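(* Let $(M,g(\tau))$, $0\le\tau\le\bar\tau$ (with $\bar\tau>0$), be a backwards Ricci flow $\partial_\tau g_{ij}=2R_{ij}$ which is complete for each $\tau$ and has uniformly bounded curvature operator on $[0,\bar\tau]$. Let $p\in M$, $v\in T_pM$, and let $\gamma_v(\tau)$, $0\le\tau\le\bar\tau$, be the $\mathcal{L}$-geodesic with $\gamma_v(0)=p$ and $\lim_{\tau\to0}\sqrt{\tau}\,\dot\gamma_v(\tau)=v$. Then the number of $\mathcal{L}$-conjugate points of $\gamma_v(0)$ along $\gamma_v(\tau)$ ($0\le\tau\le\bar\tau$) is finite.
   Context: The $\mathcal{L}$-length of a curve $\gamma(\tau)$, $\tau_1\le\tau\le\tau_2$, in $M$ is $\mathcal{L}(\gamma)=\int_{\tau_1}^{\tau_2}\sqrt{\tau}\,(R(\gamma(\tau))+|\dot\gamma(\tau)|^2)\,d\tau$, where $R$ is the scalar curvature and $|\cdot|$ the norm of $g(\tau)$ at parameter $\tau$. $\mathcal{L}$-geodesics are critical points of $\mathcal{L}$ among curves with fixed endpoints, i.e. with $X=\dot\gamma$ they satisfy $\nabla_XX-\frac12\nabla R+\frac1{2\tau}X+2\mathrm{Ric}(X)=0$ for $\tau>0$ (all quantities at parameter $\tau$ taken with respect to $g(\tau)$; $\mathrm{Ric}(X)$ is the vector dual to $\mathrm{Ric}(X,\cdot)$). For $\tau'>0$, the $\mathcal{L}_{\tau'}$-exponential map at $p$ is the map $T_pM\to M$, $v\mapsto\gamma_v(\tau')$. The point $\gamma_v(\tau')$ is called an $\mathcal{L}$-conjugate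 point of $p=\gamma_v(0)$ along $\gamma_v$ if $v$ is a critical point of the $\mathcal{L}_{\tau'}$-exponential map. $\mathcal{L}$-conjugate points along $\gamma_v$ are counted by their parameter values $\tau'\in(0,\bar\tau]$. *)

(* Defs.v *)
(* Riemannian geometry in local coordinates, over an abstract realType.        *)
(* A vector of R^n is a row vector 'rV[R]_n, and a symmetric 2-tensor G pairs  *)
(* u and w to u *m G *m w^T.                                                   *)
From HB Require Import structures.
From mathcomp Require Import all_boot all_order all_algebra.
From mathcomp Require Import all_classical all_reals all_analysis.

Set Implicit Arguments.
Unset Strict Implicit.
Unset Printing Implicit Defensive.

Import Order.TTheory GRing.Theory Num.Theory.
Import numFieldNormedType.Exports.

Local Open Scope classical_set_scope.
Local Open Scope ring_scope.

(* For V of finite dimension and U open this is the usual class C^k: the       *)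
(* iterated directional derivatives in constant directions, of order at most   *)
(* k, all exist and are continuous on U.                                       *)
Fixpoint Ck (R : realType) (V W : normedModType R) (k : nat)
    (U : set V) (f : V -> W) : Prop :=
  match k with
  | 0 => forall x, U x -> {for x, continuous f}
  | k'.+1 => [/\ forall x, U x -> {for x, continuous f},
                 forall x v, U x -> derivable f x v
               & forall v, Ck k' U (fun x => 'D_v f x)]
  end.

(* Smoothness on a set that need not be open (such as a closed time interval   *)
(* times an open set) means: locally the restriction of a smooth function on   *)
(* an open set.                                                                *)
Definition smooth_on (R : realType) (V W : normedModType R)
    (S : set V) (f : V -> W) : Prop :=
  forall x, S x -> exists (U : set V) (F : V -> W),
    [/\ open U, U x, forall k, Ck k U F & forall y, U y -> S y -> f y = F y].

(* Derivative at t of a function on S; one-sided at an endpoint of an interval. *)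
Definition derive_within (R : realType) (V : normedModType R)
    (S : set R) (f : R -> V) (t : R) : V :=
  lim (h^-1 *: (f (t + h) - f t) @[h --> within [set h | S (t + h)] (0 : R)^']).

Record chart (R : realType) (n : nat) (M : topologicalType) := Chart {
  chart_dom : set M ;
  chart_map : M -> 'rV[R]_n ;
  chart_inv : 'rV[R]_n -> M ;
  chart_dom_open : open chart_dom ;
  chart_codom_open : open (chart_map @` chart_dom) ;
  chart_mapK : forall q, chart_dom q -> chart_inv (chart_map q) = q ;
  chart_map_continuous : forall q, chart_dom q -> {for q, continuous chart_map} ;
  chart_inv_continuous : forall x, (chart_map @` chart_dom) x -> {for x, continuous chart_inv} }.

Definition smooth_atlas (R : realType) (n : nat) (M : topologicalType)
    (A : set (chart R n M)) : Prop :=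
  (forall q : M, exists2 c, A c & chart_dom c q) /\
  (forall c c', A c -> A c' ->
     smooth_on (chart_map c @` (chart_dom c `&` chart_dom c')) (chart_map c' \o chart_inv c)).

Definition smooth_manifold (R : realType) (n : nat) (M : topologicalType)
    (A : set (chart R n M)) : Prop :=
  [/\ hausdorff_space M, @second_countable M & smooth_atlas A].

(* A time-dependent 2-tensor: its components in the chart c, at time t, at the *)
(* point of coordinates x.                                                     *)
Definition tensor_family (R : realType) (n : nat) (M : topologicalType) :=
  chart R n M -> R -> 'rV[R]_n -> 'M[R]_n.

Record metric_family (R : realType) (n : nat) (M : topologicalType)
    (A : set (chart R n M)) (T : R) (g : tensor_family R n M) : Prop := {
  metric_family_smooth : forall c, A c ->
    smooth_on [set z : R^o * 'rV[R]_n | 0 <= z.1 <= T /\ (chart_map c @` chart_dom c) z.2]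
      (fun z => g c z.1 z.2) ;
  metric_family_sym : forall c t x, A c -> 0 <= t <= T -> (chart_map c @` chart_dom c) x ->
    (g c t x)^T = g c t x ;
  metric_family_pos : forall c t x (u : 'rV[R]_n),
    A c -> 0 <= t <= T -> (chart_map c @` chart_dom c) x -> u != 0 ->
    0 < (u *m g c t x *m u^T) 0 0 ;
  metric_family_change : forall c c' t q,
    A c -> A c' -> 0 <= t <= T -> chart_dom c q -> chart_dom c' q ->
    let J := jacobian (chart_map c' \o chart_inv c) (chart_map c q) in
    g c t (chart_map c q) = J *m g c' t (chart_map c' q) *m J^T }.

Definition pd (R : realType) (n : nat) (i : 'I_n) (f : 'rV[R]_n -> R)
    (x : 'rV[R]_n) : R := 'D_('e_i) (f : 'rV[R]_n -> R^o) x.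

(* Gamma^k_{ij} *)
Definition christoffel (R : realType) (n : nat) (G : 'rV[R]_n -> 'M[R]_n)
    (k i j : 'I_n) (x : 'rV[R]_n) : R :=
  2^-1 * \sum_l invmx (G x) k l *
    (pd i (fun y => G y j l) x + pd j (fun y => G y i l) x
     - pd l (fun y => G y i j) x).

(* R_{ijk}^l, with R(d_i, d_j) d_k = \sum_l R_{ijk}^l d_l and                  *)
(* R(X, Y) = [nabla_X, nabla_Y] - nabla_[X, Y]                                 *)
Definition riemann (R : realType) (n : nat) (G : 'rV[R]_n -> 'M[R]_n)
    (i j k l : 'I_n) (x : 'rV[R]_n) : R :=
  pd i (christoffel G l j k) x - pd j (christoffel G l i k) x
  + \sum_m (christoffel G l i m x * christoffel G m j k x
            - christoffel G l j m x * christoffel G m i k x).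

(* Ric(Y, Z) is the trace of X |-> R(X, Y) Z, positive on round spheres.       *)
Definition ricci (R : realType) (n : nat) (G : 'rV[R]_n -> 'M[R]_n)
    (x : 'rV[R]_n) : 'M[R]_n :=
  \matrix_(j, k) \sum_i riemann G i j k i x.

Definition scalar_curvature (R : realType) (n : nat)
    (G : 'rV[R]_n -> 'M[R]_n) (x : 'rV[R]_n) : R :=
  \tr (invmx (G x) *m ricci G x).

Definition gradient (R : realType) (n : nat) (G : 'rV[R]_n -> 'M[R]_n)
    (f : 'rV[R]_n -> R) (x : 'rV[R]_n) : 'rV[R]_n :=
  \row_k \sum_l invmx (G x) k l * pd l f x.

(* The quadratic part of nabla_X X, so that nabla_X X = X' + christoffel_quad. *)
Definition christoffel_quad (R : realType) (n : nat)
    (G : 'rV[R]_n -> 'M[R]_n) (x u : 'rV[R]_n) : 'rV[R]_n :=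
  \row_k \sum_i \sum_j christoffel G k i j x * u 0 i * u 0 j.

(* The curvature operator acting on 2-vectors, which are given by their        *)
(* antisymmetric matrix of components; up to a constant factor depending on    *)
(* normalization.                                                              *)
Definition curvature_operator (R : realType) (n : nat)
    (G : 'rV[R]_n -> 'M[R]_n) (x : 'rV[R]_n) (w : 'M[R]_n) : 'M[R]_n :=
  \matrix_(k, l) \sum_i \sum_j \sum_m
    invmx (G x) k m * riemann G i j m l x * w i j.

(* Squared norm \sum g_ik g_jl w^ij w^kl of a 2-vector. *)
Definition bivector_sqnorm (R : realType) (n : nat)
    (G w : 'M[R]_n) : R :=
  \sum_i \sum_j \sum_k \sum_l G i k * G j l * w i j * w k l.

Definition bounded_curvature_operator (R : realType) (n : nat)
    (M : topologicalType) (A : set (chart R n M)) (T : R)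
    (g : tensor_family R n M) : Prop :=
  exists C : R, forall c t x (w : 'M[R]_n),
    A c -> 0 <= t <= T -> (chart_map c @` chart_dom c) x -> w^T = - w ->
    bivector_sqnorm (g c t x) (curvature_operator (g c t) x w)
      <= C ^+ 2 * bivector_sqnorm (g c t x) w.

Definition is_geodesic (R : realType) (n : nat) (M : topologicalType)
    (A : set (chart R n M)) (h : chart R n M -> 'rV[R]_n -> 'M[R]_n)
    (sigma : R -> M) : Prop :=
  continuous sigma /\
  forall c, A c ->
    let x := chart_map c \o sigma in
    let S := [set s : R^o | chart_dom c (sigma s)] in
    smooth_on S x /\
    forall s, S s -> derive1 (derive1 x) s + christoffel_quad (h c) (x s) (derive1 x s) = 0.

(* Geodesic completeness. *)
Definition complete_metric (R : realType) (n : nat) (M : topologicalType)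
    (A : set (chart R n M)) (h : chart R n M -> 'rV[R]_n -> 'M[R]_n) : Prop :=
  forall c q (u : 'rV[R]_n), A c -> chart_dom c q ->
    exists sigma : R -> M,
      [/\ is_geodesic A h sigma, sigma 0 = q
        & derive1 (chart_map c \o sigma) 0 = u].

Definition backwards_ricci_flow (R : realType) (n : nat) (M : topologicalType)
    (A : set (chart R n M)) (T : R) (g : tensor_family R n M) : Prop :=
  metric_family A T g /\
  forall c t x, A c -> 0 <= t <= T -> (chart_map c @` chart_dom c) x ->
    derive_within `[0, T]%classic (fun s => g c s x) t = 2 *: ricci (g c t) x.

(* gamma : [0, T] -> M is an L-geodesic with gamma(0) = p and                  *)
(* sqrt(t) gamma'(t) -> v as t -> 0.  Here c0 is a chart at p, and v is the    *)
(* tangent vector at p given by its components in c0.                          *)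
Definition L_geodesic (R : realType) (n : nat) (M : topologicalType)
    (A : set (chart R n M)) (T : R) (g : tensor_family R n M)
    (c0 : chart R n M) (p : M) (v : 'rV[R]_n) (gamma : R -> M) : Prop :=
  [/\ {within `[0, T], continuous gamma},
      gamma 0 = p,
      (forall c, A c ->
         let x := chart_map c \o gamma in
         let X := derive_within `]0, T]%classic x in
         let S := [set t : R^o | 0 < t <= T /\ chart_dom c (gamma t)] in
         smooth_on S x /\
         forall t, S t ->
           derive_within `]0, T]%classic X t + christoffel_quad (g c t) (x t) (X t)
           - 2^-1 *: gradient (g c t) (scalar_curvature (g c t)) (x t)
           + (2 * t)^-1 *: X t
           + 2 *: (X t *m ricci (g c t) (x t) *m invmx (g c t (x t))) = 0)
    & Num.sqrt t *: derive_within `]0, T]%classic (chart_map c0 \o gamma) t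
        @[t --> 0^'+] --> v].

(* The L_t-exponential map at p, for 0 < t <= T, on T_pM identified with R^n   *)
(* through the chart c0.  L-geodesics are determined by their initial vector,  *)
(* and exist on [0, T] for a complete flow with bounded curvature; the default *)
(* value p is a dummy.                                                         *)
Definition L_exp (R : realType) (n : nat) (M : topologicalType)
    (A : set (chart R n M)) (T : R) (g : tensor_family R n M)
    (c0 : chart R n M) (p : M) (t : R) (v : 'rV[R]_n) : M :=
  xget p [set q | exists2 gamma, L_geodesic A T g c0 p v gamma & gamma t = q].

(* f is differentiable at v as a map into the manifold, with onto differential. *)
Definition regular_point (R : realType) (n m : nat) (M : topologicalType)
    (A : set (chart R n M)) (f : 'rV[R]_m -> M) (v : 'rV[R]_m) : Prop :=
  {for v, continuous f} /\
  exists c, [/\ A c, chart_dom c (f v), differentiable (chart_map c \o f) v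
              & forall y, exists u, 'd (chart_map c \o f) v u = y].

(* For a smooth f: the differential at v is not onto.  A point where f is not  *)
(* differentiable would also count as critical.                                *)
Definition critical_point (R : realType) (n m : nat) (M : topologicalType)
    (A : set (chart R n M)) (f : 'rV[R]_m -> M) (v : 'rV[R]_m) : Prop :=
  ~ regular_point A f v.

(* gamma_v(t) is L-conjugate to p along gamma_v. *)
Definition L_conjugate (R : realType) (n : nat) (M : topologicalType)
    (A : set (chart R n M)) (T : R) (g : tensor_family R n M)
    (c0 : chart R n M) (p : M) (v : 'rV[R]_n) (t : R) : Prop :=
  critical_point A (L_exp A T g c0 p t) v.

(* Main.v *)
(** In the parameter s = sqrt t the L-length becomes the integral of |dx/ds|^2 / 2 + 2 s^2 R, which is regular at
    s = 0. Hence the L-geodesics from p are the projections of the solutions of a smooth Hamiltonian system on the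
    cotangent bundle, with initial covector 2 v^flat at p, and they depend differentiably on v. Let the rows of (A(s), B(s))
    be the position and momentum parts of the Jacobi fields vanishing at p. The symplectic form vanishes on them, so
    A B^T is symmetric, and they are linearly independent. If u A(s0) = 0 then the component of u A(s) along u B(s0) has
    a nonzero derivative at s0, because the Hamiltonian is strictly convex in the momentum. By compactness of the
    sphere of all u, A(s) is invertible for s near s0 and distinct from s0. So A is invertible on [0, sqrt T] except at
    finitely many parameters, and where A is invertible the L-exponential map is regular at v. *)

(* The parameter s = sqrt t removes the singular term X / (2 t). At s = 0 the matrix A vanishes
   while B is invertible, so the isolation argument at s0 = 0 also prevents conjugate parameters
   from accumulating at 0. Three obstacles shape the proof. The geodesic may cross many charts, so a
   solution is a base curve together with covector components in every chart, and cotangent lifts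
   carry the field and the symplectic form from chart to chart. The L-exponential map is defined by
   a choice among geodesics, so that its values near v must be identified, through existence and
   uniqueness, with those of a family of solutions; differentiability is then carried as a first
   order expansion with quadratic error, a form that composes under flows and under changes of
   chart. Finally, the metric is smooth only up to the ends of a closed time interval: local
   computations use smooth extensions beyond it, and these are compared with the original data on
   slices of constant time, where position and momentum derivatives live. *)
From HB Require Import structures.
Require Import Defs.
From mathcomp Require Import all_boot all_order all_algebra.
From mathcomp Require Import all_classical all_reals all_analysis.
From mathcomp Require Import ring lra.

Set Implicit Arguments.
Unset Strict Implicit.
Unset Printing Implicit Defensive.

Import Order.TTheory GRing.Theory Num.Theory.
Import numFieldNormedType.Exports.

Local Open Scope classical_set_scope.
Local Open Scope ring_scope.

(** * Functions of class C^k *)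

Section CkGeneral.
Variables (R : realType) (V W : normedModType R).
Implicit Types (U : set V) (f g : V -> W).

Lemma Ck_pred k U f : Ck k.+1 U f -> Ck k U f.
Proof.
elim: k f => [|k IH] f [cf df Df]; first exact: cf.
by split=> // v; apply: IH.
Qed.

Lemma Ck_continuous k U f x : Ck k U f -> U x -> {for x, continuous f}.
Proof. by case: k => [|k]; [move=> cf|case=> cf _ _]; exact: cf. Qed.

Lemma Ck_le k l U f : (k <= l)%N -> Ck l U f -> Ck k U f.
Proof.
move/subnK <-; elim: (l - k)%N => [|d IH] //; rewrite addSn => /Ck_pred; exact: IH.
Qed.

Lemma Ck_sub k U U' f : U' `<=` U -> Ck k U f -> Ck k U' f.
Proof.
move=> sU; elim: k f => [|k IH] f; first by move=> cf x Ux; exact: cf (sU _ Ux).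
case=> cf df Df; split=> [x Ux|x v Ux|v].
- exact: cf (sU _ Ux).
- exact: df (sU _ Ux).
- exact: IH (Df v).
Qed.

Lemma Ck_derive k U f v : Ck k.+1 U f -> Ck k U (fun x => 'D_v f x).
Proof. by case=> _ _ Df; exact: Df. Qed.

Lemma Ck_derivable k U f x v : Ck k.+1 U f -> U x -> derivable f x v.
Proof. by case=> _ df _; exact: df. Qed.

Lemma Ck_ext k U f g : open U -> (forall x, U x -> f x = g x) -> Ck k U f -> Ck k U g.
Proof.
move=> oU; elim: k f g => [|k IH] f g fg.
  move=> cf x Ux; have fgx : {near x, f =1 g}.
    by near=> y; apply: fg; near: y; exact: open_nbhs_nbhs.
  rewrite /prop_for /continuous_at -(fg x Ux); apply: cvg_trans (cf x Ux).
  exact: near_eq_cvg.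
case=> cf df Df.
have fgx x : U x -> {near x, f =1 g}.
  by move=> Ux; near=> y; apply: fg; near: y; exact: open_nbhs_nbhs.
split.
- move=> x Ux; rewrite /prop_for /continuous_at -(fg x Ux).
  apply: cvg_trans (cf x Ux); exact: near_eq_cvg (fgx x Ux).
- by move=> x v Ux; apply: near_eq_derivable (fgx x Ux) (df x v Ux).
- move=> v; apply: IH (Df v) => x Ux; exact: near_eq_derive (fgx x Ux).
Unshelve. all: by end_near. Qed.

Lemma Ck_cst k U (a : W) : Ck k U (fun=> a).
Proof.
elim: k a => [|k IH] a; first by move=> x _; exact: cvg_cst.
split=> [x _|x v _|v]; [exact: cvg_cst|exact: derivable_cst|].
by under eq_fun do rewrite derive_cst; exact: IH.
Qed.

Lemma CkD k U f g : open U -> Ck k U f -> Ck k U g -> Ck k U (fun x => f x + g x).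
Proof.
move=> oU; elim: k f g => [|k IH] f g; first by move=> cf cg x Ux; exact: cvgD (cf x Ux) (cg x Ux).
case=> cf df Df [cg dg Dg]; split.
- by move=> x Ux; exact: cvgD (cf x Ux) (cg x Ux).
- by move=> x v Ux; apply: derivableD; [exact: df|exact: dg].
- move=> v; apply: Ck_ext oU _ (IH _ _ (Df v) (Dg v)) => x Ux /=.
  by rewrite -deriveD; [|exact: df|exact: dg].
Qed.

End CkGeneral.

Section CkScalar.
Variables (R : realType) (V : normedModType R).
Implicit Types (U : set V) (f g : V -> R).

Lemma CkM k U f g : open U -> Ck k U f -> Ck k U g -> Ck k U (fun x => f x * g x).
Proof.
move=> oU; elim: k f g => [|k IH] f g; first by move=> cf cg x Ux; exact: cvgM (cf x Ux) (cg x Ux).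
move=> Cf Cg; have Cf' := Ck_pred Cf; have Cg' := Ck_pred Cg.
case: Cf Cg => cf df Df [cg dg Dg]; split.
- by move=> x Ux; exact: cvgM (cf x Ux) (cg x Ux).
- by move=> x v Ux; apply: derivableM; [exact: df|exact: dg].
- move=> v; apply: Ck_ext oU _ (CkD oU (IH _ _ Cf' (Dg v)) (IH _ _ Cg' (Df v))) => x Ux /=.
  by rewrite deriveM; [|exact: df|exact: dg].
Qed.

Lemma CkV k U f : open U -> (forall x, U x -> f x != 0) -> Ck k U f -> Ck k U (fun x => (f x)^-1).
Proof.
move=> oU fn0; elim: k => [|k IH]; first by move=> cf x Ux; exact: cvgV (fn0 _ Ux) (cf x Ux).
move=> Cf; have Cf' := Ck_pred Cf; have Ci := IH Cf'.
case: Cf => cf df Df; split.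
- by move=> x Ux; exact: cvgV (fn0 _ Ux) (cf x Ux).
- by move=> x v Ux; apply: derivableV; [exact: fn0|exact: df].
- move=> v; have CN1 : Ck k U (fun=> (-1 : R)) by exact: Ck_cst.
  apply: Ck_ext oU _ (CkM oU (CkM oU CN1 (CkM oU Ci Ci)) (Df v)) => x Ux /=.
  rewrite deriveV; [|exact: fn0|exact: df].
  by rewrite mulN1r; congr (- _ * _); rewrite expr2 invfM.
Qed.

End CkScalar.

Lemma nearN (R : realType) (V : normedModType R) (x : V) (P : set V) :
  (\forall y \near x, P y) <-> exists2 d : R, 0 < d & forall y : V, `|y - x| < d -> P y.
Proof.
split=> [/nbhs_ballP[d /= d0 Bd]|[d d0 Bd]].
  by exists d => // y yx; apply: Bd; rewrite -ball_normE /ball_ /= distrC.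
apply/nbhs_ballP; exists d => //= y; rewrite -ball_normE /ball_ /= distrC; exact: Bd.
Qed.

Lemma near_normE (R : realType) (V : normedModType R) (x : V) (P : set V) :
  (\forall y \near x, P y) -> exists2 d : R, 0 < d & forall y : V, `|y - x| < d -> P y.
Proof. by move/nearN. Qed.

Section CkBig.
Variables (R : realType) (V : normedModType R).
Implicit Types (U : set V) (f g : V -> R).

Lemma Ck_sum k U (I : Type) (r : seq I) (F : I -> V -> R) : open U ->
  (forall i, Ck k U (F i)) -> Ck k U (fun x => \sum_(i <- r) F i x).
Proof.
move=> oU CF; elim: r => [|i r IH].
  by apply: (Ck_ext oU _ (Ck_cst k U (0 : R))) => x _; rewrite big_nil.
by apply: (Ck_ext oU _ (CkD oU (CF i) IH)) => x _; rewrite big_cons.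
Qed.

Lemma Ck_prod k U (I : Type) (r : seq I) (F : I -> V -> R) : open U ->
  (forall i, Ck k U (F i)) -> Ck k U (fun x => \prod_(i <- r) F i x).
Proof.
move=> oU CF; elim: r => [|i r IH].
  by apply: (Ck_ext oU _ (Ck_cst k U (1 : R))) => x _; rewrite big_nil.
by apply: (Ck_ext oU _ (CkM oU (CF i) IH)) => x _; rewrite big_cons.
Qed.

Lemma CkN k U f : open U -> Ck k U f -> Ck k U (fun x => - f x).
Proof.
move=> oU Cf; apply: (Ck_ext oU _ (CkM oU (Ck_cst k U (-1 : R)) Cf)) => x _.
by rewrite mulN1r.
Qed.

Lemma CkB k U f g : open U -> Ck k U f -> Ck k U g -> Ck k U (fun x => f x - g x).
Proof. by move=> oU Cf Cg; apply: CkD => //; exact: CkN. Qed.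

Lemma Ck_det k U n (M : V -> 'M[R]_n) : open U -> (forall i j, Ck k U (fun x => M x i j)) ->
  Ck k U (fun x => \det (M x)).
Proof.
move=> oU CM; apply: Ck_sum => // s; apply: CkM => //; first exact: Ck_cst.
by apply: Ck_prod => // i; exact: CM.
Qed.

(** By Cramer's formula the entries are cofactors divided by the determinant, hence rational
    expressions in the entries of M. *)
Lemma Ck_invmx k U n (M : V -> 'M[R]_n) : open U -> (forall i j, Ck k U (fun x => M x i j)) ->
  (forall x, U x -> M x \in unitmx) -> forall i j, Ck k U (fun x => invmx (M x) i j).
Proof.
move=> oU CM uM i j.
have CV : Ck k U (fun x => (\det (M x))^-1).
  by apply: CkV => //; [move=> x /uM; rewrite unitmxE unitfE|exact: Ck_det].
apply: (@Ck_ext _ _ _ k U (fun x => (\det (M x))^-1 * cofactor (M x) j i)) => //.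
  by move=> x Ux; rewrite /invmx uM // !mxE.
apply: CkM => //; apply: CkM => //; first exact: Ck_cst.
by apply: Ck_det => // a b; under eq_fun do rewrite !mxE; exact: CM.
Qed.

End CkBig.

Lemma dist_half (R : realFieldType) (a b c e : R) :
  `|a - c| < e / 2 -> `|b - c| < e / 2 -> `|a - b| <= e.
Proof.
by move=> H1 H2; rewrite -(subrKA c) (splitr e) (le_trans (ler_normD _ _)) // lerD ?ltW // distrC.
Qed.

(** * Mean value theorem on segments, linearity in the direction, symmetry of second derivatives *)

Section LineMVT.
Variables (R : realType) (V : normedModType R).
Implicit Types (U : set V) (f : V -> R).

Lemma is_derive_line f a v (t : R) : derivable f (a + t *: v) v ->
  is_derive t 1 (fun s : R => f (a + s *: v)) ('D_v f (a + t *: v)).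
Proof.
move=> df.
have E : (fun h : R => h^-1 *: (f (a + (h *: (1 : R) + t) *: v) - f (a + t *: v))) =
         (fun h : R => h^-1 *: (f (h *: v + (a + t *: v)) - f (a + t *: v))).
  apply/funext => h; congr (_ *: (f _ - _)).
  by rewrite scalerDl addrCA scaler1.
by split; rewrite /derivable /derive E.
Qed.

Lemma segment_MVT f a v : (forall t : R, 0 <= t <= 1 -> derivable f (a + t *: v) v) ->
  exists2 t : R, 0 < t < 1 & f (a + v) - f a = 'D_v f (a + t *: v).
Proof.
move=> H; pose g (s : R) : R := f (a + s *: v).
have [|s s01|c c01] := @MVT R g (fun t => 'D_v f (a + t *: v)) 0 1 ltr01.
- by move=> s; rewrite in_itv /= => /andP[s0 s1]; apply: is_derive_line; apply H; rewrite !ltW.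
- apply: derivable_within_continuous => {s s01} s; rewrite in_itv /= => s01.
  by have [] := is_derive_line (H _ s01).
- move=> E; exists c; first by move: c01; rewrite in_itv.
  by move: E; rewrite /g subr0 mulr1 scale1r scale0r addr0.
Qed.

Lemma is_deriveZdir f x v (k : R) : derivable f x v -> derivable f x (k *: v) ->
  'D_(k *: v) f x = k * 'D_v f x.
Proof.
have x0 w : x + (0 : R) *: w = x by rewrite scale0r addr0.
move=> dv dkv.
have Dv : is_derive (0 : R) 1 (fun s : R => f (x + s *: v)) ('D_v f x).
  by rewrite -{2}(x0 v); apply: is_derive_line; rewrite x0.
have Dkv : is_derive (0 : R) 1 (fun s : R => f (x + s *: (k *: v))) ('D_(k *: v) f x).
  by rewrite -{2}(x0 (k *: v)); apply: is_derive_line; rewrite x0.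
have kd : is_derive (0 : R) 1 (fun s : R => s * k) k.
  have : is_derive (0 : R) 1 ((fun s : R => s) * cst k) ((0 : R) *: 0 + k *: (1 : R)).
    exact: is_deriveM.
  by rewrite scale0r add0r scaler1.
have Dv' : is_derive ((fun s : R => s * k) (0 : R)) 1 (fun s : R => f (x + s *: v)) ('D_v f x).
  by rewrite mul0r.
have [_] := @is_derive1_comp R (fun s : R => f (x + s *: v)) (fun s : R => s * k) 0 _ _ Dv' kd.
rewrite mulrC => <-; have [_ <-] := Dkv.
suff -> : (fun s : R => f (x + s *: (k *: v))) = (fun s : R => f (x + s *: v)) \o (fun s : R => s * k) by [].
by apply/funext => s /=; rewrite scalerA.
Qed.

(** Existence of all directional derivatives does not give additivity. The increment is split along
    the path x, x + h u, x + h u + h v; the mean value theorem evaluates the second leg at a point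
    near x, and continuity of ['D_v f] brings it back to x. *)
Lemma derive_additive U f x u v : open U -> U x -> Ck 1 U f ->
  'D_(u + v) f x = 'D_u f x + 'D_v f x.
Proof.
move=> oU Ux [cf df Df].
suff : (fun h : R => h^-1 *: (f (h *: (u + v) + x) - f x)) @ 0^' --> 'D_v f x + 'D_u f x.
  by move=> H; rewrite [RHS]addrC; apply: cvg_lim.
have -> : (fun h : R => h^-1 *: (f (h *: (u + v) + x) - f x)) =
   (fun h : R => h^-1 *: (f (h *: u + x + h *: v) - f (h *: u + x))
                 + h^-1 *: (f (h *: u + x) - f x)).
  apply/funext => h; rewrite -scalerDr; congr (_ *: _).
  rewrite [RHS]addrA; congr (_ - _); rewrite subrK; congr (f _).
  by rewrite scalerDr addrAC.
apply: cvgD; last exact: (df x u Ux).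
apply/cvgrPdist_lt => /= e e0.
have /cvgrPdist_lt/(_ _ e0) H1 : {for x, continuous (fun y => 'D_v f y)} by exact: Df.
have H2 : \forall y \near x, U y by exact: open_nbhs_nbhs.
have [d d0 Bd] := near_normE (filterI H1 H2).
have B1 : 0 < 1 + `|u| + `|v| by rewrite -addrA ltr_pwDl // addr_ge0.
near=> h.
have h0 : h != 0 by near: h; exact: nbhs_dnbhs_neq.
have hd : `|h| < d / (1 + `|u| + `|v|) by near: h; apply: dnbhs0_lt; rewrite divr_gt0.
have Bt (t : R) : 0 <= t <= 1 -> `|h *: u + x + t *: (h *: v) - x| < d.
  case/andP=> t0 t1.
  have -> : h *: u + x + t *: (h *: v) - x = h *: u + t *: (h *: v) by rewrite addrAC addrK.
  apply: (@le_lt_trans _ _ (`|h| * (1 + `|u| + `|v|))); last by rewrite -ltr_pdivlMr.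
  apply: (le_trans (ler_normD _ _)); rewrite !normrZ -addrA mulrDr ler_wpDl ?mulr_ge0 //.
  rewrite mulrDr lerD // ler_piMl ?mulr_ge0 //.
  by rewrite ger0_norm.
have [t|t t01 ->] := @segment_MVT f (h *: u + x) (h *: v).
  by move=> /Bt /Bd[_ Uy]; exact: df.
have t01' : 0 <= t <= 1 by case/andP: t01 => ? ?; rewrite !ltW.
have [P1 Uy] := Bd _ (Bt _ t01').
rewrite is_deriveZdir; [|exact: df|exact: df].
by rewrite /GRing.scale /= mulKf.
Unshelve. all: by end_near. Qed.

Lemma derive_dir_sum U f x (I : Type) (r : seq I) (w : I -> V) : open U -> U x -> Ck 1 U f ->
  'D_(\sum_(i <- r) w i) f x = \sum_(i <- r) 'D_(w i) f x.
Proof.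
move=> oU Ux Cf; elim: r => [|i r IH]; first by rewrite !big_nil derive0.
by rewrite !big_cons (derive_additive _ _ oU Ux Cf) IH.
Qed.

(** The mean value theorem is applied twice: along u to the difference [g] of f on two parallel
    segments, then along v to ['D_u f]. *)
Lemma second_difference U f x u v (h d : R) : (forall y : V, `|y - x| < d -> U y) -> Ck 2 U f ->
  0 < h -> h * (`|u| + `|v|) < d ->
  exists2 p, `|p - x| < d & f (x + h *: u + h *: v) - f (x + h *: u) - f (x + h *: v) + f x
     = h ^+ 2 * 'D_v (fun y => 'D_u f y) p.
Proof.
move=> BU [cf df Df] h0 hd.
have B (s t : R) : 0 <= s <= 1 -> 0 <= t <= 1 -> `|x + s *: (h *: u) + t *: (h *: v) - x| < d.
  move=> /andP[s0 s1] /andP[t0 t1]; rewrite addrC !addrA addNr add0r.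
  apply: le_lt_trans hd; apply: (le_trans (ler_normD _ _)).
  rewrite !normrZ (ger0_norm s0) (ger0_norm t0) (gtr0_norm h0) mulrDr.
  by apply: lerD; rewrite ler_piMl // mulr_ge0 // ltW.
have I0 : 0 <= (0 : R) <= 1 by rewrite lexx ler01.
have I1 : 0 <= (1 : R) <= 1 by rewrite lexx ler01.
pose g (s : R) : R := f (x + h *: v + s *: (h *: u)) - f (x + s *: (h *: u)).
pose dg (s : R) : R := h * 'D_u f (x + h *: v + s *: (h *: u)) - h * 'D_u f (x + s *: (h *: u)).
have gd (s : R) : 0 <= s <= 1 -> is_derive s 1 g (dg s).
  move=> s01.
  have U1 : U (x + h *: v + s *: (h *: u)).
    by apply: BU; have := B _ _ s01 I1; rewrite scale1r [x + _ + h *: v]addrAC.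
  have U2 : U (x + s *: (h *: u)).
    by apply: BU; have := B _ _ s01 I0; rewrite scale0r addr0.
  rewrite /dg -!is_deriveZdir; try exact: df.
  by apply: is_deriveB; apply: is_derive_line; exact: df.
have [|s|s s01] := @MVT R g dg 0 1 ltr01.
- by move=> s; rewrite in_itv /= => /andP[s0 s1]; apply: gd; rewrite !ltW.
- apply: derivable_within_continuous => {}s; rewrite in_itv /= => s01.
  by have [] := gd _ s01.
rewrite in_itv /= in s01; have s01' : 0 <= s <= 1 by case/andP: s01 => ? ?; rewrite !ltW.
rewrite /g /dg subr0 mulr1 scale1r scale0r !addr0 => E.
have [_ dD _] := Df u.
have [t|t t01] := @segment_MVT (fun y => 'D_u f y) (x + s *: (h *: u)) (h *: v).
  by move=> t01; apply: dD; apply: BU; exact: B.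
have t01' : 0 <= t <= 1 by case/andP: t01 => ? ?; rewrite !ltW.
move=> E2; exists (x + s *: (h *: u) + t *: (h *: v)); first exact: B.
rewrite (addrAC x) -[LHS]addrA [- _ + _]addrC; move: E; rewrite opprB.
rewrite (addrAC x (h *: v) (s *: (h *: u))) -mulrBr E2 is_deriveZdir; first last.
- by apply: dD; apply: BU; exact: B.
- by apply: dD; apply: BU; exact: B.
by rewrite mulrA expr2 => ->.
Qed.

(** The second difference is symmetric in u and v, so the two mixed derivatives agree at two points
    p and q near x; continuity of both at x makes them arbitrarily close there. *)
Lemma derive_commute U f x u v : open U -> U x -> Ck 2 U f ->
  'D_u (fun y => 'D_v f y) x = 'D_v (fun y => 'D_u f y) x.
Proof.
move=> oU Ux C2; apply/eqP; rewrite -subr_eq0 -normr_le0; apply/ler_addgt0Pl => e e0; rewrite addr0.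
have e2 : 0 < e / 2 by rewrite divr_gt0.
have [_ _ Df] := C2.
have [_ _ /(_ v) Duv] := Df u; have [_ _ /(_ u) Dvu] := Df v.
have /cvgrPdist_lt/(_ _ e2) H1 := Duv x Ux.
have /cvgrPdist_lt/(_ _ e2) H2 := Dvu x Ux.
have H3 : \forall y \near x, U y by exact: open_nbhs_nbhs.
have [d d0 Bd] := near_normE (filterI (filterI H1 H2) H3).
have BU y : `|y - x| < d -> U y by move=> /Bd[].
pose h := d / (2 * (`|u| + `|v| + 1)).
have uv1 : 0 < `|u| + `|v| + 1 by rewrite ltr_wpDl // addr_ge0.
have h0 : 0 < h by rewrite divr_gt0 // mulr_gt0.
have hd : h * (`|u| + `|v|) < d.
  rewrite /h mulrAC ltr_pdivrMr ?mulr_gt0 // ltr_pM2l //.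
  by rewrite (@lt_le_trans _ _ (`|u| + `|v| + 1)) ?ltrDl // ler_peMl ?ltW // ltrDl.
have hd' : h * (`|v| + `|u|) < d by rewrite [`|v| + _]addrC.
have [p pB Ep] := second_difference BU C2 h0 hd.
have [q qB Eq] := second_difference BU C2 h0 hd'.
have Epq : 'D_v (fun y => 'D_u f y) p = 'D_u (fun y => 'D_v f y) q.
  have h2 : h ^+ 2 != 0 by rewrite expf_neq0 // gt_eqF.
  apply: (mulfI h2); apply: (etrans (esym Ep)); apply: etrans Eq.
  by rewrite [x + h *: u + h *: v]addrAC; congr (_ + f x); exact: addrAC.
have [[P1 _] _] := Bd _ pB; have [[_ P2] _] := Bd _ qB.
move: Epq P1 P2 => -> P1 P2.
exact: dist_half P2 P1.
Qed.

End LineMVT.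

(** * Maximum norm of matrices, and differentiability from continuous partial derivatives *)

Section MxNorm.
Variables (R : realType).

Lemma mxnorm_entry m n (M : 'M[R]_(m, n)) i j : `|M i j| <= `|M|.
Proof.
rewrite [leRHS]/Num.Def.normr /= mx_normrE.
exact: (@le_bigmax _ _ _ 0 (fun ij : 'I_m * 'I_n => `|M ij.1 ij.2|) (i, j)).
Qed.

Lemma mxnorm_le m n (M : 'M[R]_(m, n)) e : 0 <= e -> (forall i j, `|M i j| <= e) -> `|M| <= e.
Proof.
move=> e0 H; rewrite [leLHS]/Num.Def.normr /= mx_normrE.
by apply: bigmax_le => // -[i j] _; exact: H.
Qed.

End MxNorm.

Lemma differentiable_of_remainder (R : realType) (V W : normedModType R) (f : V -> W)
    (L : {linear V -> W}) x : continuous L ->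
  (forall e : R, 0 < e -> \forall y \near x, `|f y - f x - L (y - x)| <= e * `|y - x|) ->
  is_diff x f L.
Proof.
move=> cL H.
have E : f \o shift x = cst (f x) + L +o_ 0 id.
  apply/eqaddoP => e /H He.
  have [d d0 Bd] := near_normE He; apply/nearN; exists d => //= h; rewrite subr0 => hd.
  have /Bd : `|(h + x) - x| < d by rewrite addrK.
  rewrite addrK; congr (`|_| <= _).
  by rewrite -[RHS]/(f (h + x) - (f x + L h)) opprD addrA.
have dE := diff_unique cL E.
by apply: DiffDef => //; apply/diff_locallyP; rewrite dE.
Qed.

(** Reduces directional derivatives to functions of one real variable, for which derivability and
    differentiability coincide. *)
Lemma is_derive_lineP (R : realType) (V W : normedModType R) (f : V -> W) a v l :
  is_derive a v f l <-> is_derive (0 : R) 1 (fun s : R => f (a + s *: v)) l.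
Proof.
have E : (fun h : R => h^-1 *: (f (a + (h *: (1 : R) + 0) *: v) - f (a + (0 : R) *: v))) =
         (fun h : R => h^-1 *: (f (h *: v + a) - f a)).
  apply/funext => h; congr (_ *: (f _ - f _)); last by rewrite scale0r addr0.
  by rewrite scaler1 addr0 addrC.
by split=> -[]; rewrite /derivable /derive => H1 H2; split; rewrite /derivable /derive; rewrite ?E // -E.
Qed.

Lemma is_derive_comp_diff (R : realType) (V W W' : normedModType R) (f : W -> W') (g : V -> W) x v l :
  differentiable f (g x) -> is_derive x v g l -> is_derive x v (f \o g) ('d f (g x) l).
Proof.
move=> df /is_derive_lineP gl; apply/is_derive_lineP.
pose G (s : R) := g (x + s *: v).
have G0 : G 0 = g x by rewrite /G scale0r addr0.
have [dG DG] := gl; have diffG : differentiable G 0 by exact/derivable1_diffP.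
have dfG : differentiable f (G 0) by rewrite G0.
have dfg : differentiable (f \o G) (0 : R) by exact: differentiable_comp.
split; first exact: diff_derivable.
by rewrite -[LHS]/('D_1 (f \o G) 0) deriveE // diff_comp //= -G0 -DG deriveE.
Qed.

(** The candidate differential of a scalar function, with c its partial derivatives, packaged as a
    linear map. *)
Definition dot_row (R : realType) m (c : 'I_m -> R) (v : 'rV[R]_m) : R := \sum_i v 0 i * c i.

Fact dot_row_linear (R : realType) m (c : 'I_m -> R) : linear (dot_row c : 'rV[R]_m -> R^o).
Proof.
move=> k u v; rewrite /dot_row scaler_sumr -big_split /=; apply: eq_bigr => i _.
by rewrite !mxE mulrDl -mulrA.
Qed.

HB.instance Definition _ (R : realType) m (c : 'I_m -> R) :=
  GRing.isLinear.Build R 'rV[R]_m R^o _ (dot_row c) (dot_row_linear c).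

Lemma dot_row_continuous (R : realType) m (c : 'I_m -> R) : continuous (dot_row c).
Proof.
move=> x; apply: differentiable_continuous.
have -> : dot_row c = \sum_i (fun v : 'rV[R]_m => v 0 i) * cst (c i).
  by apply/funext => v; rewrite fct_sumE.
apply: differentiable_sum => i; apply: differentiableM; first exact: differentiable_coord.
exact: differentiable_cst.
Qed.

Section RowCalculus.
Variables (R : realType) (m : nat).
Implicit Types (U : set 'rV[R]_m) (f : 'rV[R]_m -> R).

Lemma derive_row U f x v : open U -> U x -> Ck 1 U f ->
  'D_v f x = \sum_i v 0 i * 'D_('e_i) f x.
Proof.
move=> oU Ux Cf; rewrite {1}(row_sum_delta v) (derive_dir_sum _ _ oU Ux Cf).
by apply: eq_bigr => i _; rewrite is_deriveZdir //; case: Cf => _ df _; exact: df.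
Qed.

(** The mean value theorem on the segment from x to y replaces the increment by partial derivatives
    at an intermediate point; there are finitely many of them and they are continuous at x. *)
Lemma C1_remainder U f x : open U -> U x -> Ck 1 U f -> forall e : R, 0 < e ->
  \forall y \near x, `|f y - f x - \sum_i (y - x) 0 i * 'D_('e_i) f x| <= e * `|y - x|.
Proof.
move=> oU Ux Cf e e0; have [cf df Df] := Cf.
(* The m partial derivatives contribute at most e m / (m + 1); the successor keeps the denominator
   nonzero when m = 0. *)
have e1 : 0 < e / m.+1%:R by rewrite divr_gt0.
have H1 : \forall y \near x, forall i : 'I_m, `|'D_('e_i) f x - 'D_('e_i) f y| < e / m.+1%:R.
  apply: (@filter_forall _ _ (fun (i : 'I_m) y => `|'D_('e_i) f x - 'D_('e_i) f y| < e / m.+1%:R) (nbhs x) _) => i.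
  have := Df 'e_i x Ux.
  by move/cvgrPdist_lt/(_ _ e1).
have H2 : \forall y \near x, U y by exact: open_nbhs_nbhs.
have [d d0 Bd] := near_normE (filterI H1 H2).
apply/nearN; exists d => // y yd.
have Bt (t : R) : 0 <= t <= 1 -> `|x + t *: (y - x) - x| < d.
  case/andP=> t0 t1; rewrite addrC addKr normrZ; apply: le_lt_trans yd.
  by rewrite ger0_norm // ler_piMl.
have [t|t t01] := @segment_MVT _ _ f x (y - x).
  by move=> /Bt /Bd[_ Uy]; exact: df.
have -> : x + (y - x) = y by rewrite addrC subrK.
move=> ->; have t01' : 0 <= t <= 1 by case/andP: t01 => ? ?; rewrite !ltW.
have [Hi Uz] := Bd _ (Bt _ t01').
rewrite (derive_row _ oU Uz Cf) -sumrB (le_trans (ler_norm_sum _ _ _)) //.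
apply: (@le_trans _ _ (\sum_(i < m) `|y - x| * (e / m.+1%:R))).
  apply: ler_sum => i _; rewrite -mulrBr normrM ler_pM //; first exact: mxnorm_entry.
  by rewrite distrC ltW.
rewrite sumr_const card_ord -[leLHS]mulr_natr -[leLHS]mulrA [leRHS]mulrC ler_wpM2l //.
by rewrite mulrAC ler_pdivrMr // ler_wpM2l ?ltW // ltr_nat.
Qed.

Lemma C1_differentiable U f x : open U -> U x -> Ck 1 U f -> differentiable f x.
Proof.
move=> oU Ux Cf.
suff [] : is_diff x (f : 'rV[R]_m -> R^o) (dot_row (fun i => 'D_('e_i) f x)) by [].
apply: differentiable_of_remainder; first exact: dot_row_continuous.
exact: C1_remainder Cf.
Qed.

Lemma C1_diff U f x v : open U -> U x -> Ck 1 U f ->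
  'd f x v = \sum_i v 0 i * 'D_('e_i) f x.
Proof.
move=> oU Ux Cf; rewrite -(derive_row _ oU Ux Cf) deriveE //; exact: C1_differentiable Cf.
Qed.

Lemma ball_segment (a b x : 'rV[R]_m) (d t : R) : `|a - x| < d -> `|b - x| < d -> 0 <= t <= 1 ->
  `|a + t *: (b - a) - x| < d.
Proof.
move=> xa xb /andP[t0 t1].
have -> : a + t *: (b - a) - x = (1 - t) *: (a - x) + t *: (b - x).
  by apply/rowP => i; rewrite !mxE; ring.
apply: (le_lt_trans (ler_normD _ _)); rewrite !normrZ (ger0_norm t0) ger0_norm ?subr_ge0 //.
have M : Num.max `|a - x| `|b - x| < d by rewrite gt_max xa xb.
apply: le_lt_trans M; set M := Num.max _ _.
have -> : M = (1 - t) * M + t * M by ring.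
by apply: lerD; apply: ler_wpM2l; rewrite ?subr_ge0 // /M le_max lexx ?orbT.
Qed.

Variables (U : set 'rV[R]_m) (x : 'rV[R]_m) (d : R).
Hypotheses (oU : open U) (BU : forall y : 'rV[R]_m, `|y - x| < d -> U y).

Lemma ball_MVT f (a b : 'rV[R]_m) : Ck 1 U f -> `|a - x| < d -> `|b - x| < d ->
  exists2 c : 'rV[R]_m, `|c - x| < d /\ `|c - a| <= `|b - a| & f b - f a = \sum_i (b - a) 0 i * 'D_('e_i) f c.
Proof.
move=> Cf xa xb.
have Us (t : R) : 0 <= t <= 1 -> U (a + t *: (b - a)) by move=> t01; apply: BU; exact: ball_segment.
have [t t01|t t01] := @segment_MVT _ _ f a (b - a).
  exact: (Ck_derivable Cf (Us t t01)).
have t01' : 0 <= t <= 1 by case/andP: t01 => ? ?; rewrite !ltW.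
have -> : a + (b - a) = b by rewrite addrC subrK.
move=> E; exists (a + t *: (b - a)).
  split; first exact: ball_segment.
  rewrite addrC addKr normrZ; case/andP: t01' => t0 t1.
  by rewrite ger0_norm // ler_piMl.
by rewrite E; apply: derive_row Cf => //; exact: Us.
Qed.

Lemma ball_lipschitz f (a b : 'rV[R]_m) (K : R) : Ck 1 U f ->
  (forall (y : 'rV[R]_m) (i : 'I_m), `|y - x| < d -> `|'D_('e_i) f y| <= K) -> `|a - x| < d -> `|b - x| < d ->
  `|f b - f a| <= m%:R * K * `|b - a|.
Proof.
move=> Cf HK xa xb; have [c [xc _] ->] := ball_MVT Cf xa xb.
apply: (le_trans (ler_norm_sum _ _ _)).
apply: (@le_trans _ _ (\sum_(i < m) `|b - a| * K)).
  by apply: ler_sum => i _; rewrite normrM ler_pM //; [exact: mxnorm_entry|exact: HK].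
by rewrite sumr_const card_ord -[leLHS]mulr_natl mulrCA mulrC.
Qed.

(** Taylor's inequality: the mean value theorem at an intermediate point c, followed by the
    Lipschitz bound for the first derivatives between a and c. Each application contributes a factor
    m from the sum over coordinates. *)
Lemma ball_quadratic f (a b : 'rV[R]_m) (K : R) : Ck 2 U f -> 0 <= K ->
  (forall (y : 'rV[R]_m) (i j : 'I_m), `|y - x| < d -> `|'D_('e_j) (fun z => 'D_('e_i) f z) y| <= K) ->
  `|a - x| < d -> `|b - x| < d ->
  `|f b - f a - \sum_i (b - a) 0 i * 'D_('e_i) f a| <= m%:R * (m%:R * K) * `|b - a| ^+ 2.
Proof.
move=> Cf K0 HK xa xb; have [c [xc ca] ->] := ball_MVT (Ck_pred Cf) xa xb.
rewrite -sumrB; apply: (le_trans (ler_norm_sum _ _ _)).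
apply: (@le_trans _ _ (\sum_(i < m) `|b - a| * (m%:R * K * `|b - a|))).
  apply: ler_sum => i _; rewrite -mulrBr normrM ler_pM //; first exact: mxnorm_entry.
  apply: (@le_trans _ _ (m%:R * K * `|c - a|)).
    by apply: (ball_lipschitz (Ck_derive _ Cf)) => // y j; exact: HK.
  by rewrite ler_wpM2l // mulr_ge0.
rewrite sumr_const card_ord -[leLHS]mulr_natl expr2 -!mulrA ler_wpM2l //.
by rewrite mulrCA ler_wpM2l // mulrCA.
Qed.

End RowCalculus.

Lemma cvg_mxP (R : realType) (T : Type) (F : set_system T) (FF : Filter F) m n
    (M : T -> 'M[R]_(m, n)) (L : 'M[R]_(m, n)) :
  M x @[x --> F] --> L <-> forall i j, M x i j @[x --> F] --> L i j.
Proof.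
split=> H.
  move=> i j; apply/cvgrPdist_le => e e0; move/cvgrPdist_le: H => /(_ _ e0).
  apply: filterS => x; apply: le_trans.
  have := mxnorm_entry (L - M x) i j; by rewrite !mxE.
apply/cvgrPdist_le => e e0.
have : \forall x \near F, forall ij : 'I_m * 'I_n, `|L ij.1 ij.2 - M x ij.1 ij.2| <= e.
  by apply: filter_forall => -[i j] /=; move: (H i j) => /cvgrPdist_le/(_ _ e0).
apply: filterS => x Hx; apply: mxnorm_le; first exact: ltW.
by move=> i j; have := Hx (i, j); rewrite !mxE.
Qed.

Lemma is_derive_mxP (R : realType) (V : normedModType R) m n (M : V -> 'M[R]_(m, n)) x v L :
  is_derive x v M L <-> forall i j, is_derive x v (fun y => M y i j) (L i j).
Proof.
split=> [[dM <-] i j|H].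
  by rewrite derive_mx // mxE; apply: DeriveDef => //; move/derivable_mxP: dM; exact.
have dM : derivable M x v by apply/derivable_mxP => i j; case: (H i j).
apply: DeriveDef => //; rewrite derive_mx //; apply/matrixP => i j; rewrite mxE.
by case: (H i j).
Qed.

Section Composition.
Variables (R : realType) (V : normedModType R) (m : nat).

Lemma is_derive_comp_row (U : set 'rV[R]_m) (f : 'rV[R]_m -> R) (g : V -> 'rV[R]_m) x v l :
  open U -> U (g x) -> Ck 1 U f -> is_derive x v g l ->
  is_derive x v (fun y => f (g y)) (\sum_i l 0 i * 'D_('e_i) f (g x)).
Proof.
move=> oU Ux Cf dg; rewrite -(C1_diff l oU Ux Cf).
apply: is_derive_comp_diff => //; exact: C1_differentiable Cf.
Qed.

Lemma Ck_comp k (U : set V) (W : set 'rV[R]_m) (f : 'rV[R]_m -> R) (g : V -> 'rV[R]_m) :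
  open U -> open W -> (forall x, U x -> W (g x)) -> (forall i, Ck k U (fun x => g x 0 i)) ->
  Ck k W f -> Ck k U (fun x => f (g x)).
Proof.
move=> oU oW UW; elim: k f => [|k IH] f Cg Cf.
  move=> x Ux; apply: (@continuous_comp _ _ _ g f).
    by apply/cvg_mxP => i j; rewrite (ord1 i); exact: Cg.
  by apply: Cf; exact: UW.
have Cg' i : Ck k U (fun x => g x 0 i) by apply: Ck_pred.
have dg x v : U x -> is_derive x v g (\row_i 'D_v (fun y => g y 0 i) x).
  move=> Ux; apply/is_derive_mxP => i j; rewrite (ord1 i) mxE; apply: DeriveDef => //.
  exact: Ck_derivable (Cg j) Ux.
have C1 : Ck 1 W f by apply: Ck_le Cf.
have D x v : U x -> is_derive x v (fun y => f (g y)) (\sum_i 'D_v (fun y => g y 0 i) x * 'D_('e_i) f (g x)).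
  move=> Ux; have := is_derive_comp_row oW (UW _ Ux) C1 (dg x v Ux).
  by under eq_bigr do rewrite mxE.
split.
- move=> x Ux; apply: (@continuous_comp _ _ _ g f).
    by apply/cvg_mxP => i j; rewrite (ord1 i); exact: Ck_continuous (Cg j) Ux.
  exact: Ck_continuous Cf (UW _ Ux).
- by move=> x v Ux; case: (D x v Ux).
- move=> v.
  apply: (@Ck_ext _ _ _ k U (fun x => \sum_i 'D_v (fun y => g y 0 i) x * 'D_('e_i) f (g x))) => //.
    by move=> x Ux; case: (D x v Ux).
  apply: Ck_sum => // i; apply: CkM => //; first exact: Ck_derive (Cg i).
  apply: (IH (fun z => 'D_('e_i) f z)) => //; exact: Ck_derive Cf.
Qed.

End Composition.

(* Sealed: conversion tests between directional derivatives would unfold their defining limits. *)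
Fact partial_sig : {p : forall (R : realType) m, 'I_m -> ('rV[R]_m -> R) -> 'rV[R]_m -> R |
  forall R m i f x, p R m i f x = 'D_('e_i) f x}.
Proof. by exists (fun R m i f x => 'D_('e_i) f x). Qed.

Definition partial (R : realType) m := sval partial_sig R m.
Arguments partial {R m} i f x.

Section Partial.
Variables (R : realType) (m : nat).
Implicit Types (U : set 'rV[R]_m) (f : 'rV[R]_m -> R) (i j : 'I_m) (x : 'rV[R]_m).

Lemma partialE i f x : partial i f x = 'D_('e_i) f x.
Proof. exact: (svalP partial_sig). Qed.

Lemma partial_funE i f : partial i f = (fun x => 'D_('e_i) f x).
Proof. by apply/funext => x; exact: partialE. Qed.

Lemma Ck_partial k U f i : Ck k.+1 U f -> Ck k U (partial i f).
Proof. by move=> Cf; rewrite partial_funE; exact: Ck_derive. Qed.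

Lemma partial_commute U f i j x : open U -> U x -> Ck 2 U f ->
  partial i (partial j f) x = partial j (partial i f) x.
Proof.
move=> oU Ux Cf; rewrite partialE partial_funE; apply: (etrans (derive_commute _ _ oU Ux Cf)).
by rewrite -partial_funE -partialE.
Qed.

Lemma derive_partial U f x (v : 'rV[R]_m) : open U -> U x -> Ck 1 U f ->
  'D_v f x = \sum_i v 0 i * partial i f x.
Proof.
by move=> oU Ux Cf; rewrite (derive_row v oU Ux Cf); apply: eq_bigr => i _; rewrite partialE.
Qed.

Lemma is_derive_chain (V : normedModType R) U f (g : V -> 'rV[R]_m) (y v : V) (l : 'rV[R]_m) :
  open U -> U (g y) -> Ck 1 U f -> is_derive y v g l ->
  is_derive y v (fun y => f (g y)) (\sum_i l 0 i * partial i f (g y)).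
Proof.
move=> oU Ux Cf dg; have := is_derive_comp_row oU Ux Cf dg.
by under eq_bigr do rewrite -partialE.
Qed.

End Partial.

(** * Ordinary differential equations *)

Lemma near_realI (R : realType) (t : R) (P : set R) :
  (exists2 d : R, 0 < d & forall s : R, `|s - t| < d -> P s) -> \forall s \near t, P s.
Proof.
case=> d d0 Bd; apply/nbhs_ballP; exists d => //= s; rewrite /ball /= distrC; exact: Bd.
Qed.

Lemma near_realE (R : realType) (t : R) (P : set R) :
  (\forall s \near t, P s) -> exists2 d : R, 0 < d & forall s : R, `|s - t| < d -> P s.
Proof.
move=> /nbhs_ballP[d /= d0 Bd]; exists d => // s st; apply: Bd; by rewrite /ball /= distrC.
Qed.

Section MatrixCurves.
Variables (R : realType) (p m : nat).
Implicit Types (x : R -> 'M[R]_(p, m)) (a b t : R).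

Lemma within_mx_entry x (A : set R) i j :
  {within A, continuous x} -> {within A, continuous (fun t => x t i j)}.
Proof. by move=> cx s; move/cvg_mxP: (cx s); apply. Qed.

Lemma within_norm x (A : set R) : {within A, continuous x} -> {within A, continuous (fun t => `|x t|)}.
Proof. move=> cx s; exact: cvg_norm (cx s). Qed.

Lemma within_sub (U : topologicalType) (x : R -> U) (A B : set R) :
  B `<=` A -> {within A, continuous x} -> {within B, continuous x}.
Proof. by move=> BA; exact: continuous_subspaceW. Qed.

(** The intermediate point may depend on the entry, which is harmless because the norm is the
    maximum over entries. *)
Lemma mx_MVT_le x (dx : R -> 'M[R]_(p, m)) a b (K : R) : a <= b ->
  {within `[a, b], continuous x} ->
  (forall t, a < t < b -> is_derive t 1 x (dx t) /\ `|dx t| <= K) -> `|x b - x a| <= K * (b - a).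
Proof.
move=> ab cx dxK.
have [->|anb] := eqVneq a b; first by rewrite !subrr normr0 mulr0.
have {}ab : a < b by rewrite lt_neqAle anb.
have K0 : 0 <= K.
  apply: le_trans (dxK ((a + b) / 2) _).2; first exact: normr_ge0.
  by rewrite ltr_pdivlMr // ltr_pdivrMr //; apply/andP; split; lra.
apply: mxnorm_le => [|i j]; first by rewrite mulr_ge0 // subr_ge0 ltW.
have [t|t|c cab E] := @MVT R (fun t => x t i j) (fun t => dx t i j) a b ab.
- by rewrite in_itv /= => /dxK[/is_derive_mxP].
- exact: within_mx_entry.
have -> : (x b - x a) i j = dx c i j * (b - a) by rewrite !mxE.
rewrite normrM (gtr0_norm (_ : 0 < b - a)) ?subr_gt0 //.
apply: ler_wpM2r; first by rewrite subr_ge0 ltW.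
move: cab; rewrite in_itv /= => /dxK[_]; apply: le_trans; exact: mxnorm_entry.
Qed.

(* An interval short enough for (b - a) L <= 1/2 lets the maximum of the solution absorb itself,
   so no exponential is needed. *)
Lemma short_gronwall x (dx : R -> 'M[R]_(p, m)) a b (L e r : R) : 0 <= L -> 0 <= e ->
  (b - a) * L <= 2^-1 -> {within `[a, b], continuous x} ->
  (forall t, a < t < b -> is_derive t 1 x (dx t) /\ `|dx t| <= L * `|x t| + e) ->
  a <= r <= b -> forall t, a <= t <= b -> `|x t| <= 2 * `|x r| + 2 * (b - a) * e.
Proof.
move=> L0 e0 baL cx dxL /andP[ar rb].
have ab : a <= b by exact: le_trans rb.
have [c] := EVT_max ab (within_norm cx).
rewrite in_itv /= => /andP[ac cb] cmax t tab.
apply: (le_trans (cmax t _)); first by rewrite in_itv.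
have M u : a < u < b -> `|dx u| <= L * `|x c| + e.
  move=> uab; apply: (le_trans (dxL u uab).2); rewrite lerD2r ler_wpM2l //.
  by apply: cmax; rewrite in_itv /=; case/andP: uab => ? ?; rewrite !ltW.
have H : `|x c - x r| <= (L * `|x c| + e) * (b - a).
  have Le0 : 0 <= L * `|x c| + e by rewrite addr_ge0 // mulr_ge0.
  have [rc|cr] := leP r c.
    apply: (@le_trans _ _ ((L * `|x c| + e) * (c - r))); last by rewrite ler_wpM2l // lerB.
    apply: (mx_MVT_le (dx := dx) rc).
      by apply: within_sub cx => u /=; rewrite !in_itv /= => /andP[ru uc]; rewrite (le_trans ar) //= (le_trans uc).
    move=> u /andP[ru uc]; have uab : a < u < b by rewrite (le_lt_trans ar) //= (lt_le_trans uc).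
    by split; [case: (dxL u uab)|exact: M].
  rewrite distrC; apply: (@le_trans _ _ ((L * `|x c| + e) * (r - c))); last by rewrite ler_wpM2l // lerB.
  apply: (mx_MVT_le (dx := dx) (ltW cr)).
    by apply: within_sub cx => u /=; rewrite !in_itv /= => /andP[ru uc]; rewrite (le_trans ac) //= (le_trans uc).
  move=> u /andP[ru uc]; have uab : a < u < b by rewrite (le_lt_trans ac) //= (lt_le_trans uc).
  by split; [case: (dxL u uab)|exact: M].
have H2 : `|x c| <= `|x r| + (L * `|x c| + e) * (b - a).
  by have := ler_normD (x c - x r) (x r); rewrite subrK; lra.
have H3 : L * `|x c| * (b - a) <= 2^-1 * `|x c|.
  by rewrite mulrAC [L * _]mulrC ler_wpM2r.
lra.
Qed.

(** The fixed interval suffices because the integral equation below is solved only for times smaller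
    than some d < 1. *)
Lemma continuous_primitive (h : R -> R) : continuous h ->
  exists H : R -> R, forall t, -1 < t < 1 -> is_derive t 1 H (h t).
Proof.
move=> ch; pose H (y : R) : R := (\int[lebesgue_measure]_(t in `[-1, y]) h t)%R.
have hint : lebesgue_measure.-integrable `[-1 : R, 1] (EFin \o h).
  apply: continuous_compact_integrable; first exact: segment_compact.
  exact: continuous_subspaceT.
exists H => t /andP[t0 t1].
have [dH DH] := @continuous_FTC1_closed R h (-1) t 1 t1 hint t0 (ch t).
split; [exact: dH|]; rewrite -derive1E; exact: DH.
Qed.

(** Truncation to [-d, d]. It turns data on a bounded time interval, or in a cube, into data defined
    everywhere, so that no domains have to be tracked in the iteration. *)
Definition clamp (d t : R) : R := Num.max (- d) (Num.min d t).

Lemma clamp_le (d t : R) : 0 <= d -> `|clamp d t| <= d.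
Proof.
move=> d0; rewrite /clamp ler_norml le_max lexx /= ge_max ge_min lexx /= andbT.
by rewrite (le_trans _ d0) // oppr_le0.
Qed.

Lemma clamp_id (d t : R) : `|t| <= d -> clamp d t = t.
Proof.
rewrite ler_norml => /andP[dt td]; rewrite /clamp min_r // max_r //.
Qed.

Lemma clamp_continuous (d : R) : continuous (clamp d).
Proof.
move=> t; apply: (@continuous_max R R (fun=> - d) (fun t => Num.min d t)); first exact: cvg_cst.
by apply: (@continuous_min R R (fun=> d) id); [exact: cvg_cst|exact: cvg_id].
Qed.

Lemma clamp_near (d t : R) : `|t| < d -> \forall s \near t, clamp d s = s.
Proof.
move=> td; apply: near_realI; exists (d - `|t|); first by rewrite subr_gt0.
move=> s st; apply: clamp_id; have := ler_normD (s - t) t; rewrite subrK; lra.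
Qed.

(** Freezing the primitive outside [-d, d] makes it bounded on the whole line, so Picard iterates
    can be compared uniformly in t. *)
Lemma continuous_mx_primitive (h : R -> 'M[R]_(p, m)) (z : 'M[R]_(p, m)) (d : R) :
  continuous h -> 0 < d < 1 ->
  exists Y : R -> 'M[R]_(p, m), [/\ Y 0 = z, continuous Y, forall t, Y t = Y (clamp d t)
    & forall t, `|t| < d -> is_derive t 1 Y (h t)].
Proof.
move=> ch /andP[d0 d1].
have ent i j : exists H : R -> R, forall t, -1 < t < 1 -> is_derive t 1 H (h t i j).
  by apply: continuous_primitive => t; move/cvg_mxP: (ch t); apply.
pose H t : 'M[R]_(p, m) := \matrix_(i, j) sval (cid (ent i j)) t.
have dH t : -1 < t < 1 -> is_derive t 1 H (h t).
  move=> t1; apply/is_derive_mxP => i j; under eq_fun do rewrite mxE.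
  exact: (svalP (cid (ent i j))).
have cl0 : clamp d 0 = 0 by apply: clamp_id; rewrite normr0 ltW.
exists (fun t => z + (H (clamp d t) - H 0)); split.
- by rewrite cl0 subrr addr0.
- move=> t; apply: cvgD; first exact: cvg_cst.
  apply: cvgB; last exact: cvg_cst.
  apply: (@continuous_comp _ _ _ (clamp d) H); first exact: clamp_continuous.
  apply: differentiable_continuous; apply/derivable1_diffP.
  have /dH[] // : -1 < clamp d t < 1.
  by rewrite -ltr_norml (le_lt_trans (clamp_le _ _)) // ltW.
- by move=> t; rewrite [clamp d (clamp d t)]clamp_id // clamp_le // ltW.
- move=> t td.
  have Ht : is_derive t 1 H (h t) by apply: dH; rewrite -ltr_norml (lt_trans td).
  have : is_derive t 1 (cst z + (H - cst (H 0))) (0 + (h t - 0)).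
    by apply: is_deriveD; apply: is_deriveB.
  rewrite subr0 add0r; apply: near_eq_is_derive.
  by apply: filterS (clamp_near td) => s E; rewrite E.
Qed.

(** The intervals of radius 2 C / 2^k around u k are nested, since the remaining steps sum up to
    that radius; the limit is the supremum of their left ends. *)
Lemma geometric_limit (u : nat -> R) (C : R) : (forall k, `|u k.+1 - u k| <= C / 2 ^+ k) ->
  exists l, forall k, `|l - u k| <= 2 * C / 2 ^+ k.
Proof.
move=> H.
have C0 : 0 <= C by have := le_trans (normr_ge0 _) (H 0%N); rewrite expr0 divr1.
have D k : `|u k.+1 - u k| + 2 * C / 2 ^+ k.+1 <= 2 * C / 2 ^+ k.
  have := H k; have -> : 2 * C / 2 ^+ k.+1 = C / 2 ^+ k.
    by rewrite exprS -mulf_div divff // mul1r.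
  by rewrite -mulrA; lra.
have D2 k j : `|u (k + j)%N - u k| + 2 * C / 2 ^+ (k + j) <= 2 * C / 2 ^+ k.
  elim: j => [|j IH]; first by rewrite addn0 subrr normr0 add0r.
  rewrite addnS; apply: le_trans IH; apply: (@le_trans _ _ (`|u (k + j).+1 - u (k + j)%N| + `|u (k + j)%N - u k| + 2 * C / 2 ^+ (k + j).+1)).
    by rewrite lerD2r -{1}(subrKA (u (k + j)%N)) ler_normD.
  by have := D (k + j)%N; lra.
pose E := [set u k - 2 * C / 2 ^+ k | k in [set: nat]].
have pos k : 0 <= 2 * C / 2 ^+ k by rewrite divr_ge0 ?mulr_ge0 // exprn_ge0.
have ub k : ubound E (u k + 2 * C / 2 ^+ k).
  move=> _ [j _ <-].
  have [kj|jk] := leqP k j.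
    have := D2 k (j - k)%N; rewrite subnKC //; have := pos j; have := ler_norm (u j - u k); lra.
  have := D2 j (k - j)%N; rewrite subnKC ?(ltnW jk) //; have := pos k; have := ler_norm (u j - u k).
  by rewrite distrC; lra.
have Esup : has_sup E.
  by split; [exists (u 0%N - 2 * C / 2 ^+ 0); exists 0%N|exists (u 0%N + 2 * C / 2 ^+ 0); exact: ub].
exists (sup E) => k; rewrite ler_norml; apply/andP; split.
  have := @sup_upper_bound R E Esup (u k - 2 * C / 2 ^+ k) (ex_intro2 _ _ k I erefl); lra.
have := sup_le_ub Esup.1 (ub k); lra.
Qed.

Lemma geometric_small (C e : R) : 0 < e -> exists k : nat, C / 2 ^+ k < e.
Proof.
move=> e0; have /cvgrPdist_lt/(_ _ e0) : geometric C (2^-1 : R) k @[k --> \oo] --> (0 : R).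
  by apply: cvg_geometric; rewrite ger0_norm // invf_lt1 // ltr1n.
case=> k _ /(_ k (leqnn k)); rewrite /= sub0r normrN exprVn => H; exists k.
exact: le_lt_trans (ler_norm _) H.
Qed.

Lemma uniform_limit_continuous (X : nat -> R -> 'M[R]_(p, m)) x C :
  (forall k, continuous (X k)) -> (forall k t, `|x t - X k t| <= C / 2 ^+ k) -> continuous x.
Proof.
move=> cX H t; apply/cvgrPdist_le => e e0.
have e3 : 0 < e / 3 by rewrite divr_gt0.
have [k Hk] := geometric_small C e3.
have /cvgrPdist_le/(_ _ e3) := cX k t.
apply: filterS => s Hs; rewrite -(subrKA (X k t)) -[X in _ + X](subrKA (X k s)).
rewrite (le_trans (ler_normD _ _)) //.
have := ler_normD (X k t - X k s) (X k s - x s).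
have := H k t; have := H k s; rewrite distrC; lra.
Qed.

(** The integral operator contracts the uniform distance by d L <= 1/2. Continuity of F is assumed
    along continuous curves only, which is what the integrand requires, and the Lipschitz bound is
    global: local fields are cut off before this lemma is applied. *)
Lemma picard (F : R -> 'M[R]_(p, m) -> 'M[R]_(p, m)) (z : 'M[R]_(p, m)) (d L : R) :
  (forall x, continuous x -> continuous (fun t => F t (x t))) ->
  0 <= L -> (forall t u v, `|F t u - F t v| <= L * `|u - v|) -> 0 < d < 1 -> d * L <= 2^-1 ->
  exists x, [/\ x 0 = z, continuous x & forall t, `|t| < d -> is_derive t 1 x (F t (x t))].
Proof.
move=> cF L0 FL d01 dL; have /andP[d0 d1] := d01.
(* [P] is the integral operator; it is made total by an arbitrary value at curves that are not
   continuous. *)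
have /choice[P HP] : forall x : R -> 'M[R]_(p, m), exists y, continuous x ->
    [/\ y 0 = z, continuous y, forall t, y t = y (clamp d t)
      & forall t, `|t| < d -> is_derive t 1 y (F t (x t))].
  move=> x; have [cx|ncx] := pselect (continuous x); last by exists x.
  have [y Hy] := continuous_mx_primitive z (cF _ cx) d01; by exists y.
have contract (x y : R -> 'M[R]_(p, m)) (e : R) : continuous x -> continuous y -> (forall t, `|x t - y t| <= e) ->
    forall t, `|P x t - P y t| <= e / 2.
  move=> cx cy xy t; have [Px0 cPx Pxc dPx] := HP _ cx; have [Py0 cPy Pyc dPy] := HP _ cy.
  have e0 : 0 <= e by exact: le_trans (normr_ge0 _) (xy 0).
  rewrite Pxc Pyc; have := clamp_le t (ltW d0); set s := clamp d t => sd.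
  have cD : continuous (P x - P y) by move=> u; apply: cvgB; [exact: cPx|exact: cPy].
  have D (u : R) : `|u| < d -> is_derive u 1 (P x - P y) (F u (x u) - F u (y u)) /\ `|F u (x u) - F u (y u)| <= L * e.
    move=> ud; split; first by apply: is_deriveB; [exact: dPx|exact: dPy].
    by apply: le_trans (FL _ _ _) _; rewrite ler_wpM2l.
  have key : `|(P x - P y) s - (P x - P y) 0| <= L * e * `|s|.
    have [s0|s0] := leP 0 s.
      rewrite (ger0_norm s0) -{2}[s]subr0.
      apply: (mx_MVT_le (dx := fun u => F u (x u) - F u (y u)) s0); first exact: continuous_subspaceT.
      by move=> u /andP[u0 us]; apply: D; rewrite gtr0_norm // (lt_le_trans us) // (le_trans (ler_norm _)).
    rewrite (ltr0_norm s0) -[- s]sub0r distrC.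
    apply: (mx_MVT_le (dx := fun u => F u (x u) - F u (y u)) (ltW s0)); first exact: continuous_subspaceT.
    move=> u /andP[us u0]; apply: D; rewrite ltr0_norm // (lt_le_trans _ sd) // ltr0_norm //.
    by rewrite ltrN2.
  have -> : P x s - P y s = (P x - P y) s - (P x - P y) 0 by rewrite /= -[LHS]subr0; congr (_ - _); rewrite -[RHS]/(P x 0 - P y 0) Px0 Py0 subrr.
  apply: (le_trans key); apply: (@le_trans _ _ (d * L * e)).
    by rewrite mulrC mulrA ler_wpM2r // ler_wpM2r.
  by rewrite [e / 2]mulrC ler_wpM2r.
pose X k := iter k P (cst z).
have cX k : continuous (X k).
  by elim: k => [|k IH]; [move=> t; exact: cvg_cst|have [] := HP _ IH].
(* The first step is bounded on the whole line, because the first iterate is continuous and constant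
   outside [-d, d]. *)
have [C HC] : exists C, forall t, `|X 1%N t - X 0%N t| <= C.
  have [_ cX1 X1c _] := HP _ (cX 0%N).
  have cN : {within `[- d, d], continuous (fun t => `|X 1%N t - z|)}.
    apply: continuous_subspaceT => t; apply: cvg_norm; apply: cvgB; [exact: cX1|exact: cvg_cst].
  have [|c _ Hc] := EVT_max _ cN; first by rewrite (@le_trans _ _ 0) // ?oppr_le0 ltW.
  exists `|X 1%N c - z| => t; have -> : X 1%N t = X 1%N (clamp d t) by exact: X1c.
  by apply: Hc; rewrite in_itv /= -ler_norml clamp_le // ltW.
have step k t : `|X k.+1 t - X k t| <= C / 2 ^+ k.
  elim: k t => [|k IH] t; first by rewrite expr0 divr1.
  have -> : C / 2 ^+ k.+1 = C / 2 ^+ k / 2 by rewrite exprS invfM mulrA mulrAC.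
  exact: (contract _ _ _ (cX k.+1) (cX k) IH t).
have lim t i j : exists l, forall k, `|l - X k t i j| <= 2 * C / 2 ^+ k.
  apply: geometric_limit => k; apply: le_trans (step k t).
  by have := mxnorm_entry (X k.+1 t - X k t) i j; rewrite !mxE.
pose x t : 'M[R]_(p, m) := \matrix_(i, j) sval (cid (lim t i j)).
have xX k t : `|x t - X k t| <= 2 * C / 2 ^+ k.
  have C0 : 0 <= C by exact: le_trans (normr_ge0 _) (HC 0).
  apply: mxnorm_le => [|i j]; first by rewrite divr_ge0 ?mulr_ge0 // exprn_ge0.
  by rewrite !mxE; exact: (svalP (cid (lim t i j))).
have cx := uniform_limit_continuous cX xX.
have Px : P x = x.
  apply/funext => t; apply/eqP; rewrite -subr_eq0 -normr_le0; apply/ler_addgt0Pl => e e0; rewrite addr0.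
  have [k Hk] := geometric_small (4 * C) e0.
  have H1 := contract _ _ _ cx (cX k) (xX k) t.
  have H2 := xX k.+1 t.
  rewrite -(subrKA (X k.+1 t)); apply: (le_trans (ler_normD _ _)).
  move: H2; have -> : 2 * C / 2 ^+ k.+1 = C / 2 ^+ k by rewrite exprS -mulf_div divff // mul1r.
  rewrite distrC; move: H1 Hk; rewrite -[X k.+1 t]/(P (X k) t); set w := _ ^+ _; rewrite -!mulrA; lra.
have [x0 _ _ dx] := HP _ cx; exists x; split=> //; first by rewrite -Px.
by move=> t /dx; rewrite Px.
Qed.

End MatrixCurves.

Lemma cvg_sum_seq (R : realType) (T I : Type) (F : set_system T) (FF : Filter F) (r : seq I)
    (g : I -> T -> R) (l : I -> R) : (forall i, g i x @[x --> F] --> l i) ->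
  \sum_(i <- r) g i x @[x --> F] --> \sum_(i <- r) l i.
Proof.
move=> H; elim: r => [|i r IH].
  by rewrite big_nil; under eq_fun do rewrite big_nil; exact: cvg_cst.
by rewrite big_cons; under eq_fun do rewrite big_cons; exact: cvgD.
Qed.

Lemma cvg_mulmx (R : realType) (T : Type) (F : set_system T) (FF : Filter F) p m n
    (A : T -> 'M[R]_(p, m)) (B : T -> 'M[R]_(m, n)) (A0 : 'M[R]_(p, m)) (B0 : 'M[R]_(m, n)) :
  A x @[x --> F] --> A0 -> B x @[x --> F] --> B0 -> A x *m B x @[x --> F] --> A0 *m B0.
Proof.
move=> /cvg_mxP cA /cvg_mxP cB; apply/cvg_mxP => i j; rewrite mxE; under eq_fun do rewrite mxE.
apply: cvg_sum_seq => k; apply: cvgM; [exact: cA|exact: cB].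
Qed.

Lemma mxnorm_mul (R : realType) p m n (A : 'M[R]_(p, m)) (B : 'M[R]_(m, n)) (K : R) :
  (forall i j, `|B i j| <= K) -> 0 <= K -> `|A *m B| <= m%:R * K * `|A|.
Proof.
move=> HB K0; apply: mxnorm_le => [|i j]; first by rewrite !mulr_ge0.
rewrite mxE (le_trans (ler_norm_sum _ _ _)) //.
apply: (@le_trans _ _ (\sum_(k < m) `|A| * K)).
  by apply: ler_sum => k _; rewrite normrM ler_pM //; exact: mxnorm_entry.
by rewrite sumr_const card_ord -[leLHS]mulr_natl mulrCA mulrC.
Qed.

Lemma is_derive_mulmx (R : realType) (V : normedModType R) p m n (A : V -> 'M[R]_(p, m))
    (B : V -> 'M[R]_(m, n)) x v dA dB :
  is_derive x v A dA -> is_derive x v B dB ->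
  is_derive x v (fun y => A y *m B y) (dA *m B x + A x *m dB).
Proof.
move=> /is_derive_mxP HA /is_derive_mxP HB; apply/is_derive_mxP => i j.
have -> : (fun y => (A y *m B y) i j) = \sum_k ((fun y => A y i k) * (fun y => B y k j)).
  by apply/funext => y; rewrite mxE fct_sumE.
have -> : (dA *m B x + A x *m dB) i j = \sum_k (A x i k *: dB k j + B x k j *: dA i k).
  rewrite !mxE -big_split /=; apply: eq_bigr => k _.
  by rewrite addrC; congr (_ + _); rewrite mulrC.
by apply: is_derive_sum => k; apply: is_deriveM.
Qed.

Lemma is_derive_mulmxl (R : realType) (V : normedModType R) p m n (A : 'M[R]_(p, m))
    (B : V -> 'M[R]_(m, n)) x v dB :
  is_derive x v B dB -> is_derive x v (fun y => A *m B y) (A *m dB).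
Proof.
move=> HB; have := is_derive_mulmx (is_derive_cst A x v) HB.
by rewrite mul0mx add0r.
Qed.

Lemma is_derive_mulmxr (R : realType) (V : normedModType R) p m n (A : V -> 'M[R]_(p, m))
    (B : 'M[R]_(m, n)) x v dA :
  is_derive x v A dA -> is_derive x v (fun y => A y *m B) (dA *m B).
Proof.
move=> HA; have := is_derive_mulmx HA (is_derive_cst B x v).
by rewrite mulmx0 addr0.
Qed.

Lemma locally_bounded (R : realType) (V : normedModType R) (I : finType) (g : I -> V -> R) x :
  (forall i, {for x, continuous (g i)}) -> exists2 K : R, 0 <= K & \forall y \near x, forall i, `|g i y| <= K.
Proof.
move=> cg; exists (1 + \sum_i `|g i x|); first by rewrite addr_ge0 // sumr_ge0.
apply: (@filter_forall _ _ (fun i y => `|g i y| <= 1 + \sum_i `|g i x|) (nbhs x) _) => i.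
have /cvgrPdist_le/(_ 1 ltr01) := cg i; apply: filterS => y Hy.
rewrite (bigD1 i) //= addrA (@le_trans _ _ (1 + `|g i x|)) //; last by rewrite lerDl sumr_ge0.
have := ler_normB (g i x) (g i x - g i y); rewrite opprB addrC subrK; lra.
Qed.

(** * Local flow of a vector field and its linearization *)

Section LocalFlow.
Variables (R : realType) (m : nat) (Om : set 'rV[R]_m) (f : 'I_m -> 'rV[R]_m -> R).
Hypotheses (oO : open Om) (Cf : forall j, Ck 2 Om (f j)).

Definition vf (z : 'rV[R]_m) : 'rV[R]_m := \row_j f j z.
(** Row convention: [u *m dvf z] is the derivative of [vf] at z in the direction u, so linearized
    solutions are multiplied by [dvf] on the right. *)
Definition dvf (z : 'rV[R]_m) : 'M[R]_m := \matrix_(i, j) partial i (f j) z.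

Section Bounds.
Variables (z0 : 'rV[R]_m) (d K : R).
Hypotheses (d0 : 0 < d) (K0 : 0 <= K) (BO : forall y : 'rV[R]_m, `|y - z0| < d -> Om y)
  (B0 : forall y : 'rV[R]_m, `|y - z0| < d -> forall j, `|f j y| <= K)
  (B1 : forall y : 'rV[R]_m, `|y - z0| < d -> forall i j, `|'D_('e_i) (f j) y| <= K)
  (B2 : forall y : 'rV[R]_m, `|y - z0| < d -> forall k i j,
     `|'D_('e_k) (fun w => 'D_('e_i) (f j) w) y| <= K).

Lemma vf_bound (y : 'rV[R]_m) : `|y - z0| < d -> `|vf y| <= K.
Proof. by move=> yd; apply: mxnorm_le => // i j; rewrite mxE; exact: B0. Qed.

Lemma vf_lipschitz (a b : 'rV[R]_m) : `|a - z0| < d -> `|b - z0| < d -> `|vf b - vf a| <= m%:R * K * `|b - a|.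
Proof.
move=> ad bd; apply: mxnorm_le => [|i j]; first by rewrite !mulr_ge0.
have -> : (vf b - vf a) i j = f j b - f j a by rewrite !mxE.
by apply: (ball_lipschitz oO BO (Ck_pred (Cf j))) => // y k yd; exact: B1.
Qed.

Lemma vf_quadratic (a b : 'rV[R]_m) : `|a - z0| < d -> `|b - z0| < d ->
  `|vf b - vf a - (b - a) *m dvf a| <= m%:R * (m%:R * K) * `|b - a| ^+ 2.
Proof.
move=> ad bd; apply: mxnorm_le => [|i j]; first by rewrite !mulr_ge0 // exprn_ge0.
have -> : (vf b - vf a - (b - a) *m dvf a) i j =
    f j b - f j a - \sum_k (b - a) 0 k * 'D_('e_k) (f j) a.
  rewrite (ord1 i) !mxE; congr (_ - _ - _); apply: eq_bigr => k _.
  by rewrite !mxE partialE.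
by apply: (ball_quadratic oO BO (Cf j)) => // y k l yd; exact: B2.
Qed.

Lemma dvf_bound p (Z : 'M[R]_(p, m)) (a : 'rV[R]_m) : `|a - z0| < d -> `|Z *m dvf a| <= m%:R * K * `|Z|.
Proof. by move=> ad; apply: mxnorm_mul => // i j; rewrite mxE partialE; exact: B1. Qed.

Definition solves (phi : R -> 'rV[R]_m) (t : R) :=
  `|phi t - z0| < d /\ is_derive t 1 phi (vf (phi t)).

Variable del : R.
Hypotheses (del0 : 0 < del) (del1 : del < 1) (delL : 2 * del * (m%:R * K) <= 2^-1) (delK : del * K <= d / 4).

(** The field is composed with the projection onto the cube of radius d/2 around z0, which is
    1-Lipschitz, so that [picard] applies. The solution starts within d/4 of z0 and moves by at most
    del K <= d/4, hence stays where the projection is the identity. *)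
Lemma flow_exists (z : 'rV[R]_m) : `|z - z0| < d / 4 ->
  exists phi, phi 0 = z /\ forall t : R, `|t| < del -> solves phi t.
Proof.
move=> zd; have := d0; have := delK; have := delL; move=> delL' delK' d0'; pose r := d / 2.
have r0 : 0 < r by rewrite divr_gt0.
have rd : r < d by rewrite /r; lra.
pose cl (y : 'rV[R]_m) : 'rV[R]_m := z0 + \row_j clamp r ((y - z0) 0 j).
have clr (y : 'rV[R]_m) : `|cl y - z0| <= r.
  rewrite /cl addrC addKr; apply: mxnorm_le => [|i j]; first exact: ltW.
  by rewrite mxE clamp_le // ltW.
have cld (y : 'rV[R]_m) : `|cl y - z0| < d by apply: le_lt_trans (clr y) _.
have clid (y : 'rV[R]_m) : `|y - z0| <= r -> cl y = y.
  move=> yr; apply/rowP => j; rewrite /cl !mxE clamp_id; first by rewrite addrC subrK.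
  by apply: le_trans yr; have := mxnorm_entry (y - z0) 0 j; rewrite !mxE.
have cllip (a b : 'rV[R]_m) : `|cl a - cl b| <= `|a - b|.
  apply: mxnorm_le => // i j; apply: le_trans (mxnorm_entry (a - b) i j).
  rewrite (ord1 i) !mxE /clamp.
  set x := a 0 j; set y := b 0 j; set w := z0 0 j.
  rewrite /Num.max /Num.min; do ! case: ifP => //; rewrite ?subrr ?normr0 //;
  move=> *; rewrite ler_norml; have := ler_norm (x - y); have := ler_norm (y - x); rewrite (distrC y); lra.
have [|||||phi [phi0 cphi dphi]] := @picard R 1 m (fun _ y => vf (cl y)) z del (m%:R * K).
- move=> x cx t; apply/cvgrPdist_le => e e0.
  have /cvgrPdist_le/(_ (e / (m%:R * K + 1))) := cx t.
  have L1 : 0 < m%:R * K + 1 by rewrite ltr_wpDl // mulr_ge0.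
  rewrite divr_gt0 // => /(_ isT); apply: filterS => s Hs.
  apply: (le_trans (vf_lipschitz (cld _) (cld _))).
  apply: (@le_trans _ _ ((m%:R * K + 1) * (e / (m%:R * K + 1)))); last by rewrite mulrC divfK // gt_eqF.
  apply: ler_pM => //; first by rewrite mulr_ge0.
    by rewrite lerDl.
  exact: le_trans (cllip _ _) Hs.
- by rewrite mulr_ge0.
- move=> _ u v; apply: (le_trans (vf_lipschitz (cld _) (cld _))).
  by rewrite ler_wpM2l // mulr_ge0.
- by rewrite del0.
- have P : 0 <= del * (m%:R * K) by apply: mulr_ge0; [exact: ltW|exact: mulr_ge0].
  lra.
have near_z (t : R) : `|t| < del -> `|phi t - z| <= d / 4.
  move=> td; rewrite -phi0.
  have key (a b : R) : a <= b -> (forall s, a < s < b -> `|s| < del) -> `|phi b - phi a| <= K * (b - a).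
    move=> ab abd; apply: (mx_MVT_le (dx := fun s => vf (cl (phi s))) ab).
      exact: continuous_subspaceT.
    by move=> s /abd sd; split; [exact: dphi|exact: vf_bound].
  have [t0|t0] := leP 0 t.
    apply: (le_trans (key _ _ t0 _)).
      move=> s /andP[s0 st]; rewrite gtr0_norm // (lt_trans st) // (le_lt_trans (ler_norm t)) //.
    rewrite subr0; apply: le_trans delK; rewrite mulrC ler_wpM2r //.
    by rewrite ltW // (le_lt_trans (ler_norm t)).
  rewrite distrC; apply: (le_trans (key _ _ (ltW t0) _)).
    move=> s /andP[s0 st]; rewrite ltr0_norm //; move: td; rewrite ltr0_norm //; lra.
  apply: le_trans delK; rewrite mulrC ler_wpM2r //.
  by move: td; rewrite ltr0_norm //; lra.
exists phi; split=> // t td.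
have pz : `|phi t - z0| < r.
  rewrite -(subrKA z) (le_lt_trans (ler_normD _ _)) //; have := near_z t td; rewrite /r; lra.
split; first exact: lt_trans pz _.
by have := dphi t td; rewrite (clid (phi t) (ltW pz)).
Qed.

Lemma flow_stable (phi psi : R -> 'rV[R]_m) (a b r : R) : b - a <= 2 * del ->
  {within `[a, b], continuous phi} -> {within `[a, b], continuous psi} ->
  (forall t : R, a < t < b -> solves phi t) -> (forall t : R, a < t < b -> solves psi t) ->
  a <= r <= b -> forall t : R, a <= t <= b -> `|psi t - phi t| <= 2 * `|psi r - phi r|.
Proof.
move=> ab cphi cpsi sphi spsi rab t tab.
have := @short_gronwall R 1 m (psi - phi) (fun t => vf (psi t) - vf (phi t)) a b (m%:R * K) 0 r.
rewrite mulr0 addr0; apply => //.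
- by rewrite mulr_ge0.
- apply: le_trans delL; rewrite ler_wpM2r // mulr_ge0 //.
- by move=> s; apply: cvgB; [exact: cpsi|exact: cphi].
move=> s sab; have [d1 D1] := sphi s sab; have [d2 D2] := spsi s sab.
by split; [exact: is_deriveB|rewrite addr0; exact: vf_lipschitz].
Qed.

Lemma linear_stable p (phi : R -> 'rV[R]_m) (Z : R -> 'M[R]_(p, m)) (a b r : R) : b - a <= 2 * del ->
  {within `[a, b], continuous Z} ->
  (forall t : R, a < t < b -> `|phi t - z0| < d /\ is_derive t 1 Z (Z t *m dvf (phi t))) ->
  a <= r <= b -> forall t : R, a <= t <= b -> `|Z t| <= 2 * `|Z r|.
Proof.
move=> ab cZ dZ rab t tab.
have := @short_gronwall R p m Z (fun t => Z t *m dvf (phi t)) a b (m%:R * K) 0 r.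
rewrite mulr0 addr0; apply => //.
- by rewrite mulr_ge0.
- apply: le_trans delL; rewrite ler_wpM2r // mulr_ge0 //.
by move=> s /dZ[sd D]; split=> //; rewrite addr0; exact: dvf_bound.
Qed.

Lemma solves_within (phi : R -> 'rV[R]_m) (a b : R) : (forall t : R, a <= t <= b -> solves phi t) -> {within `[a, b], continuous phi}.
Proof.
move=> H; apply: derivable_within_continuous => t; rewrite in_itv /= => /H[_].
by case.
Qed.

(** [Phi] solves a linear equation whose coefficients are frozen outside [-del/2, del/2]. The error
    w = psi - phi - h Phi vanishes at 0 and solves the same equation up to the Taylor error of the
    field, which [flow_stable] bounds by a multiple of (2 |h|)^2. The short Gronwall estimate on
    [-|t|, |t|], of length at most 1, gives the constant 8 = 2 * 4. *)
Lemma flow_linearization phi : (forall t : R, `|t| < del -> solves phi t) ->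
  exists Phi : R -> 'M[R]_m, [/\ Phi 0 = 1%:M,
    forall t : R, `|t| < del / 2 -> is_derive t 1 Phi (Phi t *m dvf (phi t))
  & forall psi, (forall t : R, `|t| < del -> solves psi t) -> forall t : R, `|t| < del / 2 ->
     `|psi t - phi t - (psi 0 - phi 0) *m Phi t| <= 8 * (m%:R * (m%:R * K)) * `|psi 0 - phi 0| ^+ 2].
Proof.
move=> sphi; have := del0; have := delL; move=> delL' del0'; pose e := del / 2.
have e0 : 0 < e by rewrite divr_gt0.
have ed : e < del by rewrite /e; lra.
have L0 : 0 <= m%:R * K by rewrite mulr_ge0.
have cle (t : R) : `|clamp e t| < del by apply: le_lt_trans ed; rewrite clamp_le // ltW.
have phid (t : R) : `|phi (clamp e t) - z0| < d by have [] := sphi _ (cle t).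
have cD : continuous (fun t => dvf (phi (clamp e t))).
  move=> t; apply/cvg_mxP => i j; rewrite mxE; under eq_fun do rewrite mxE.
  apply: (@continuous_comp _ _ _ (fun t => phi (clamp e t)) (partial i (f j))).
    apply: (@continuous_comp _ _ _ (clamp e) phi); first exact: clamp_continuous.
    by apply: differentiable_continuous; apply/derivable1_diffP; have [_ []] := sphi _ (cle t).
  exact: Ck_continuous (Ck_partial i (Cf j)) (BO (phid t)).
have [|||||Phi [Phi0 cPhi dPhi]] := @picard R m m (fun t Z => Z *m dvf (phi (clamp e t))) 1%:M e (m%:R * K).
- by move=> x cx t; apply: cvg_mulmx; [exact: cx|exact: cD].
- by [].
- by move=> t u v; rewrite -mulmxBl; exact: dvf_bound.
- by rewrite e0 /= (lt_trans ed).
- move: delL; have : e * (m%:R * K) <= del * (m%:R * K) by rewrite ler_wpM2r // ltW.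
  by have := mulr_ge0 (ltW e0) L0; rewrite -[2 * del * _]mulrA; lra.
have dPhi' (t : R) : `|t| < e -> is_derive t 1 Phi (Phi t *m dvf (phi t)).
  by move=> te; have := dPhi t te; rewrite clamp_id // ltW.
exists Phi; split=> // psi spsi t te; set h := psi 0 - phi 0.
pose w s := psi s - phi s - h *m Phi s.
have s_in (s : R) : - `|t| <= s <= `|t| -> `|s| < del.
  by rewrite -ler_norml => st; apply: le_lt_trans st _; apply: lt_trans te ed.
have s_in' (s : R) : - `|t| <= s <= `|t| -> `|s| < e.
  by rewrite -ler_norml => st; apply: le_lt_trans st te.
have psiphi (s : R) : - `|t| <= s <= `|t| -> `|psi s - phi s| <= 2 * `|h|.
  move=> st; apply: (@flow_stable phi psi (- `|t|) `|t| 0) => //.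
  - have : `|t| < e by []. rewrite /e; lra.
  - by apply: solves_within => u /s_in; exact: sphi.
  - by apply: solves_within => u /s_in; exact: spsi.
  - by move=> u /andP[u1 u2]; apply: sphi; apply: s_in; rewrite !ltW.
  - by move=> u /andP[u1 u2]; apply: spsi; apply: s_in; rewrite !ltW.
  - by rewrite oppr_le0 !normr_ge0.
have dw (s : R) : - `|t| <= s <= `|t| -> is_derive s 1 w (vf (psi s) - vf (phi s) - h *m (Phi s *m dvf (phi s))).
  move=> st; have [_ D1] := sphi _ (s_in _ st); have [_ D2] := spsi _ (s_in _ st).
  apply: is_deriveB; last by apply: is_derive_mulmxl; exact: dPhi' (s_in' _ st).
have te' : `|t| < e by [].
have := @short_gronwall R 1 m w (fun s => vf (psi s) - vf (phi s) - h *m (Phi s *m dvf (phi s)))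
  (- `|t|) `|t| (m%:R * K) (m%:R * (m%:R * K) * (2 * `|h|) ^+ 2) 0 L0.
have q0 : 0 <= m%:R * (m%:R * K) * (2 * `|h|) ^+ 2 by rewrite mulr_ge0 ?exprn_ge0 // mulr_ge0.
have w0 : w 0 = 0 by rewrite /w Phi0 mulmx1 subrr.
move=> /(_ q0) G; apply: le_trans (G _ _ _ _ t _) _.
- apply: le_trans delL; rewrite ler_wpM2r // ; have : `|t| < e by []. rewrite /e; lra.
- by apply: derivable_within_continuous => u; rewrite in_itv /= => /dw[].
- move=> s /andP[s1 s2]; have st : - `|t| <= s <= `|t| by rewrite !ltW.
  split; first exact: dw.
  have [a1 _] := sphi _ (s_in _ st); have [a2 _] := spsi _ (s_in _ st).
  have -> : vf (psi s) - vf (phi s) - h *m (Phi s *m dvf (phi s)) =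
      w s *m dvf (phi s) + (vf (psi s) - vf (phi s) - (psi s - phi s) *m dvf (phi s)).
    by rewrite /w (mulmxBl (psi s - phi s)) -mulmxA [RHS]addrC [RHS]addrA subrK.
  apply: (le_trans (ler_normD _ _)); apply: lerD; first exact: dvf_bound.
  apply: (le_trans (vf_quadratic a1 a2)); apply: ler_wpM2l; first by rewrite mulr_ge0.
  by rewrite lerXn2r ?nnegrE ?mulr_ge0 //; exact: psiphi.
- by rewrite oppr_le0 !normr_ge0.
- by rewrite -ler_norml.
rewrite w0 normr0 mulr0 add0r exprMn.
have t2 : `|t| - - `|t| <= 1.
  have : `|t| < e by []. have := del1; rewrite /e; lra.
set A := m%:R * (m%:R * K) in q0 *; set B := `|h| ^+ 2.
have AB : 0 <= A * B by rewrite mulr_ge0 ?exprn_ge0 // mulr_ge0.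
have -> : 2 * (`|t| - - `|t|) * (A * (2 ^+ 2 * B)) = (`|t| - - `|t|) * (8 * A * B) by ring.
by rewrite ler_piMl // -mulrA mulr_ge0.
Qed.

End Bounds.

Lemma flow_constants (z0 : 'rV[R]_m) : Om z0 -> exists d K del : R,
  [/\ 0 < d, 0 <= K, 0 < del & del < 1] /\
  [/\ 2 * del * (m%:R * K) <= 2^-1, del * K <= d / 4,
    (forall y : 'rV[R]_m, `|y - z0| < d -> Om y) &
  [/\ forall y : 'rV[R]_m, `|y - z0| < d -> forall j, `|f j y| <= K,
    forall y : 'rV[R]_m, `|y - z0| < d -> forall i j, `|'D_('e_i) (f j) y| <= K
  & forall y : 'rV[R]_m, `|y - z0| < d -> forall k i j,
     `|'D_('e_k) (fun w => 'D_('e_i) (f j) w) y| <= K]].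
Proof.
move=> Oz0.
have [K1 K10 H1] := @locally_bounded R _ _ f z0 (fun j => Ck_continuous (Cf j) Oz0).
have [K2 K20 H2] := @locally_bounded R _ _ (fun (ij : 'I_m * 'I_m) y => 'D_('e_(ij.1)) (f ij.2) y) z0
  (fun ij => Ck_continuous (Ck_derive 'e_(ij.1) (Cf ij.2)) Oz0).
have [K3 K30 H3] := @locally_bounded R _ _ (fun (kij : 'I_m * ('I_m * 'I_m)) y =>
     'D_('e_(kij.1)) (fun w => 'D_('e_(kij.2.1)) (f kij.2.2) w) y) z0
  (fun kij => Ck_continuous (Ck_derive 'e_(kij.1) (Ck_derive 'e_(kij.2.1) (Cf kij.2.2))) Oz0).
have H4 : \forall y \near z0, Om y by exact: open_nbhs_nbhs.
have [d d0 Bd] := near_normE (filterI (filterI H1 H2) (filterI H3 H4)).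
pose K := K1 + K2 + K3.
have K0 : 0 <= K by rewrite !addr_ge0.
(* With del = 1/D, the three summands of D provide del < 1, 2 del m K <= 1/2 and del K <= d/4
   respectively. *)
pose D := 2 + 4 * (m%:R * K) + 4 * K / d.
have mK0 : 0 <= m%:R * K by rewrite mulr_ge0.
have Kd0 : 0 <= 4 * K / d by rewrite divr_ge0 ?mulr_ge0 // ltW.
have D0 : 0 < D by rewrite /D; lra.
have DV : D * D^-1 = 1 by rewrite divff // gt_eqF.
exists d, K, D^-1; split; first split => //.
- by rewrite invr_gt0.
- by rewrite invf_lt1 // /D; lra.
split.
- rewrite mulrAC -ler_pdivlMr ?invr_gt0 // invrK /D; lra.
- rewrite mulrC ler_pdivrMr // /D.
  apply: (@le_trans _ _ (d / 4 * (4 * K / d))); last by rewrite ler_wpM2l ?divr_ge0 ?ltW //; lra.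
  have -> : d / 4 * (4 * K / d) = K * (d / d) by field; rewrite gt_eqF.
  by rewrite divff ?mulr1 // gt_eqF.
- by move=> y /Bd[_ [_ Oy]].
split.
- by move=> y /Bd[[H _] _] j; apply: le_trans (H j) _; rewrite /K -addrA lerDl addr_ge0.
- by move=> y /Bd[[_ H] _] i j; apply: le_trans (H (i, j)) _; rewrite /K addrAC lerDr addr_ge0.
- by move=> y /Bd[_ [H _]] k i j; apply: le_trans (H (k, (i, j))) _; rewrite /K lerDr addr_ge0.
Qed.

End LocalFlow.

(** * Hamiltonian systems in coordinates *)

Section CkLocal.
Variables (R : realType) (V W : normedModType R).

Lemma Ck_local k (S : set V) (f : V -> W) :
  (forall x, S x -> exists U : set V, [/\ open U, U x & Ck k U f]) -> Ck k S f.
Proof.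
elim: k f => [|k IH] f H.
  by move=> x Sx; have [U [_ Ux Cf]] := H x Sx; exact: Cf.
split.
- by move=> x Sx; have [U [_ Ux Cf]] := H x Sx; exact: Ck_continuous Cf Ux.
- by move=> x v Sx; have [U [_ Ux Cf]] := H x Sx; exact: Ck_derivable Cf Ux.
- move=> v; apply: IH => x Sx; have [U [oU Ux Cf]] := H x Sx.
  by exists U; split=> //; exact: Ck_derive Cf.
Qed.

Lemma smooth_on_open k (S : set V) (f : V -> W) : open S -> smooth_on S f -> Ck k S f.
Proof.
move=> oS sf; apply: Ck_local => x Sx; have [U [F [oU Ux CF fF]]] := sf x Sx.
exists (U `&` S); split; [exact: openI|by split|].
apply: (@Ck_ext _ _ _ k (U `&` S) F); first exact: openI.
  by move=> y [Uy Sy]; rewrite fF.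
apply: (Ck_sub _ (CF k)); by move=> y [].
Qed.

Lemma Ck_linear k (U : set V) (f : V -> W) : continuous f -> linear f -> Ck k U f.
Proof.
move=> cf lf.
have D x v : is_derive x v f (f v).
  have E : (fun h : R => h^-1 *: (f (h *: v + x) - f x)) @ 0^' --> f v.
    apply: cvg_near_cst; near=> h; have h0 : h != 0 by near: h; exact: nbhs_dnbhs_neq.
    by rewrite lf addrK scalerA mulVf // scale1r.
  by split; [apply/cvg_ex; exists (f v)|apply: cvg_lim].
case: k => [|k]; first by move=> x _; exact: cf.
split=> [x _|x v _|v]; [exact: cf|by case: (D x v)|].
have -> : (fun x => 'D_v f x) = (fun=> f v) by apply/funext => x; case: (D x v).
exact: Ck_cst.
Unshelve. all: by end_near. Qed.

End CkLocal.

Lemma Ck_coord (R : realType) p q k (U : set 'M[R]_(p, q)) i j :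
  Ck k U (fun M : 'M[R]_(p, q) => M i j).
Proof.
apply: Ck_linear; first by move=> x; apply/differentiable_continuous/differentiable_coord.
by move=> a x y; rewrite !mxE.
Qed.

Lemma Ck_entry (R : realType) (V : normedModType R) p q k (U : set V) (f : V -> 'M[R]_(p, q)) i j :
  open U -> Ck k U f -> Ck k U (fun x => f x i j).
Proof.
move=> oU; elim: k f => [|k IH] f Cf; first by move=> x Ux; move/cvg_mxP: (Cf x Ux); apply.
have D x v : U x -> is_derive x v (fun x => f x i j) ('D_v f x i j).
  move=> Ux; have : is_derive x v f ('D_v f x) by apply: DeriveDef => //; exact: Ck_derivable Cf Ux.
  by move/is_derive_mxP.
split.
- by move=> x Ux; move/cvg_mxP: (Ck_continuous Cf Ux); apply.
- by move=> x v Ux; case: (D x v Ux).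
- move=> v; apply: (Ck_ext oU _ (IH _ (Ck_derive v Cf))) => x Ux; by case: (D x v Ux).
Qed.

Section StateSpace.
Variables (R : realType) (n : nat).
Local Notation N := (1 + (n + n))%N.

(* A state is a row vector (t, x, xi): time, position and covector. The functions tm, xp, mp read off its
   blocks, row by row for a matrix of states, and mk assembles them. *)
Definition i0 : 'I_N := lshift (n + n) (ord0 : 'I_1).
Definition ix (k : 'I_n) : 'I_N := rshift 1 (lshift n k).
Definition ip (k : 'I_n) : 'I_N := rshift 1 (rshift n k).

Lemma sum_state (V : nmodType) (F : 'I_N -> V) :
  \sum_i F i = F i0 + \sum_k F (ix k) + \sum_k F (ip k).
Proof. by rewrite !big_split_ord big_ord1 /= addrA. Qed.

Lemma state_ind (P : 'I_N -> Prop) : P i0 -> (forall k, P (ix k)) -> (forall k, P (ip k)) -> forall j, P j.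
Proof.
move=> P0 Px Pp j; case: (split_ordP j) => [k ->|k ->]; first by rewrite (ord1 k).
by case: (split_ordP k) => l ->; [exact: Px|exact: Pp].
Qed.

Definition sel (T : Type) (a : T) (b c : 'I_n -> T) (j : 'I_N) : T :=
  match fintype.split j with inl _ => a | inr k => match fintype.split k with inl l => b l | inr l => c l end end.

Lemma sel0 T (a : T) b c : sel a b c i0 = a.
Proof. by rewrite /sel; case: split_ordP => // k /eqP; rewrite eq_lrshift. Qed.

Lemma selx T (a : T) b c k : sel a b c (ix k) = b k.
Proof.
rewrite /sel /ix; case: split_ordP => [l /eqP|l]; first by rewrite eq_rlshift.
move/rshift_inj <-; case: split_ordP => [j /lshift_inj ->|j /eqP] //.
by rewrite eq_lrshift.
Qed.

Lemma selp T (a : T) b c k : sel a b c (ip k) = c k.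
Proof.
rewrite /sel /ip; case: split_ordP => [l /eqP|l]; first by rewrite eq_rlshift.
move/rshift_inj <-; case: split_ordP => [j /eqP|j /rshift_inj ->] //.
by rewrite eq_rlshift.
Qed.

Definition tm p (Z : 'M[R]_(p, N)) : 'cV[R]_p := \col_i Z i i0.
Definition xp p (Z : 'M[R]_(p, N)) : 'M[R]_(p, n) := \matrix_(i, k) Z i (ix k).
Definition mp p (Z : 'M[R]_(p, N)) : 'M[R]_(p, n) := \matrix_(i, k) Z i (ip k).
Definition mk p (t : 'cV[R]_p) (x xi : 'M[R]_(p, n)) : 'M[R]_(p, N) :=
  \matrix_(i, j) sel (t i 0) (x i) (xi i) j.

Lemma tmE p (Z : 'M[R]_(p, N)) i j : tm Z i j = Z i i0. Proof. by rewrite mxE. Qed.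
Lemma xpE p (Z : 'M[R]_(p, N)) i k : xp Z i k = Z i (ix k). Proof. by rewrite mxE. Qed.
Lemma mpE p (Z : 'M[R]_(p, N)) i k : mp Z i k = Z i (ip k). Proof. by rewrite mxE. Qed.
Lemma vfE m (f : 'I_m -> 'rV[R]_m -> R) z i j : vf f z i j = f j z. Proof. by rewrite mxE. Qed.
Lemma dvfE m (f : 'I_m -> 'rV[R]_m -> R) z i j : dvf f z i j = partial i (f j) z.
Proof. by rewrite mxE. Qed.
Lemma mulmx_entry p q r (A : 'M[R]_(p, q)) (B : 'M[R]_(q, r)) i j : (A *m B) i j = \sum_k A i k * B k j.
Proof. by rewrite mxE. Qed.
Lemma addmx_entry p q (A B : 'M[R]_(p, q)) i j : (A + B) i j = A i j + B i j. Proof. by rewrite mxE. Qed.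
Lemma oppmx_entry p q (A : 'M[R]_(p, q)) i j : (- A) i j = - A i j. Proof. by rewrite mxE. Qed.
Lemma trmx_entry p q (A : 'M[R]_(p, q)) i j : A^T i j = A j i. Proof. by rewrite mxE. Qed.

Lemma tm_mk p (t : 'cV[R]_p) x xi : tm (mk t x xi) = t.
Proof. by apply/matrixP => i j; rewrite !mxE sel0 (ord1 j). Qed.
Lemma xp_mk p (t : 'cV[R]_p) x xi : xp (mk t x xi) = x.
Proof. by apply/matrixP => i j; rewrite !mxE selx. Qed.
Lemma mp_mk p (t : 'cV[R]_p) x xi : mp (mk t x xi) = xi.
Proof. by apply/matrixP => i j; rewrite !mxE selp. Qed.

Lemma state_ext p (Z W : 'M[R]_(p, N)) : tm Z = tm W -> xp Z = xp W -> mp Z = mp W -> Z = W.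
Proof.
move=> /matrixP t /matrixP x /matrixP q; apply/matrixP => i.
by apply: state_ind => [|k|k]; [have := t i 0|have := x i k|have := q i k]; rewrite !mxE.
Qed.

Lemma tmM p q (A : 'M[R]_(p, q)) (Z : 'M[R]_(q, N)) : tm (A *m Z) = A *m tm Z.
Proof. by apply/matrixP => i j; rewrite !mxE; apply: eq_bigr => k _; rewrite !mxE. Qed.
Lemma xpM p q (A : 'M[R]_(p, q)) (Z : 'M[R]_(q, N)) : xp (A *m Z) = A *m xp Z.
Proof. by apply/matrixP => i j; rewrite !mxE; apply: eq_bigr => k _; rewrite !mxE. Qed.
Lemma mpM p q (A : 'M[R]_(p, q)) (Z : 'M[R]_(q, N)) : mp (A *m Z) = A *m mp Z.
Proof. by apply/matrixP => i j; rewrite !mxE; apply: eq_bigr => k _; rewrite !mxE. Qed.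

Lemma tm_row p i (Z : 'M[R]_(p, N)) : tm (row i Z) = row i (tm Z).
Proof. by apply/matrixP => a b; rewrite !mxE. Qed.
Lemma xp_row p i (Z : 'M[R]_(p, N)) : xp (row i Z) = row i (xp Z).
Proof. by apply/matrixP => a b; rewrite !mxE. Qed.
Lemma mp_row p i (Z : 'M[R]_(p, N)) : mp (row i Z) = row i (mp Z).
Proof. by apply/matrixP => a b; rewrite !mxE. Qed.

(** Matrix of the values of the canonical symplectic form on the rows of Z and of W; [omega Z Z = 0]
    says that the rows of Z span an isotropic space, and equivalently that [xp Z *m (mp Z)^T] is
    symmetric. *)
Definition omega p q (Z : 'M[R]_(p, N)) (W : 'M[R]_(q, N)) : 'M[R]_(p, q) :=
  xp Z *m (mp W)^T - mp Z *m (xp W)^T.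

(* The time coordinate follows z' = 1, which makes the Hamiltonian system autonomous. *)
Definition hf (H : 'rV[R]_N -> R) (j : 'I_N) (z : 'rV[R]_N) : R :=
  sel 1 (fun k => partial (ip k) H z) (fun k => - partial (ix k) H z) j.

Lemma hf0 H z : hf H i0 z = 1. Proof. exact: sel0. Qed.
Lemma hfx H k z : hf H (ix k) z = partial (ip k) H z. Proof. exact: selx. Qed.
Lemma hfp H k z : hf H (ip k) z = - partial (ix k) H z. Proof. exact: selp. Qed.

Lemma Ck_hf k U H j : open U -> Ck k.+1 U H -> Ck k U (hf H j).
Proof.
move=> oU CH; elim/state_ind: j => [|l|l].
- by apply: (Ck_ext oU _ (Ck_cst k U (1 : R))) => z _; rewrite hf0.
- by apply: (Ck_ext oU _ (Ck_partial (ip l) CH)) => z _; rewrite hfx.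
- by apply: (Ck_ext oU _ (CkN oU (Ck_partial (ix l) CH))) => z _; rewrite hfp.
Qed.

(** The coordinate-free characterization of the Hamiltonian field, dH = omega(X_H, .), on directions
    of constant time. This form is what makes the field transform correctly under cotangent
    lifts. *)
Lemma derive_state U (H : 'rV[R]_N -> R) z w : open U -> U z -> Ck 1 U H -> tm w = 0 ->
  'D_w H z = omega (vf (hf H) z) w 0 0.
Proof.
move=> oU Uz CH tw; rewrite (derive_partial _ oU Uz CH) sum_state.
have -> : w 0 i0 = 0 by move/matrixP/(_ 0 0): tw; rewrite !mxE.
rewrite mul0r add0r !mxE addrC; congr (_ + _); last rewrite -sumrN; apply: eq_bigr => k _.
  by rewrite !mxE hfx mulrC.
by rewrite !mxE hfp mulNr opprK mulrC.
Qed.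

Section Linearization.
Variables (H : 'rV[R]_N -> R) (U : set 'rV[R]_N) (z : 'rV[R]_N).
Hypotheses (oU : open U) (Uz : U z) (CH : Ck 2 U H).

Definition hess (a b : 'I_n -> 'I_N) : 'M[R]_n :=
  \matrix_(k, l) partial (a k) (partial (b l) H) z.

Lemma hess_tr a b : (hess a b)^T = hess b a.
Proof. by apply/matrixP => k l; rewrite !mxE; exact: partial_commute oU Uz CH. Qed.

Lemma dvf_tm p (Z : 'M[R]_(p, N)) : tm (Z *m dvf (hf H) z) = 0.
Proof.
apply/matrixP => i j; rewrite tmE [LHS]mulmx_entry mxE big1 // => k _; rewrite [X in _ * X]dvfE.
have -> : hf H i0 = cst 1 by apply/funext => y; rewrite hf0.
by rewrite partialE derive_cst mulr0.
Qed.

Lemma mul_state p (Z : 'M[R]_(p, N)) (D : 'M[R]_N) (a : 'I_n -> 'I_N) : tm Z = 0 ->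
  \matrix_(i, k) (Z *m D) i (a k) =
  xp Z *m (\matrix_(l, k) D (ix l) (a k)) + mp Z *m (\matrix_(l, k) D (ip l) (a k)).
Proof.
move=> tZ; apply/matrixP => i k; rewrite !mxE sum_state.
have -> : Z i i0 = 0 by move/matrixP/(_ i 0): tZ; rewrite tmE mxE.
by rewrite mul0r add0r; congr (_ + _); apply: eq_bigr => l _; rewrite !mxE.
Qed.

Lemma dvf_xp p (Z : 'M[R]_(p, N)) : tm Z = 0 ->
  xp (Z *m dvf (hf H) z) = xp Z *m hess ix ip + mp Z *m hess ip ip.
Proof.
move=> tZ; rewrite {1}/xp (mul_state _ _ tZ).
have E k : hf H (ix k) = partial (ip k) H by apply/funext => y; rewrite hfx.
by congr (_ + _); congr (_ *m _); apply/matrixP => l k; rewrite !mxE E.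
Qed.

Lemma dvf_mp p (Z : 'M[R]_(p, N)) : tm Z = 0 ->
  mp (Z *m dvf (hf H) z) = - (xp Z *m hess ix ix + mp Z *m hess ip ix).
Proof.
move=> tZ; rewrite {1}/mp (mul_state _ _ tZ).
have E k i : partial i (hf H (ip k)) z = - partial i (partial (ix k) H) z.
  have -> : hf H (ip k) = - partial (ix k) H by apply/funext => y; rewrite hfp.
  by rewrite !partialE deriveN //; exact: Ck_derivable (Ck_partial _ CH) Uz.
by rewrite opprD -!mulmxN; congr (_ + _); congr (_ *m _); apply/matrixP => l k; rewrite !mxE E.
Qed.

(* The linearized Hamiltonian flow preserves the symplectic form. *)
Lemma dvf_symmetric p (Z : 'M[R]_(p, N)) : tm Z = 0 ->
  let S := xp (Z *m dvf (hf H) z) *m (mp Z)^T + xp Z *m (mp (Z *m dvf (hf H) z))^T in S^T = S.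
Proof.
move=> tZ /=; rewrite dvf_xp // dvf_mp //.
set X := xp Z; set Y := mp Z.
have := hess_tr ix ix; have := hess_tr ip ip; have := hess_tr ip ix.
move: (hess ix ip) (hess ip ip) (hess ip ix) (hess ix ix) => A B C D CA BB DD.
have -> : (X *m A + Y *m B) *m Y^T + X *m (- (X *m D + Y *m C))^T =
    Y *m B *m Y^T - X *m D *m X^T.
  rewrite raddfN raddfD /= !trmx_mul CA DD mulmxN mulmxDr mulmxDl !mulmxA opprD.
  by rewrite [X in _ + X]addrC addrA [X in X - _]addrAC subrr add0r.
by rewrite raddfB /= !trmx_mul !trmxK BB DD !mulmxA.
Qed.

End Linearization.
End StateSpace.

Arguments i0 {n}.

(** * Cotangent lifts of coordinate changes *)

Section CotangentLift.
Variables (R : realType) (n : nat).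
Local Notation N := (1 + (n + n))%N.
Variables (V : set 'rV[R]_n) (phi : 'I_n -> 'rV[R]_n -> R).
Hypotheses (oV : open V) (Cphi : forall k a, Ck k V (phi a)).

Definition jac (x : 'rV[R]_n) : 'M[R]_n := \matrix_(k, a) partial k (phi a) x.

Lemma jacE x k a : jac x k a = partial k (phi a) x.
Proof. by rewrite mxE. Qed.

Hypothesis uJ : forall x, V x -> jac x \in unitmx.

Definition ctlift_dom : set 'rV[R]_N := [set z | V (xp z)].

Definition ctlift (j : 'I_N) (z : 'rV[R]_N) : R :=
  mk (tm z) (\row_a phi a (xp z)) (mp z *m (invmx (jac (xp z)))^T) 0 j.

Lemma vf_lift z : vf ctlift z = mk (tm z) (\row_a phi a (xp z)) (mp z *m (invmx (jac (xp z)))^T).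
Proof. by apply/rowP => j; rewrite vfE. Qed.

Lemma xp_continuous : continuous (fun z : 'rV[R]_N => xp z).
Proof.
move=> z; apply/(@cvg_mxP _ _ (nbhs z)) => i j; rewrite xpE; under eq_fun do rewrite xpE.
apply: differentiable_continuous; exact: differentiable_coord.
Qed.

Lemma lift_dom_open : open ctlift_dom.
Proof. by apply: open_comp => // z _; exact: xp_continuous. Qed.

Lemma Ck_xp k (U : set 'rV[R]_N) (f : 'rV[R]_n -> R) : open U -> U `<=` ctlift_dom -> Ck k V f ->
  Ck k U (fun z => f (xp z)).
Proof.
move=> oU UV Cf; apply: (Ck_comp oU oV _ _ Cf) => [z /UV //|i].
by apply: (Ck_ext oU _ (Ck_coord k U 0 (ix i))) => z _; rewrite xpE.
Qed.

Lemma Ck_lift k j : Ck k ctlift_dom (ctlift j).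
Proof.
have oL := lift_dom_open.
elim/state_ind: j => [|a|a].
- apply: (Ck_ext oL _ (Ck_coord k _ 0 i0)) => z _; by rewrite /ctlift -[RHS](tmE _ 0 0) tm_mk tmE.
- apply: (@Ck_ext _ _ _ k ctlift_dom (fun z => phi a (xp z))) => //.
    by move=> z _; rewrite /ctlift -[RHS]xpE xp_mk mxE.
  by apply: Ck_xp.
apply: (@Ck_ext _ _ _ k ctlift_dom (fun z => \sum_b mp z 0 b * invmx (jac (xp z)) a b)) => //.
  by move=> z _; rewrite /ctlift -[RHS]mpE mp_mk mulmx_entry; apply: eq_bigr => b _; rewrite trmx_entry.
apply: Ck_sum => // b; apply: CkM => //.
  by apply: (Ck_ext oL _ (Ck_coord k _ 0 (ip b))) => z _; rewrite mpE.
apply: (@Ck_xp k ctlift_dom (fun x => invmx (jac x) a b)) => //.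
apply: Ck_invmx => // c d; apply: (Ck_ext oV _ (Ck_partial c (Cphi k.+1 d))) => x _.
by rewrite jacE.
Qed.

(** The Hessian of the coordinate change contracted with the transported covector. It measures how
    the momentum part of the differential of the lift depends on the displacement of the base point;
    its symmetry is the reason why lifts are symplectic. *)
Definition lift_curv (z : 'rV[R]_N) : 'M[R]_n :=
  \matrix_(j, k) \sum_a mp (vf ctlift z) 0 a * partial j (partial k (phi a)) (xp z).

Lemma lift_curvE z j k : lift_curv z j k =
  \sum_a mp (vf ctlift z) 0 a * partial j (partial k (phi a)) (xp z).
Proof. exact: mxE. Qed.

Lemma lift_curv_sym z : ctlift_dom z -> (lift_curv z)^T = lift_curv z.
Proof.
move=> Vz; apply/matrixP => j k; rewrite trmx_entry [LHS]lift_curvE [RHS]lift_curvE; apply: eq_bigr => a _.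
by rewrite (partial_commute k j oV Vz (Cphi 2 a)).
Qed.

Lemma is_derive_lift z u : ctlift_dom z -> is_derive z u (vf ctlift) (u *m dvf ctlift z).
Proof.
move=> Lz; apply/is_derive_mxP => i j; rewrite (ord1 i).
have -> : (u *m dvf ctlift z) 0 j = 'D_u (ctlift j) z.
  rewrite [LHS]mulmx_entry (derive_partial _ lift_dom_open Lz (Ck_lift 1 j)); apply: eq_bigr => k _.
  by rewrite dvfE.
have -> : (fun y => vf ctlift y 0 j) = ctlift j by apply/funext => y; rewrite vfE.
by apply: DeriveDef => //; exact: Ck_derivable (Ck_lift 1 j) Lz.
Qed.

Lemma is_derive_xp z u : is_derive z u (fun y : 'rV[R]_N => xp y) (xp u).
Proof.
have /is_derive_mxP H : is_derive z u id u by exact: is_derive_id.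
apply/is_derive_mxP => i k; rewrite xpE.
have -> : (fun y : 'rV[R]_N => xp y i k) = (fun y => y i (ix k)) by apply/funext => y; rewrite xpE.
exact: H.
Qed.

Lemma is_derive_mp z u : is_derive z u (fun y : 'rV[R]_N => mp y) (mp u).
Proof.
have /is_derive_mxP H : is_derive z u id u by exact: is_derive_id.
apply/is_derive_mxP => i k; rewrite mpE.
have -> : (fun y : 'rV[R]_N => mp y i k) = (fun y => y i (ip k)) by apply/funext => y; rewrite mpE.
exact: H.
Qed.

Lemma dlift_tm1 (u : 'rV[R]_N) z : ctlift_dom z -> tm (u *m dvf ctlift z) = tm u.
Proof.
move=> Lz; have /is_derive_mxP/(_ 0 i0)[_ H] := is_derive_lift u Lz.
apply/matrixP => i j; rewrite (ord1 i) tmE [RHS]tmE -H.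
have -> : (fun y => vf ctlift y 0 i0) = (fun y => y 0 i0).
  by apply/funext => y; rewrite vfE /ctlift -[LHS](tmE _ 0 0) tm_mk tmE.
have /is_derive_mxP/(_ 0 i0)[_ ->] : is_derive z u id u by exact: is_derive_id.
by [].
Qed.

Lemma dlift_xp1 (u : 'rV[R]_N) z : ctlift_dom z -> xp (u *m dvf ctlift z) = xp u *m jac (xp z).
Proof.
move=> Lz; apply/rowP => a; rewrite [LHS]xpE.
have /is_derive_mxP/(_ 0 (ix a))[_ <-] := is_derive_lift u Lz.
have -> : (fun y => vf ctlift y 0 (ix a)) = (fun y => phi a (xp y)).
  by apply/funext => y; rewrite vfE /ctlift -[LHS]xpE xp_mk mxE.
have [_ ->] := is_derive_chain oV Lz (Cphi 1 a) (is_derive_xp z u).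
by rewrite [RHS]mulmx_entry; apply: eq_bigr => k _; rewrite jacE.
Qed.

Lemma mp_lift z : ctlift_dom z -> mp z = mp (vf ctlift z) *m (jac (xp z))^T.
Proof.
by move=> Lz; rewrite vf_lift mp_mk -mulmxA -trmx_mul mulmxV ?uJ // trmx1 mulmx1.
Qed.

(** Obtained by differentiating the identity [mp_lift], in which the new covector is multiplied by
    the Jacobian; this avoids the derivative of the inverse Jacobian. *)
Lemma dlift_mp1 (u : 'rV[R]_N) z : ctlift_dom z ->
  mp u = mp (u *m dvf ctlift z) *m (jac (xp z))^T + xp u *m lift_curv z.
Proof.
move=> Lz.
have D1 : is_derive z u (fun y => mp (vf ctlift y)) (mp (u *m dvf ctlift z)).
  have /is_derive_mxP H := is_derive_lift u Lz.
  apply/is_derive_mxP => i k; rewrite mpE.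
  have -> : (fun y => mp (vf ctlift y) i k) = (fun y => vf ctlift y i (ip k)) by apply/funext => y; rewrite mpE.
  exact: H.
pose dJ : 'M[R]_n := \matrix_(a, k) \sum_j xp u 0 j * partial j (partial k (phi a)) (xp z).
have D2 : is_derive z u (fun y => (jac (xp y))^T) dJ.
  apply/is_derive_mxP => a k; rewrite [X in is_derive _ _ _ X]mxE.
  have -> : (fun y => (jac (xp y))^T a k) = (fun y => partial k (phi a) (xp y)).
    by apply/funext => y; rewrite trmx_entry [LHS]jacE.
  exact: is_derive_chain oV Lz (Ck_partial k (Cphi 2 a)) (is_derive_xp z u).
have [_ <-] := is_derive_mp z u.
have [_ D3] := is_derive_mulmx D1 D2.
have -> : 'D_u (fun y => mp y) z = 'D_u (fun y => mp (vf ctlift y) *m (jac (xp y))^T) z.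
  apply: near_eq_derive.
  have : \forall y \near z, ctlift_dom y by apply: open_nbhs_nbhs; split=> //; exact: lift_dom_open.
  by apply: filterS => y; exact: mp_lift.
rewrite D3; congr (_ + _); apply/rowP => k; rewrite [LHS]mulmx_entry [RHS]mulmx_entry.
transitivity (\sum_j \sum_a xp u 0 j * (mp (vf ctlift z) 0 a * partial j (partial k (phi a)) (xp z))).
  rewrite exchange_big /=; apply: eq_bigr => a _; rewrite [X in _ * X = _]mxE mulr_sumr.
  by apply: eq_bigr => j _; rewrite mulrCA.
by apply: eq_bigr => j _; rewrite -mulr_sumr lift_curvE.
Qed.

End CotangentLift.

Section LiftMatrix.
Variables (R : realType) (n : nat).
Local Notation N := (1 + (n + n))%N.
Variables (V : set 'rV[R]_n) (phi : 'I_n -> 'rV[R]_n -> R).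
Hypotheses (oV : open V) (Cphi : forall k a, Ck k V (phi a))
  (uJ : forall x, V x -> jac phi x \in unitmx).
Variables (z : 'rV[R]_N) (Lz : ctlift_dom V z).
Local Notation D := (dvf (ctlift phi) z).
Local Notation J := (jac phi (xp z)).
Local Notation E := (lift_curv phi z).

Lemma dlift_tm p (Z : 'M[R]_(p, N)) : tm (Z *m D) = tm Z.
Proof.
by apply/row_matrixP => i; rewrite -!tm_row row_mul (dlift_tm1 oV Cphi uJ).
Qed.

Lemma dlift_xp p (Z : 'M[R]_(p, N)) : xp (Z *m D) = xp Z *m J.
Proof.
by apply/row_matrixP => i; rewrite -xp_row !row_mul (dlift_xp1 oV Cphi uJ) // xp_row.
Qed.

Lemma dlift_mp p (Z : 'M[R]_(p, N)) : mp Z = mp (Z *m D) *m J^T + xp Z *m E.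
Proof.
apply/row_matrixP => i; rewrite -mp_row (dlift_mp1 oV Cphi uJ _ Lz).
by rewrite linearD /= !row_mul -mp_row -xp_row row_mul.
Qed.

Lemma omega_lift p q (Z : 'M[R]_(p, N)) (W : 'M[R]_(q, N)) : omega (Z *m D) (W *m D) = omega Z W.
Proof.
rewrite /omega (dlift_mp Z) (dlift_mp W) !dlift_xp.
rewrite raddfD /= !trmx_mul !trmxK (lift_curv_sym oV Cphi) //.
rewrite mulmxDr mulmxDl !mulmxA.
by rewrite [X in _ = _ - X]addrC opprD addrA addrK.
Qed.

Lemma dlift_inj p (Z : 'M[R]_(p, N)) : Z *m D = 0 -> Z = 0.
Proof.
move=> Z0; have x0 : xp Z = 0.
  have : xp Z *m J = 0 by rewrite -dlift_xp Z0; apply/matrixP => i j; rewrite !mxE.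
  by move/(congr1 (fun X => X *m invmx J)); rewrite mulmxK ?mul0mx //; exact: uJ.
apply: state_ext.
- by rewrite -dlift_tm Z0.
- by rewrite x0; apply/matrixP => i j; rewrite !mxE.
rewrite dlift_mp x0 Z0 mul0mx addr0; have -> : mp (0 : 'M[R]_(p, N)) = 0 by apply/matrixP => i j; rewrite !mxE.
by rewrite mul0mx.
Qed.

Lemma dlift_surj p (L : 'M[R]_(p, N)) : tm L = 0 -> exists2 W, tm W = 0 & W *m D = L.
Proof.
move=> tL; pose x := xp L *m invmx J; pose W := mk 0 x (mp L *m J^T + x *m E).
have uJz : J \in unitmx by exact: uJ.
exists W; first by rewrite tm_mk.
apply: state_ext.
- by rewrite dlift_tm tm_mk tL.
- by rewrite dlift_xp xp_mk /x mulmxKV.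
have := dlift_mp W; rewrite mp_mk xp_mk => /addIr.
move/(congr1 (fun X => X *m invmx J^T)); rewrite !mulmxK ?unitmx_tr //.
Qed.

End LiftMatrix.

Section HamiltonianLift.
Variables (R : realType) (n : nat).
Local Notation N := (1 + (n + n))%N.

Lemma omega_nondeg (u : 'rV[R]_N) : (forall w : 'rV[R]_N, tm w = 0 -> omega u w = 0) -> xp u = 0 /\ mp u = 0.
Proof.
move=> H; split; apply/rowP => k; rewrite [RHS]mxE.
  have := H (mk 0 0 (delta_mx 0 k)); rewrite tm_mk => /(_ erefl) /matrixP/(_ 0 0).
  rewrite /omega xp_mk mp_mk trmx0 mulmx0 subr0 trmx_delta.
  by rewrite -colE !mxE.
have := H (mk 0 (delta_mx 0 k) 0); rewrite tm_mk => /(_ erefl) /matrixP/(_ 0 0).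
rewrite /omega xp_mk mp_mk trmx0 mulmx0 sub0r trmx_delta -colE !mxE => /eqP.
by rewrite oppr_eq0 => /eqP.
Qed.

Lemma omegaBl p q (Z Z' : 'M[R]_(p, N)) (W : 'M[R]_(q, N)) : omega (Z - Z') W = omega Z W - omega Z' W.
Proof.
rewrite /omega; have -> : xp (Z - Z') = xp Z - xp Z' by apply/matrixP => i j; rewrite !mxE.
have -> : mp (Z - Z') = mp Z - mp Z' by apply/matrixP => i j; rewrite !mxE.
by rewrite !mulmxBl !opprB addrACA [RHS]addrACA; congr (_ + _); rewrite addrC.
Qed.

Variables (V : set 'rV[R]_n) (phi : 'I_n -> 'rV[R]_n -> R).
Hypotheses (oV : open V) (Cphi : forall k a, Ck k V (phi a))
  (uJ : forall x, V x -> jac phi x \in unitmx).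
Variables (z : 'rV[R]_N) (Lz : ctlift_dom V z).
Variables (U U' : set 'rV[R]_N) (K K' : 'rV[R]_N -> R).
Hypotheses (oU : open U) (oU' : open U') (Uz : U z) (Uz' : U' (vf (ctlift phi) z))
  (CK : Ck 1 U K) (CK' : Ck 1 U' K').

(* Cotangent lifts map the Hamiltonian vector field of K' o lift to that of K'; only the values on the
   slice of constant time through z matter. *)
Lemma lift_hamiltonian : (\forall y \near z, tm (y : 'rV[R]_N) = tm z -> K y = K' (vf (ctlift phi) y)) ->
  vf (hf K) z *m dvf (ctlift phi) z = vf (hf K') (vf (ctlift phi) z).
Proof.
move=> KK'; set D := dvf _ _; set T := vf (ctlift phi).
have E w : tm w = 0 -> 'D_w K z = 'D_(w *m D) K' (T z).
  move=> tw.
  have C1 : is_derive z w K ('D_w K z) by apply: DeriveDef => //; exact: Ck_derivable CK Uz.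
  have [_ <-] := iffLR (is_derive_lineP K z w _) C1.
  have C2 := is_derive_lift oV Cphi uJ w Lz.
  have := is_derive_chain oU' Uz' CK' C2.
  rewrite -(derive_partial _ oU' Uz' CK') => /is_derive_lineP[_ <-].
  apply: near_eq_derive.
  have cl : continuous (fun s : R => z + s *: w).
    by move=> s; apply: cvgD; [exact: cvg_cst|apply: cvgZr_tmp; exact: cvg_id].
  have cl0 : (z + s *: w) @[s --> (0 : R)] --> z.
    by have := cl (0 : R); rewrite /continuous_at scale0r addr0.
  have cl1 : \forall s \near (0 : R), tm (z + s *: w) = tm z -> K (z + s *: w) = K' (T (z + s *: w)).
    exact: cl0 _ KK'.
  apply: filterS cl1 => s -> //.
  have w0 : w 0 i0 = 0 by move/matrixP/(_ 0 0): tw; rewrite tmE mxE.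
  by apply/matrixP => i j; rewrite !mxE (ord1 i) w0 mulr0 addr0.
have tmu : tm (vf (hf K) z) = const_mx 1 by apply/matrixP => i j; rewrite tmE vfE hf0 mxE.
have tmu' : tm (vf (hf K') (T z)) = const_mx 1 by apply/matrixP => i j; rewrite tmE vfE hf0 mxE.
(* Both vectors have the same pairing with every [w *m D] for [tm w = 0], and these exhaust the
   directions of constant time, so nondegeneracy identifies their position and momentum parts. *)
have [|x0 p0] := @omega_nondeg (vf (hf K) z *m D - vf (hf K') (T z)).
  move=> l tl; have [w tw <-] := dlift_surj oV Cphi uJ Lz tl.
  rewrite omegaBl (omega_lift oV Cphi uJ Lz); apply/matrixP => i j.
  rewrite (ord1 i) (ord1 j) addmx_entry oppmx_entry [RHS]mxE.
  have tw' : tm (w *m D) = 0 by rewrite (dlift_tm oV Cphi uJ Lz).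
  have := E _ tw; rewrite (derive_state oU Uz CK tw) (derive_state oU' Uz' CK' tw') => ->.
  by rewrite subrr.
apply: state_ext.
- by rewrite (dlift_tm oV Cphi uJ Lz) tmu.
- apply/eqP; rewrite -subr_eq0 -x0; apply/eqP/matrixP => i j; by rewrite !mxE.
- apply/eqP; rewrite -subr_eq0 -p0; apply/eqP/matrixP => i j; by rewrite !mxE.
Qed.

End HamiltonianLift.

(** * Coordinate changes of the atlas and their Jacobians *)

Section Charts.
Variables (R : realType) (n : nat) (M : topologicalType) (A : set (chart R n M)).
Hypothesis hM : smooth_manifold A.
Implicit Types c : chart R n M.

Definition trans c c' (a : 'I_n) (x : 'rV[R]_n) : R := chart_map c' (chart_inv c x) 0 a.
Definition overlap c c' : set 'rV[R]_n := chart_map c @` (chart_dom c `&` chart_dom c').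

Lemma overlap_mem c c' q : chart_dom c q -> chart_dom c' q -> overlap c c' (chart_map c q).
Proof. by exists q. Qed.

Lemma row_trans c c' q : chart_dom c q -> \row_a trans c c' a (chart_map c q) = chart_map c' q.
Proof. by move=> cq; apply/rowP => a; rewrite mxE /trans chart_mapK. Qed.

Lemma chart_inv_dom c x : (chart_map c @` chart_dom c) x -> chart_dom c (chart_inv c x).
Proof. by case=> q cq <-; rewrite chart_mapK. Qed.

Lemma chart_invK c x : (chart_map c @` chart_dom c) x -> chart_map c (chart_inv c x) = x.
Proof. by case=> q cq <-; rewrite chart_mapK. Qed.

Lemma overlap_near c c' x : overlap c c' x -> \forall y \near x, overlap c c' y.
Proof.
case=> q [cq c'q] <-.
have xc : (chart_map c @` chart_dom c) (chart_map c q) by exists q.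
have H1 : \forall y \near chart_map c q, (chart_map c @` chart_dom c) y.
  by apply: open_nbhs_nbhs; split=> //; exact: chart_codom_open.
have H2 : \forall y \near chart_map c q, chart_dom c' (chart_inv c y).
  have := chart_inv_continuous xc; rewrite /prop_for /continuous_at chart_mapK // => /(_ (chart_dom c')).
  by apply; apply: open_nbhs_nbhs; split=> //; exact: chart_dom_open.
apply: filterS (filterI H1 H2) => y [yc yc']; exists (chart_inv c y); last exact: chart_invK.
by split=> //; exact: chart_inv_dom.
Qed.

Lemma overlap_open c c' : open (overlap c c').
Proof. by rewrite openE => x /overlap_near. Qed.

Lemma Ck_trans c c' k a : A c -> A c' -> Ck k (overlap c c') (trans c c' a).
Proof.
move=> Ac Ac'; have [_ _ [_ /(_ c c' Ac Ac') sm]] := hM.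
have := smooth_on_open k (@overlap_open c c') sm.
move/(Ck_entry 0 a (@overlap_open c c')); exact.
Qed.

Lemma jac_id c q : chart_dom c q -> jac (trans c c) (chart_map c q) = 1%:M.
Proof.
move=> cq; apply/matrixP => k a; rewrite jacE partialE.
have -> : 'D_('e_k) (trans c c a) (chart_map c q) = 'D_('e_k) (fun x : 'rV[R]_n => x 0 a) (chart_map c q).
  apply: near_eq_derive; have := @overlap_near c c _ (overlap_mem cq cq).
  by apply: filterS => y [r [cr _] <-]; rewrite /trans chart_mapK.
have /is_derive_mxP/(_ 0 a)[_ ->] : is_derive (chart_map c q) 'e_k id 'e_k by exact: is_derive_id.
by rewrite !mxE eqxx /= eq_sym.
Qed.

Lemma jac_chain c c' c'' q : A c -> A c' -> A c'' ->
  chart_dom c q -> chart_dom c' q -> chart_dom c'' q ->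
  jac (trans c c') (chart_map c q) *m jac (trans c' c'') (chart_map c' q) = jac (trans c c'') (chart_map c q).
Proof.
move=> Ac Ac' Ac'' cq c'q c''q; apply/matrixP => k b; rewrite [RHS]jacE partialE.
have o1 := overlap_mem cq c'q; have o2 := overlap_mem c'q c''q; have o3 := overlap_mem cq c''q.
have Dg : is_derive (chart_map c q) 'e_k (fun x => \row_a trans c c' a x) (\row_a jac (trans c c') (chart_map c q) k a).
  apply/is_derive_mxP => i a; rewrite (ord1 i) mxE jacE partialE.
  have -> : (fun y => (\row_a0 trans c c' a0 y) 0 a) = trans c c' a by apply/funext => y; rewrite mxE.
  by apply: DeriveDef => //; exact: Ck_derivable (Ck_trans 1 a Ac Ac') o1.
have o2' : overlap c' c'' (\row_a trans c c' a (chart_map c q)) by rewrite row_trans.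
have := is_derive_chain (@overlap_open c' c'') o2' (Ck_trans 1 b Ac' Ac'') Dg.
rewrite row_trans // => -[_ H]; rewrite mulmx_entry.
transitivity (\sum_i (\row_a jac (trans c c') (chart_map c q) k a) 0 i * partial i (trans c' c'' b) (chart_map c' q)).
  by apply: eq_bigr => i _; rewrite mxE [X in _ * X = _]jacE.
rewrite -H; apply: near_eq_derive.
apply: filterS (overlap_near o1) => y [r [cr c'r] <-].
by rewrite row_trans // /trans !chart_mapK.
Qed.

Lemma jac_unit c c' x : A c -> A c' -> overlap c c' x -> jac (trans c c') x \in unitmx.
Proof.
move=> Ac Ac' [q [cq c'q] <-].
have := jac_chain Ac Ac' Ac cq c'q cq; rewrite jac_id // => /mulmx1_unit[].
by [].
Qed.

End Charts.

(** * Hamiltonian systems on the cotangent bundle *)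

Lemma derive_along_line (R : realType) (V W : normedModType R) (f g : V -> W) z w l :
  (\forall s \near (0 : R), f (z + s *: w) = g (z + s *: w)) ->
  is_derive z w f l -> is_derive z w g l.
Proof.
move=> fg /is_derive_lineP df; apply/is_derive_lineP; exact: near_eq_is_derive df.
Qed.

Lemma cvg_line (R : realType) (V : normedModType R) (z w : V) : (z + s *: w) @[s --> (0 : R)] --> z.
Proof.
have cl : continuous (fun s : R => z + s *: w).
  by move=> s; apply: cvgD; [exact: cvg_cst|apply: cvgZr_tmp; exact: cvg_id].
by have := cl (0 : R); rewrite /continuous_at scale0r addr0.
Qed.

Section FieldAlongCurve.
Variables (R : realType) (m p : nat) (Om : set 'rV[R]_m) (f : 'I_p -> 'rV[R]_m -> R).
Hypotheses (oO : open Om).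

Lemma vf_continuous z : (forall j, Ck 0 Om (f j)) -> Om z -> {for z, continuous (fun y => \row_j f j y)}.
Proof.
move=> Cf Oz; apply/(@cvg_mxP _ _ (nbhs z)) => i j; rewrite mxE; under eq_fun do rewrite mxE.
exact: Cf.
Qed.

End FieldAlongCurve.

Lemma is_derive_vf_chain (R : realType) (V : normedModType R) m (Om : set 'rV[R]_m)
    (f : 'I_m -> 'rV[R]_m -> R) (g : V -> 'rV[R]_m) (y v : V) (l : 'rV[R]_m) :
  open Om -> Om (g y) -> (forall j, Ck 1 Om (f j)) -> is_derive y v g l ->
  is_derive y v (fun y => vf f (g y)) (l *m dvf f (g y)).
Proof.
move=> oO Oy Cf dg; apply/is_derive_mxP => i j.
have -> : (fun y => vf f (g y) i j) = (fun y => f j (g y)) by apply/funext => x; rewrite vfE.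
have := is_derive_chain oO Oy (Cf j) dg.
rewrite (ord1 i) mulmx_entry; under eq_bigr do rewrite -dvfE.
by [].
Qed.

(* Near z0 the flow of f exists for times less than del; the other fields are uniform estimates for solutions,
   for solutions of the linearized equation, and for the error of linearization. *)
Record flow_box (R : realType) m (Om : set 'rV[R]_m) (f : 'I_m -> 'rV[R]_m -> R) (z0 : 'rV[R]_m)
    (d del C : R) : Prop := {
  fb_d : 0 < d ;
  fb_del : 0 < del ;
  fb_C : 0 <= C ;
  fb_sub : forall y : 'rV[R]_m, `|y - z0| < d -> Om y ;
  fb_flow : forall z : 'rV[R]_m, `|z - z0| < d / 4 ->
    exists phi : R -> 'rV[R]_m, phi 0 = z /\ forall t : R, `|t| < del -> solves f z0 d phi t ;
  fb_stable : forall (phi psi : R -> 'rV[R]_m) (a b r : R), b - a <= 2 * del ->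
    {within `[a, b], continuous phi} -> {within `[a, b], continuous psi} ->
    (forall t : R, a < t < b -> solves f z0 d phi t) ->
    (forall t : R, a < t < b -> solves f z0 d psi t) ->
    a <= r <= b -> forall t : R, a <= t <= b -> `|psi t - phi t| <= 2 * `|psi r - phi r| ;
  fb_linear : forall (p : nat) (phi : R -> 'rV[R]_m) (Z : R -> 'M[R]_(p, m)) (a b r : R),
    b - a <= 2 * del -> {within `[a, b], continuous Z} ->
    (forall t : R, a < t < b -> `|phi t - z0| < d /\ is_derive t 1 Z (Z t *m dvf f (phi t))) ->
    a <= r <= b -> forall t : R, a <= t <= b -> `|Z t| <= 2 * `|Z r| ;
  fb_linearization : forall phi : R -> 'rV[R]_m, (forall t : R, `|t| < del -> solves f z0 d phi t) ->
    exists Phi : R -> 'M[R]_m, [/\ Phi 0 = 1%:M,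
      forall t : R, `|t| < del / 2 -> is_derive t 1 Phi (Phi t *m dvf f (phi t))
    & forall psi : R -> 'rV[R]_m, (forall t : R, `|t| < del -> solves f z0 d psi t) ->
        forall t : R, `|t| < del / 2 ->
        `|psi t - phi t - (psi 0 - phi 0) *m Phi t| <= C * `|psi 0 - phi 0| ^+ 2] }.

Lemma flow_box_exists (R : realType) m (Om : set 'rV[R]_m) (f : 'I_m -> 'rV[R]_m -> R) (z0 : 'rV[R]_m) :
  open Om -> (forall j, Ck 2 Om (f j)) -> Om z0 -> exists d del C : R, flow_box Om f z0 d del C.
Proof.
move=> oO Cf Oz0.
have [d [K [del [[d0 K0 del0 del1] [delL delK BO [B0 B1 B2]]]]]] := flow_constants oO Cf Oz0.
exists d, del, (8 * (m%:R * (m%:R * K))); split=> //.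
- by rewrite !mulr_ge0.
- by move=> z zd; apply: (flow_exists oO Cf d0 K0 BO B0 B1 del0 del1 delL delK zd).
- move=> phi psi a b r; exact: (flow_stable oO Cf K0 BO B1 delL).
- move=> p phi Z a b r; exact: (linear_stable K0 B1 delL).
- move=> phi; exact: (flow_linearization oO Cf K0 BO B1 B2 del0 del1 delL).
Qed.

Lemma is_derive_shift_real (R : realType) (V : normedModType R) (f : R -> V) (s t : R) l :
  is_derive (t - s) 1 f l -> is_derive t 1 (fun u => f (u - s)) l.
Proof.
have E : (fun h : R => h^-1 *: (f (h *: (1 : R) + t - s) - f (t - s))) =
   (fun h : R => h^-1 *: (f (h *: (1 : R) + (t - s)) - f (t - s))).
  by apply/funext => h; rewrite addrA.
by case=> d1 d2; split; rewrite /derivable /derive E.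
Qed.

Lemma between_dist (R : realType) (s s1 s2 u e : R) : `|s1 - s| < e -> `|s2 - s| < e ->
  Num.min s1 s2 <= u <= Num.max s1 s2 -> `|u - s| < e.
Proof.
rewrite !ltr_norml ge_min le_max => /andP[? ?] /andP[? ?] /andP[/orP[?|?] /orP[?|?]];
by apply/andP; split; lra.
Qed.

(** Continuous induction. Around the supremum of the times reached from s1, the local step carries P
    from a point just below it to points beyond it, unless s2 has been reached. *)
Lemma interval_chain (R : realType) (a b : R) (P : R -> Prop) :
  (forall s0, a <= s0 <= b -> exists2 d : R, 0 < d & forall s1 s2, a <= s1 -> s1 <= s2 -> s2 <= b ->
     `|s1 - s0| < d -> `|s2 - s0| < d -> P s1 -> P s2) ->
  forall s1 s2, a <= s1 -> s1 <= s2 -> s2 <= b -> P s1 -> P s2.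
Proof.
move=> Hl s1 s2 as1 s12 s2b P1.
pose E := [set t | s1 <= t <= s2 /\ forall u, s1 <= u <= t -> P u].
have E1 : E s1 by split; [rewrite lexx|move=> u /andP[u1 u2]; have -> : u = s1 by apply/le_anti; rewrite u1 u2].
have Eub : ubound E s2 by move=> t [/andP[_ ?] _].
have supE : has_sup E by split; [exists s1|exists s2].
pose s := sup E.
have s1s : s1 <= s by exact: sup_upper_bound.
have ss2 : s <= s2 by apply: sup_le_ub => //; exists s1.
have sab : a <= s <= b by rewrite (le_trans as1) //= (le_trans ss2).
have [d d0 Hd] := Hl s sab.
have d20 : 0 < d / 2 by rewrite divr_gt0.
have [e Ee es] := sup_adherent d20 supE.
have [/andP[e1 e2] Pe] := Ee.
have es' : e <= s by exact: sup_upper_bound.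
have Pe' : P e by apply: Pe; rewrite e1 lexx.
pose f := Num.min s2 (s + d / 2).
have fs2 : f <= s2 by rewrite /f ge_min lexx.
have fs : f <= s + d / 2 by rewrite /f ge_min lexx orbT.
have sf : s <= f by rewrite /f le_min ss2 /= lerDl ltW.
have Ef : E f.
  split; first by rewrite (le_trans s1s).
  move=> u /andP[u1 uf]; have [ue|eu] := leP u e; first by apply: Pe; rewrite u1.
  apply: (Hd e u) => //.
  - exact: le_trans e1.
  - exact: ltW.
  - by rewrite (le_trans uf) // (le_trans fs2).
  - by move: es; rewrite -/s distrC ger0_norm ?subr_ge0 //; lra.
  - move: es; rewrite -/s ltr_norml; move=> es; apply/andP; split; lra.
have fs' : f <= s by exact: sup_upper_bound.
have : s2 <= s.
  by move: fs'; rewrite /f ge_min => /orP[//|]; lra.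
move=> s2s; case: Ef => _ /(_ s2); apply; rewrite s12 /=.
by apply: le_trans s2s sf.
Qed.

(** If the local step works in both directions, then propagating P to the left amounts to
    propagating its negation to the right. *)
Lemma interval_chain2 (R : realType) (a b : R) (P : R -> Prop) :
  (forall s0, a <= s0 <= b -> exists2 d : R, 0 < d & forall s1 s2, a <= s1 <= b -> a <= s2 <= b ->
     `|s1 - s0| < d -> `|s2 - s0| < d -> P s1 -> P s2) ->
  forall s1 s2, a <= s1 <= b -> a <= s2 <= b -> P s1 -> P s2.
Proof.
move=> Hl s1 s2 /andP[as1 s1b] /andP[as2 s2b] P1.
have [s12|/ltW s21] := leP s1 s2.
  apply: (@interval_chain R a b P _ s1 s2) => // s0 /Hl[d d0 Hd]; exists d => // u v au uv vb ud vd.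
  by apply: Hd => //; [rewrite au (le_trans uv)|rewrite vb (le_trans au)].
apply: contrapT => nP2; suff : ~ P s1 by [].
apply: (@interval_chain R a b (fun s => ~ P s) _ s2 s1) => // s0 /Hl[d d0 Hd]; exists d => // u v au uv vb ud vd nPu Pv.
by apply: nPu; apply: (Hd v u) => //; [rewrite vb (le_trans au)|rewrite au (le_trans uv)].
Qed.

(** * Isolation of singular parameters, composition of expansions, invariance of the symplectic
    form *)

Lemma unitmx_of_kernel (R : realType) n (A : 'M[R]_n) :
  (forall u : 'rV[R]_n, `|u| = 1 -> u *m A != 0) -> A \in unitmx.
Proof.
move=> HA; rewrite -row_free_unit -kermx_eq0; apply/negPn/negP => /rowV0Pn[v /sub_kermxP vA v0].
have v1 : `| (`|v|^-1 *: v) | = 1 by rewrite normrZ normfV normr_id mulVf // normr_eq0.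
by have := HA _ v1; rewrite -scalemxAl vA scaler0 eqxx.
Qed.

Lemma near_neq0 (R : realType) (T : Type) (F : set_system T) (FF : Filter F) n (v : T -> 'rV[R]_n) (v0 : 'rV[R]_n) :
  v x @[x --> F] --> v0 -> v0 != 0 -> \forall x \near F, v x != 0.
Proof.
move=> cv; rewrite -normr_gt0 => v00.
have n1 : \forall x \near F, 0 < `|v x| by apply: cvgr_gt v00; exact: cvg_norm.
by apply: filterS n1 => x; rewrite normr_gt0.
Qed.

(* Where u A(0) = 0, the component of u A(t) along u B vanishes to first order only, with slope Q(uB, uB). *)
Lemma unitmx_isolated (R : realType) n (A : R -> 'M[R]_n) (B P Q : 'M[R]_n) :
  is_derive (0 : R) 1 A (A 0 *m P + B *m Q) -> A 0 *m B^T = B *m (A 0)^T ->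
  (forall u : 'rV[R]_n, u *m A 0 = 0 -> u *m B = 0 -> u = 0) ->
  (forall w : 'rV[R]_n, w != 0 -> 0 < (w *m Q *m w^T) 0 0) ->
  exists2 e : R, 0 < e & forall t : R, t != 0 -> `|t| < e -> A t \in unitmx.
Proof.
move=> dA sym inj pos.
pose q (t : R) := t^-1 *: (A t - A 0).
have cq : q t @[t --> (0 : R)^'] --> A 0 *m P + B *m Q.
  case: dA; rewrite /derivable /derive => c <-; suff -> : q = (fun h : R => h^-1 *: ((A \o shift 0) (h *: (1 : R)) - A 0)) by [].
  by apply/funext => h; rewrite /q /= addr0 [h *: _]mulr1.
have cA : A t @[t --> (0 : R)^'] --> A 0.
  apply: cvg_within_filter; have [dA1 _] := dA.
  by move/derivable1_diffP: dA1 => /differentiable_continuous.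
pose Sp : set 'rV[R]_n := [set u | `|u| = 1].
have cSp : compact Sp.
  apply: bounded_closed_compact.
    by exists 1; split=> // x x1 u /= ->; rewrite ltW.
  have -> : Sp = (fun u : 'rV[R]_n => `|u|) @^-1` [set 1] by [].
  apply: closed_comp; last exact: closed_eq.
  by move=> u _; exact: norm_continuous.
(* Compactness of the unit sphere makes the punctured neighbourhood of 0 uniform in u. It remains to
   treat one u, with the vector near u and the time near 0 varying together. *)
have : \forall t \near (0 : R)^', Sp `<=` (fun u => u *m A t != 0).
  apply: (iffLR (compact_near_coveringP Sp) cSp R _ (fun t u => u *m A t != 0)) => u u1.
  have u0 : u != 0 by rewrite -normr_gt0 u1.
  have c1 : x.1 @[x --> filter_prod (nbhs u) (0 : R)^'] --> u by exact: cvg_fst.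
  have c2 : x.2 @[x --> filter_prod (nbhs u) (0 : R)^'] --> (0 : R)^' by exact: cvg_snd.
  have [uA|uA] := eqVneq (u *m A 0) 0; last first.
    have c : x.1 *m A x.2 @[x --> filter_prod (nbhs u) (0 : R)^'] --> u *m A 0.
      by apply: cvg_mulmx c1 _; exact: cvg_comp c2 cA.
    exact: near_neq0 c uA.
  have uB : u *m B != 0 by apply: contra_neq u0 => uB; exact: inj.
  pose w := (u *m B)^T.
  have key : 0 < (u *m (A 0 *m P + B *m Q) *m w) 0 0.
    by rewrite mulmxDr !mulmxA uA mul0mx add0r; exact: pos.
  have c3 : x.1 *m q x.2 @[x --> filter_prod (nbhs u) (0 : R)^'] --> u *m (A 0 *m P + B *m Q).
    by apply: cvg_mulmx c1 _; exact: cvg_comp c2 cq.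
  have c4 : (x.1 *m q x.2 *m w) 0 0 @[x --> filter_prod (nbhs u) (0 : R)^'] --> (u *m (A 0 *m P + B *m Q) *m w) 0 0.
    by apply: (iffLR (cvg_mxP _ _ _) _ 0 0); apply: cvg_mulmx c3 _; exact: cvg_cst.
  have n1 : \forall x \near filter_prod (nbhs u) (0 : R)^', 0 < (x.1 *m q x.2 *m w) 0 0.
    by apply: cvgr_gt key; exact: c4.
  have n2 : \forall x \near filter_prod (nbhs u) (0 : R)^', x.2 != 0.
    have n0 : \forall t \near (0 : R)^', t != 0 by exact: nbhs_dnbhs_neq.
    exact: (c2 _ n0).
  apply: filterS (filterI n1 n2) => -[u' t] /= [gt0 t0]; apply/eqP => u'A.
  have E : u' *m q t *m w = - (t^-1 *: (u' *m A 0 *m w)).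
    by rewrite /q -scalemxAr -scalemxAl mulmxBr u'A sub0r mulNmx scalerN.
  (* Symmetry turns u' A(0) B^T u^T into u' B (u A(0))^T = 0. Hence the component of the difference
     quotient along w is 0 if u' A(t) = 0, although its limit is positive. *)
  have E1 : u' *m A 0 *m w = 0.
    by rewrite /w trmx_mul mulmxA -[_ *m B^T]mulmxA sym -!mulmxA -trmx_mul uA trmx0 !mulmx0.
  by move: gt0; rewrite E E1 scaler0 oppr0 mxE ltxx.
move=> H; have H0 : \forall t \near (0 : R), t != 0 -> Sp `<=` (fun u => u *m A t != 0) by exact: H.
have [e e0 He] := near_realE H0; exists e => // t t0 te.
apply: unitmx_of_kernel => u u1; apply: (He t) => //; by rewrite subr0.
Qed.

(** Composition of two first order expansions with quadratic errors. The bound |u| <= (n |Z| + C)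
    |h|, valid for |h| < 1, both places u in the domain of the second expansion and turns its error
    into a quadratic one in h. *)
Lemma quad_trans (R : realType) (n m q : nat) (Z : 'M[R]_(n, m)) (D : 'M[R]_(m, q)) (C K d : R) :
  0 <= C -> 0 <= K -> 0 < d -> exists C' e : R, [/\ 0 <= C', 0 < e &
    forall (h : 'rV[R]_n) (u : 'rV[R]_m) (w : 'rV[R]_q), `|h| < e -> `|u - h *m Z| <= C * `|h| ^+ 2 ->
    `|u| < d /\ (`|w - u *m D| <= K * `|u| ^+ 2 -> `|w - h *m (Z *m D)| <= C' * `|h| ^+ 2)].
Proof.
move=> C0 K0 d0; pose k1 := n%:R * `|Z|; pose k2 := m%:R * `|D|; pose B := k1 + C.
have k10 : 0 <= k1 by rewrite mulr_ge0.
have k20 : 0 <= k2 by rewrite mulr_ge0.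
have B0 : 0 <= B by rewrite addr_ge0.
have B1 : 0 < B + 1 by rewrite ltr_wpDl.
exists (K * B ^+ 2 + k2 * C), (Num.min 1 (d / (B + 1))); split.
- by rewrite addr_ge0 // mulr_ge0 // exprn_ge0.
- by rewrite lt_min ltr01 divr_gt0.
move=> h u w; rewrite lt_min => /andP[h1 hd] hu.
have hZ : `|h *m Z| <= k1 * `|h| by apply: mxnorm_mul => // i j; exact: mxnorm_entry.
have uB : `|u| <= B * `|h|.
  rewrite -(subrK (h *m Z) u) (le_trans (ler_normD _ _)) // addrC mulrDl; apply: lerD => //.
  by rewrite (le_trans hu) // ler_wpM2l // expr2 ler_piMr // ltW.
split.
  apply: (le_lt_trans uB); apply: (@le_lt_trans _ _ ((B + 1) * `|h|)); first by rewrite ler_wpM2r // lerDl.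
  by rewrite mulrC -ltr_pdivlMr.
move=> wu; have -> : w - h *m (Z *m D) = (w - u *m D) + (u - h *m Z) *m D.
  by rewrite mulmxBl mulmxA addrA subrK.
rewrite (le_trans (ler_normD _ _)) // mulrDl; apply: lerD.
  by rewrite (le_trans wu) // -mulrA ler_wpM2l // -exprMn lerXn2r ?nnegrE ?mulr_ge0.
apply: (@le_trans _ _ (k2 * `|u - h *m Z|)); last by rewrite -[k2 * C * _]mulrA; apply: ler_wpM2l.
by apply: mxnorm_mul => // i j; exact: mxnorm_entry.
Qed.

Lemma vf_quadratic_near (R : realType) m (Om : set 'rV[R]_m) (f : 'I_m -> 'rV[R]_m -> R) z0 :
  open Om -> (forall j, Ck 2 Om (f j)) -> Om z0 -> exists d K : R, [/\ 0 < d, 0 <= K &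
    forall z : 'rV[R]_m, `|z - z0| < d -> Om z /\ `|vf f z - vf f z0 - (z - z0) *m dvf f z0| <= K * `|z - z0| ^+ 2].
Proof.
move=> oO Cf Oz0; have [d [K [del [[d0 K0 _ _] [_ _ BO [B0 B1 B2]]]]]] := flow_constants oO Cf Oz0.
exists d, (m%:R * (m%:R * K)); split=> //; first by rewrite !mulr_ge0.
move=> z zd; split; first exact: BO.
by apply: (vf_quadratic oO Cf K0 BO B2) => //; rewrite subrr normr0.
Qed.

Lemma constant_of_derive0 (R : realType) p q (Y : R -> 'M[R]_(p, q)) (e : R) :
  (forall t : R, `|t| < e -> is_derive t 1 Y 0) -> forall t : R, `|t| < e -> Y t = Y 0.
Proof.
move=> dY.
have key (x y : R) : x <= y -> (forall t, x <= t <= y -> `|t| < e) -> Y y = Y x.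
  move=> xy xye; apply/eqP; rewrite -subr_eq0 -normr_le0 -(mul0r (y - x)).
  apply: (mx_MVT_le (dx := fun=> 0) xy).
    apply: derivable_within_continuous => t; rewrite in_itv /= => /xye/dY[//].
  move=> t /andP[t1 t2]; rewrite normr0; split=> //; apply: dY; apply: xye; by rewrite !ltW.
move=> t te; have [t0|/ltW t0] := leP 0 t.
  by apply: key => // s /andP[s0 st]; rewrite ger0_norm // (le_lt_trans st) // (le_lt_trans (ler_norm t)).
apply/esym; apply: key => // s /andP[ts s0]; rewrite ler0_norm // (le_lt_trans _ te) // ler0_norm // lerN2 //.
Qed.

Lemma is_derive_tr (R : realType) (V : normedModType R) p q (Y : V -> 'M[R]_(p, q)) x v dY :
  is_derive x v Y dY -> is_derive x v (fun t => (Y t)^T) dY^T.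
Proof.
move=> /is_derive_mxP D; apply/is_derive_mxP => i j; rewrite trmx_entry.
by under eq_fun do rewrite trmx_entry.
Qed.

Section LinearizedFlow.
Variables (R : realType) (n : nat).
Local Notation N := (1 + (n + n))%N.

Lemma is_derive_tm_curve p (W : R -> 'M[R]_(p, N)) dW (t : R) :
  is_derive t 1 W dW -> is_derive t 1 (fun s => tm (W s)) (tm dW).
Proof.
move=> /is_derive_mxP D; apply/is_derive_mxP => i j; rewrite tmE.
by under eq_fun do rewrite tmE.
Qed.

Lemma is_derive_xp_curve p (W : R -> 'M[R]_(p, N)) dW (t : R) :
  is_derive t 1 W dW -> is_derive t 1 (fun s => xp (W s)) (xp dW).
Proof.
move=> /is_derive_mxP D; apply/is_derive_mxP => i j; rewrite xpE.
by under eq_fun do rewrite xpE.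
Qed.

Lemma is_derive_mp_curve p (W : R -> 'M[R]_(p, N)) dW (t : R) :
  is_derive t 1 W dW -> is_derive t 1 (fun s => mp (W s)) (mp dW).
Proof.
move=> /is_derive_mxP D; apply/is_derive_mxP => i j; rewrite mpE.
by under eq_fun do rewrite mpE.
Qed.

(** The derivative of omega(W, W) is S - S^T with the matrix S of [dvf_symmetric], hence 0. *)
Lemma linear_flow_omega (U : set 'rV[R]_N) K p (phi : R -> 'rV[R]_N) (W : R -> 'M[R]_(p, N)) (e : R) :
  open U -> Ck 2 U K -> (forall t : R, `|t| < e -> U (phi t)) -> tm (W 0) = 0 ->
  (forall t : R, `|t| < e -> is_derive t 1 W (W t *m dvf (hf K) (phi t))) ->
  forall t : R, `|t| < e -> tm (W t) = 0 /\ omega (W t) (W t) = omega (W 0) (W 0).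
Proof.
move=> oU CK Up W0 dW.
have tW t : `|t| < e -> tm (W t) = 0.
  move=> te; rewrite -W0; apply: (constant_of_derive0 (Y := fun t => tm (W t)) _ te) => s se.
  by rewrite -(@dvf_tm _ _ K (phi s) _ (W s)); apply: is_derive_tm_curve; exact: dW.
move=> t te; split; first exact: tW.
apply: (constant_of_derive0 (Y := fun t => omega (W t) (W t)) _ te) => s se.
have D := dW s se; have Dx := is_derive_xp_curve D; have Dm := is_derive_mp_curve D.
have Sy := dvf_symmetric oU (Up _ se) CK (tW _ se).
set dX := xp _ in Dx Sy; set dM := mp _ in Dm Sy.
have := is_deriveB (is_derive_mulmx Dx (is_derive_tr Dm)) (is_derive_mulmx Dm (is_derive_tr Dx)).
move: Sy; rewrite /= raddfD /= !trmx_mul !trmxK => Sy.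
by rewrite -Sy [mp _ *m _ + _]addrC subrr.
Qed.

End LinearizedFlow.

Section Hamiltonian.
Variables (R : realType) (n : nat) (M : topologicalType) (A : set (chart R n M)).
Local Notation N := (1 + (n + n))%N.
Hypothesis hM : smooth_manifold A.
Variables (S : R) (H : chart R n M -> 'rV[R]_N -> R).
Implicit Types (c : chart R n M) (z : 'rV[R]_N) (a b r t : R).

Definition slab z := 0 <= z 0 i0 <= S.
Definition chart_image c : set 'rV[R]_n := chart_map c @` chart_dom c.
Definition transfer c c' : 'rV[R]_N -> 'rV[R]_N := vf (ctlift (trans c c')).

(** H is controlled only for times in [0, S]. Near each point it is replaced by a function K smooth
    on an open set, which may differ from H at other times; convexity in the momentum is recorded
    for K. *)
Hypothesis H_smooth : forall c z0, A c -> slab z0 -> chart_image c (xp z0) ->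
  exists (U : set 'rV[R]_N) (K : 'rV[R]_N -> R),
    [/\ open U, U z0, forall k, Ck k U K, forall z, U z -> chart_image c (xp z) /\ (slab z -> H c z = K z)
    & forall z, U z -> slab z -> forall w : 'rV[R]_n, w != 0 -> 0 < (w *m hess K z (@ip n) (@ip n) *m w^T) 0 0].
Hypothesis H_transfer : forall c c' z, A c -> A c' -> slab z -> overlap c c' (xp z) ->
  H c z = H c' (transfer c c' z).

Definition hfield c z : 'rV[R]_N := vf (hf (H c)) z.

(** The field involves only derivatives in position and momentum, along lines of constant time.
    These lines stay in the slab, so H and K have the same field even at the end times. *)
Lemma hfield_model c z U K : open U -> U z -> Ck 1 U K -> (forall y, U y -> slab y -> H c y = K y) ->
  slab z -> hfield c z = vf (hf K) z.
Proof.
move=> oU Uz CK HK sz.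
have E i : i != i0 -> partial i (H c) z = partial i K z.
  move=> ii0; rewrite !partialE.
  have C1 : is_derive z 'e_i K ('D_('e_i) K z) by apply: DeriveDef => //; exact: Ck_derivable CK Uz.
  have [] // : is_derive z 'e_i (H c) ('D_('e_i) K z).
  apply: derive_along_line C1.
  have nU : \forall s \near (0 : R), U (z + s *: 'e_i).
    by apply: cvg_line; apply: open_nbhs_nbhs.
  apply: filterS nU => s Us; rewrite HK // /slab !mxE eqxx /= eq_sym (negbTE ii0) mulr0 addr0.
  exact: sz.
apply/rowP => j; rewrite /hfield !vfE; elim/state_ind: j => [|k|k].
- by rewrite !hf0.
- by rewrite !hfx E // /ip /i0 eq_rlshift.
- by rewrite !hfp E // /ix /i0 eq_rlshift.
Qed.

Lemma transfer_tm c c' z : transfer c c' z 0 i0 = z 0 i0.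
Proof.
have := tmE (transfer c c' z) 0 0; rewrite /transfer vf_lift tm_mk => <-.
by rewrite tmE.
Qed.

Lemma transfer_xp c c' z : xp (transfer c c' z) = \row_a trans c c' a (xp z).
Proof. by rewrite /transfer vf_lift xp_mk. Qed.

Lemma transfer_mp c c' z : mp (transfer c c' z) = mp z *m (invmx (jac (trans c c') (xp z)))^T.
Proof. by rewrite /transfer vf_lift mp_mk. Qed.

Section TwoCharts.
Variables (c c' : chart R n M).
Hypotheses (Ac : A c) (Ac' : A c').

Let oV := @overlap_open R n M c c'.
Let CV k (a : 'I_n) : Ck k (overlap c c') (trans c c' a) := Ck_trans hM k a Ac Ac'.
Let uJ x (Vx : overlap c c' x) := jac_unit hM Ac Ac' Vx.

Definition tdom : set 'rV[R]_N := ctlift_dom (overlap c c').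

Lemma tdom_open : open tdom. Proof. exact: lift_dom_open. Qed.

Lemma Ck_transfer k j : Ck k tdom (ctlift (trans c c') j).
Proof. exact: (Ck_lift oV CV uJ). Qed.

Lemma transfer_continuous z : tdom z -> {for z, continuous (transfer c c')}.
Proof. by move=> Tz; apply: (vf_continuous _ Tz) => j; exact: (Ck_transfer 0). Qed.

Lemma hfield_transfer z : slab z -> tdom z ->
  hfield c z *m dvf (ctlift (trans c c')) z = hfield c' (transfer c c' z).
Proof.
move=> sz Tz; have [q [cq c'q] Eq] := Tz.
have xc : chart_image c (xp z) by exists q.
have sz' : slab (transfer c c' z) by rewrite /slab transfer_tm.
have xc' : chart_image c' (xp (transfer c c' z)).
  by rewrite transfer_xp -Eq row_trans //; exists q.
have [U [K [oU Uz CK HK Kpos]]] := H_smooth Ac sz xc.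
have [U' [K' [oU' Uz' CK' HK' _]]] := H_smooth Ac' sz' xc'.
rewrite (hfield_model oU Uz (CK 1%N) (fun y Uy => (HK y Uy).2) sz).
rewrite (hfield_model oU' Uz' (CK' 1%N) (fun y Uy => (HK' y Uy).2) sz').
apply: (lift_hamiltonian oV CV uJ Tz oU oU' Uz Uz' (CK 1%N) (CK' 1%N)).
have nU : \forall y \near z, U y by apply: open_nbhs_nbhs.
have nT : \forall y \near z, tdom y by apply: open_nbhs_nbhs; split=> //; exact: tdom_open.
have nU' : \forall y \near z, U' (transfer c c' y).
  by apply: (transfer_continuous Tz); apply: open_nbhs_nbhs.
apply: filterS (filterI nU (filterI nT nU')) => y [Uy [Ty U'y]] ty.
have sy : slab y by move/matrixP/(_ 0 0): ty; rewrite !tmE /slab => ->.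
have sy' : slab (transfer c c' y) by rewrite /slab transfer_tm.
by rewrite -(HK y Uy).2 // (H_transfer Ac Ac') // (HK' _ U'y).2.
Qed.

End TwoCharts.

Definition st c (sigma : R -> M) (xi : chart R n M -> R -> 'rV[R]_n) t : 'rV[R]_N :=
  mk (const_mx t) (chart_map c (sigma t)) (xi c t).

Lemma st_tm c sigma xi t : st c sigma xi t 0 i0 = t.
Proof. by rewrite -(tmE _ 0 0) tm_mk mxE. Qed.
Lemma st_xp c sigma xi t : xp (st c sigma xi t) = chart_map c (sigma t).
Proof. exact: xp_mk. Qed.
Lemma st_mp c sigma xi t : mp (st c sigma xi t) = xi c t.
Proof. exact: mp_mk. Qed.

Local Notation W a b r := (within `[a, b]%classic (nbhs r)).

(* A curve in the cotangent bundle over [a, b]: the covector over sigma t is given by its components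
   xi c t in every chart c. *)
Record phase_at a b (sigma : R -> M) (xi : chart R n M -> R -> 'rV[R]_n) r : Prop := {
  phase_base : sigma t @[t --> W a b r] --> sigma r;
  phase_cvg : forall c, A c -> chart_dom c (sigma r) ->
    st c sigma xi t @[t --> W a b r] --> st c sigma xi r;
  phase_ode : forall c, A c -> chart_dom c (sigma r) -> a < r < b ->
    is_derive r 1 (st c sigma xi) (hfield c (st c sigma xi r));
  phase_cov : forall c c', A c -> A c' -> chart_dom c (sigma r) -> chart_dom c' (sigma r) ->
    xi c r = xi c' r *m (jac (trans c c') (chart_map c (sigma r)))^T }.

Definition phase a b sigma xi := forall r, a <= r <= b -> phase_at a b sigma xi r.

Lemma in_seg a b t : `[a, b]%classic t <-> a <= t <= b.
Proof. by rewrite /= in_itv. Qed.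

Lemma st_transfer c c' sigma xi t : A c -> A c' -> chart_dom c (sigma t) -> chart_dom c' (sigma t) ->
  xi c t = xi c' t *m (jac (trans c c') (chart_map c (sigma t)))^T ->
  st c' sigma xi t = transfer c c' (st c sigma xi t).
Proof.
move=> Ac Ac' ct c't E; apply: state_ext.
- by apply/matrixP => i j; rewrite (ord1 i) !tmE transfer_tm !st_tm.
- by rewrite transfer_xp !st_xp row_trans.
rewrite transfer_mp !st_mp st_xp E -mulmxA -trmx_mul mulVmx ?trmx1 ?mulmx1 //.
apply: (jac_unit hM) => //; exact: overlap_mem.
Qed.

Lemma phase_near_dom a b sigma xi r c : phase_at a b sigma xi r -> chart_dom c (sigma r) ->
  \forall t \near W a b r, chart_dom c (sigma t).
Proof.
move=> P cr; apply: (phase_base P); apply: open_nbhs_nbhs; split=> //; exact: chart_dom_open.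
Qed.

Lemma chart_phase c0 (z : R -> 'rV[R]_N) a b : A c0 -> 0 <= a -> b <= S ->
  (forall t, a <= t <= b -> [/\ z t 0 i0 = t, chart_image c0 (xp (z t)) & z s @[s --> W a b t] --> z t]) ->
  (forall t, a < t < b -> is_derive t 1 z (hfield c0 (z t))) ->
  exists sigma xi, phase a b sigma xi /\
    forall t, a <= t <= b -> chart_dom c0 (sigma t) /\ st c0 sigma xi t = z t.
Proof.
move=> Ac0 a0 bS Hz dz.
pose sigma t := chart_inv c0 (xp (z t)).
pose xi c t := mp (z t) *m (jac (trans c c0) (chart_map c (sigma t)))^T.
have dom0 t : a <= t <= b -> chart_dom c0 (sigma t) by move/Hz => -[_ xc _]; exact: chart_inv_dom.
have map0 t : a <= t <= b -> chart_map c0 (sigma t) = xp (z t) by move/Hz => -[_ xc _]; exact: chart_invK.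
have st0 t : a <= t <= b -> st c0 sigma xi t = z t.
  move=> tab; apply: state_ext.
  - by apply/matrixP => i j; rewrite (ord1 i) !tmE st_tm; have [-> _ _] := Hz _ tab.
  - by rewrite st_xp map0.
  - by rewrite st_mp /xi jac_id ?trmx1 ?mulmx1 //; exact: dom0.
have cov c c' t : a <= t <= b -> A c -> A c' -> chart_dom c (sigma t) -> chart_dom c' (sigma t) ->
    xi c t = xi c' t *m (jac (trans c c') (chart_map c (sigma t)))^T.
  move=> tab Ac Ac' ct c't; rewrite /xi -mulmxA -trmx_mul; congr (_ *m _^T).
  by rewrite (jac_chain hM) //; exact: dom0.
have tr c t : a <= t <= b -> A c -> chart_dom c (sigma t) -> st c sigma xi t = transfer c0 c (z t).
  move=> tab Ac ct; rewrite -(st0 _ tab); apply: st_transfer => //; first exact: dom0.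
  by apply: cov => //; exact: dom0.
have td c t : a <= t <= b -> chart_dom c (sigma t) -> tdom c0 c (z t).
  by move=> tab ct; rewrite /tdom /ctlift_dom /= -map0 //; apply: overlap_mem => //; exact: dom0.
have base r : a <= r <= b -> sigma t @[t --> W a b r] --> sigma r.
  move=> rab; have [_ xc cz] := Hz _ rab.
  apply: (cvg_comp (fun t => xp (z t)) (chart_inv c0)); last exact: (chart_inv_continuous xc).
  apply: (cvg_comp z (fun y => xp y)); first exact: cz.
  exact: xp_continuous.
exists sigma, xi; split=> [r rab|t tab]; last by split; [exact: dom0|exact: st0].
have near_dom c : chart_dom c (sigma r) -> \forall t \near W a b r, chart_dom c (sigma t).
  by move=> cr; apply: (base _ rab); apply: open_nbhs_nbhs; split=> //; exact: chart_dom_open.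
split.
- exact: base.
- move=> c Ac cr; rewrite tr //.
  have [_ _ cz] := Hz _ rab.
  have := cvg_comp z (transfer c0 c) cz (transfer_continuous Ac0 Ac (td _ _ rab cr)).
  apply: cvg_trans; apply: near_eq_cvg.
  have nd : \forall t \near r, `[a, b]%classic t -> chart_dom c (sigma t) by exact: near_dom.
  have : \forall t \near r, `[a, b]%classic t -> transfer c0 c (z t) = st c sigma xi t.
    by apply: filterS nd => t ct tab; rewrite tr //; exact: ct.
  by [].
- move=> c Ac cr rab'.
  rewrite tr // -(hfield_transfer Ac0 Ac); first last.
  - exact: td.
  - have [zt _ _] := Hz _ rab; rewrite /slab zt; case/andP: rab => ar rb.
    by rewrite (le_trans a0) //= (le_trans rb).
  have D := is_derive_vf_chain (tdom_open (c:=c0) (c':=c)) (td _ _ rab cr) (Ck_transfer Ac0 Ac 1) (dz _ rab').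
  apply: near_eq_is_derive D.
  have nd : \forall t \near r, `[a, b]%classic t -> chart_dom c (sigma t) by exact: near_dom.
  have ni : \forall t \near r, t \in `]a, b[ by apply: near_in_itvoo; rewrite in_itv.
  apply: filterS (filterI nd ni) => t [ct]; rewrite in_itv /= => /andP[at_ tb].
  have tab : a <= t <= b by rewrite !ltW.
  by rewrite tr //; apply: ct; apply/in_seg.
- by move=> c c' Ac Ac' cr c'r; exact: cov.
Qed.

(** Being a solution is a local property. The condition that times of [a, b] near r lie in [a', b']
    allows the limits within the two intervals to be compared, including one-sided ones. *)
Lemma phase_glue a b sigma xi :
  (forall r, a <= r <= b -> exists a' b' sigma' xi', [/\ phase a' b' sigma' xi', a' <= r <= b' &
     \forall t \near r, a <= t <= b -> [/\ a' <= t <= b', sigma t = sigma' t &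
       forall c, A c -> chart_dom c (sigma t) -> xi c t = xi' c t]]) -> phase a b sigma xi.
Proof.
move=> Hl r rab; have [a' [b' [sigma' [xi' [P rab' E]]]]] := Hl _ rab.
have [_ Er Exi] := nbhs_singleton E rab.
have P' := P _ rab'.
have base : sigma t @[t --> W a b r] --> sigma r.
  move=> Q; rewrite Er => /(phase_base P') HQ.
  have HQ' : \forall t \near r, `[a', b']%classic t -> Q (sigma' t) by exact: HQ.
  have : \forall t \near r, `[a, b]%classic t -> Q (sigma t).
    apply: filterS (filterI HQ' E) => t [Q1 E1] /in_seg /E1[tab' -> _].
    by apply: Q1; apply/in_seg.
  by [].
have stE c t : a <= t <= b -> A c -> chart_dom c (sigma t) -> [/\ a' <= t <= b', sigma t = sigma' t &
    forall c, A c -> chart_dom c (sigma t) -> xi c t = xi' c t] -> st c sigma xi t = st c sigma' xi' t.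
  by move=> tab Ac ct [_ E1 E2]; rewrite /st E2 // E1.
have near_dom c : chart_dom c (sigma r) -> \forall t \near r, `[a, b]%classic t -> chart_dom c (sigma t).
  move=> cr; have : nbhs (sigma r) (chart_dom c) by apply: open_nbhs_nbhs; split=> //; exact: chart_dom_open.
  exact: base.
have str c : A c -> chart_dom c (sigma r) -> st c sigma xi r = st c sigma' xi' r.
  by move=> Ac cr; apply: stE.
split=> //.
- move=> c Ac cr; rewrite str // => Q; have cr' : chart_dom c (sigma' r) by rewrite -Er.
  move=> /(phase_cvg P' Ac cr') HQ.
  have HQ' : \forall t \near r, `[a', b']%classic t -> Q (st c sigma' xi' t) by exact: HQ.
  have : \forall t \near r, `[a, b]%classic t -> Q (st c sigma xi t).
    apply: filterS (filterI HQ' (filterI E (near_dom c cr))) => t [Q1 [E1 ct]] tab.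
    have tab' := iffLR (in_seg _ _ _) tab.
    rewrite (stE c t tab' Ac (ct tab) (E1 tab')); apply: Q1; apply/in_seg.
    by case: (E1 tab').
  by [].
- move=> c Ac cr /andP[ar rb]; have cr' : chart_dom c (sigma' r) by rewrite -Er.
  (* Times on both sides of r belong to [a, b] and therefore to [a', b'], so r is interior there as
     well. *)
  have rab'' : a' < r < b'.
    have ni : \forall t \near r, t \in `]a, b[ by apply: near_in_itvoo; rewrite in_itv /= ar.
    have [d d0 Hd] := near_realE (filterI E ni).
    apply/andP; split.
      have /Hd[E1] : `|(r - d / 2) - r| < d by rewrite addrC addKr normrN gtr0_norm ?divr_gt0 //; lra.
      rewrite in_itv /= => /andP[u1 u2].
      have [|/andP[v1 _] _ _] := E1; first by rewrite !ltW.
      by lra.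
    have /Hd[E1] : `|(r + d / 2) - r| < d by rewrite addrC addKr gtr0_norm ?divr_gt0 //; lra.
    rewrite in_itv /= => /andP[u1 u2].
    have [|/andP[_ v1] _ _] := E1; first by rewrite !ltW.
    by lra.
  rewrite str //; apply: near_eq_is_derive (phase_ode P' Ac cr' rab'').
  have ni : \forall t \near r, t \in `]a, b[ by apply: near_in_itvoo; rewrite in_itv /= ar.
  apply: filterS (filterI ni (filterI E (near_dom c cr))) => t [tab [E1 ct]].
  move: tab; rewrite in_itv /= => /andP[t1 t2]; have tab : a <= t <= b by rewrite !ltW.
  by rewrite (stE c t tab Ac (ct (iffRL (in_seg _ _ _) tab)) (E1 tab)).
- move=> c c' Ac Ac' cr c'r; have cr' := cr; have c'r' := c'r; rewrite Er in cr' c'r'.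
  by rewrite !Exi // (phase_cov P' Ac Ac' cr' c'r') Er.
Qed.

Lemma phase_sub a b a' b' sigma xi : phase a b sigma xi -> a <= a' -> b' <= b -> phase a' b' sigma xi.
Proof.
move=> P aa bb; apply: phase_glue => r /andP[ar rb]; exists a, b, sigma, xi; split=> //.
  by rewrite (le_trans aa) //= (le_trans rb).
near=> t; move=> /andP[at_ tb]; split=> //.
by rewrite (le_trans aa) //= (le_trans tb).
Unshelve. all: by end_near. Qed.

Record local_model c (z0 : 'rV[R]_N) (U : set 'rV[R]_N) (K : 'rV[R]_N -> R) (d del C : R) : Prop := {
  lm_open : open U ;
  lm_mem : U z0 ;
  lm_smooth : forall k, Ck k U K ;
  lm_eq : forall z, U z -> chart_image c (xp z) /\ (slab z -> H c z = K z) ;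
  lm_convex : forall z, U z -> slab z -> forall w : 'rV[R]_n, w != 0 -> 0 < (w *m hess K z (@ip n) (@ip n) *m w^T) 0 0 ;
  lm_box : flow_box U (hf K) z0 d del C }.

Lemma local_model_exists c z0 : A c -> slab z0 -> chart_image c (xp z0) ->
  exists U K d del C, local_model c z0 U K d del C.
Proof.
move=> Ac sz xc; have [U [K [oU Uz CK HK Kpos]]] := H_smooth Ac sz xc.
have [d [del [C B]]] := flow_box_exists oU (fun j => Ck_hf j oU (CK 3%N)) Uz.
by exists U, K, d, del, C.
Qed.

Lemma model_field c z0 U K d del C z : local_model c z0 U K d del C -> U z -> slab z ->
  hfield c z = vf (hf K) z.
Proof.
move=> L Uz sz; apply: (hfield_model (lm_open L) Uz (lm_smooth L 1) _ sz).
by move=> y Uy; case: (lm_eq L Uy).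
Qed.

Lemma phase_near a b sigma xi s0 c (e : R) : phase a b sigma xi -> a <= s0 <= b -> A c ->
  chart_dom c (sigma s0) -> 0 < e -> exists2 d : R, 0 < d & forall t, a <= t <= b -> `|t - s0| < d ->
    chart_dom c (sigma t) /\ `|st c sigma xi t - st c sigma xi s0| < e.
Proof.
move=> P sab Ac cs e0; have P0 := P _ sab.
have H1 : \forall t \near s0, `[a, b]%classic t -> chart_dom c (sigma t) by exact: phase_near_dom P0 cs.
have H2 : \forall t \near s0, `[a, b]%classic t -> `|st c sigma xi s0 - st c sigma xi t| < e.
  have := phase_cvg P0 Ac cs; move/cvgrPdist_lt/(_ _ e0); exact.
have [d d0 Hd] := near_realE (filterI H1 H2); exists d => // t tab td.
have [h1 h2] := Hd _ td; split; first by apply: h1; apply/in_seg.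
by rewrite distrC; apply: h2; apply/in_seg.
Qed.

Lemma phase_within a b sigma xi c a' b' : phase a b sigma xi -> A c -> a <= a' -> b' <= b ->
  (forall t, a' <= t <= b' -> chart_dom c (sigma t)) -> {within `[a', b'], continuous (st c sigma xi)}.
Proof.
move=> P Ac aa bb D; apply/subspace_continuousP => t /in_seg tab.
exact: phase_cvg (phase_sub P aa bb tab) c Ac (D _ tab).
Qed.

Lemma phase_solves a b sigma xi c z0 U K d del C t : phase a b sigma xi -> 0 <= a -> b <= S ->
  local_model c z0 U K d del C -> A c -> a < t < b ->
  chart_dom c (sigma t) -> `|st c sigma xi t - z0| < d -> solves (hf K) z0 d (st c sigma xi) t.
Proof.
move=> P a0 bS L Ac /andP[at_ tb] ct zd; split=> //.
have tab : a <= t <= b by rewrite !ltW.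
rewrite -(model_field L); first by apply: phase_ode (P _ tab) _ Ac ct _; rewrite at_.
  exact: fb_sub (lm_box L) _ zd.
by rewrite /slab st_tm (le_trans a0 (ltW at_)) (le_trans (ltW tb)).
Qed.

Definition agree (sigma : R -> M) (xi : chart R n M -> R -> 'rV[R]_n) sigma' xi' t :=
  sigma t = sigma' t /\ forall c, A c -> chart_dom c (sigma t) -> xi c t = xi' c t.

Lemma chart_inj c q q' : chart_dom c q -> chart_dom c q' -> chart_map c q = chart_map c q' -> q = q'.
Proof. by move=> cq cq' E; rewrite -(chart_mapK cq) -(chart_mapK cq') E. Qed.

Lemma agree_st a b sigma xi a' b' sigma' xi' t c : phase a b sigma xi -> phase a' b' sigma' xi' ->
  a <= t <= b -> a' <= t <= b' -> A c -> chart_dom c (sigma t) -> chart_dom c (sigma' t) ->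
  st c sigma xi t = st c sigma' xi' t -> agree sigma xi sigma' xi' t.
Proof.
move=> P P' tab tab' Ac ct ct' E.
have E1 : sigma t = sigma' t by apply: (chart_inj ct ct'); have := congr1 (@xp R n 1) E; rewrite !st_xp.
split=> // c' Ac' c't.
have c't' : chart_dom c' (sigma' t) by rewrite -E1.
rewrite (phase_cov (P _ tab) Ac' Ac c't ct) (phase_cov (P' _ tab') Ac' Ac c't' ct') E1.
by rewrite -(st_mp c sigma xi t) E st_mp.
Qed.

Lemma agree_stE sigma xi sigma' xi' t c : agree sigma xi sigma' xi' t -> A c -> chart_dom c (sigma t) ->
  st c sigma xi t = st c sigma' xi' t.
Proof. by move=> [E1 E2] Ac ct; rewrite /st E2 // E1. Qed.

Lemma chart_at q : exists c, A c /\ chart_dom c q.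
Proof. by have [_ _ [/(_ q)[c Ac cq] _]] := hM; exists c. Qed.

Lemma map_image c q : chart_dom c q -> chart_image c (chart_map c q).
Proof. by exists q. Qed.

(** Agreement is propagated near each s0. If the curves differ at s0, in position (separated by the
    Hausdorff property) or in state (by continuity), they differ nearby and nothing has to be
    propagated. Otherwise both remain in one flow box, and stability with equal data at s1 forces
    equality at s2. *)
Lemma phase_unique a b sigma xi sigma' xi' r t : phase a b sigma xi -> phase a b sigma' xi' ->
  0 <= a -> b <= S -> a <= r <= b -> a <= t <= b ->
  agree sigma xi sigma' xi' r -> agree sigma xi sigma' xi' t.
Proof.
move=> P P' a0 bS rab tab; move: r t rab tab; apply: interval_chain2 => s0 sab.
have [c [Ac cs]] := chart_at (sigma s0).
have [cs'|ncs'] := pselect (sigma s0 = sigma' s0); last first.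
  have [hs _ _] := hM.
  have [B [B1 B2 B0]] : exists B : set M * set M, [/\ nbhs (sigma s0) B.1, nbhs (sigma' s0) B.2 & B.1 `&` B.2 = set0].
    apply: contrapT => nB; apply: ncs'; apply: hs => B1 B2 n1 n2.
    by apply/set0P/eqP => E; apply: nB; exists (B1, B2).
  have H1 : \forall t \near s0, `[a, b]%classic t -> B.1 (sigma t) by exact: phase_base (P _ sab) _ B1.
  have H2 : \forall t \near s0, `[a, b]%classic t -> B.2 (sigma' t) by exact: phase_base (P' _ sab) _ B2.
  have [d d0 Hd] := near_realE (filterI H1 H2); exists d => // s1 s2 s1ab _ s1d _ [E _].
  have [h1 h2] := Hd _ s1d; have h1' := h1 (iffRL (in_seg _ _ _) s1ab); have h2' := h2 (iffRL (in_seg _ _ _) s1ab).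
  suff : (B.1 `&` B.2) (sigma s1) by rewrite B0.
  by split=> //; rewrite E.
have cs1 : chart_dom c (sigma' s0) by rewrite -cs'.
have [E0|nE0] := pselect (st c sigma xi s0 = st c sigma' xi' s0); last first.
  pose e := `|st c sigma xi s0 - st c sigma' xi' s0| / 2.
  have e0 : 0 < e by rewrite divr_gt0 // normr_gt0 subr_eq0; apply/eqP.
  have [d1 d10 H1] := phase_near P sab Ac cs e0.
  have [d2 d20 H2] := phase_near P' sab Ac cs1 e0.
  exists (Num.min d1 d2); first by rewrite lt_min d10.
  move=> s1 s2 s1ab _; rewrite lt_min => /andP[l1 l2] _ /agree_stE -/(_ _ Ac) E.
  have [c1 n1] := H1 _ s1ab l1; have [c2 n2] := H2 _ s1ab l2.
  have := E c1 => {}E; exfalso.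
  have : `|st c sigma xi s0 - st c sigma' xi' s0| < e + e.
    rewrite -(subrKA (st c sigma xi s1)); apply: (le_lt_trans (ler_normD _ _)).
    by apply: ltrD; [rewrite distrC|rewrite E].
  by rewrite /e -splitr ltxx.
pose z0 := st c sigma xi s0.
have sl : slab z0 by rewrite /slab st_tm; case/andP: sab => u v; rewrite (le_trans a0 u) (le_trans v bS).
have xc : chart_image c (xp z0) by rewrite st_xp; exact: map_image.
have [U [K [d [del [C L]]]]] := local_model_exists Ac sl xc.
have B := lm_box L; have d0 := fb_d B; have del0 := fb_del B.
have [d1 d10 H1] := phase_near P sab Ac cs d0.
have [d2 d20 H2] := phase_near P' sab Ac cs1 d0.
exists (Num.min (Num.min d1 d2) del); first by rewrite !lt_min d10 d20.
move=> s1 s2 s1ab s2ab; rewrite !lt_min => /andP[/andP[l1 l2] l3] /andP[/andP[k1 k2] k3] Ag.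
pose al := Num.min s1 s2; pose be := Num.max s1 s2.
have aal : a <= al by rewrite le_min; case/andP: s1ab => -> _; case/andP: s2ab => -> _.
have beb : be <= b by rewrite ge_max; case/andP: s1ab => _ ->; case/andP: s2ab => _ ->.
have nr u : al <= u <= be -> a <= u <= b /\ `|u - s0| < Num.min d1 d2.
  case/andP=> u1 u2; split; first by rewrite (le_trans aal) //= (le_trans u2).
  have m1 : `|s1 - s0| < Num.min d1 d2 by rewrite lt_min l1.
  have m2 : `|s2 - s0| < Num.min d1 d2 by rewrite lt_min k1.
  by apply: (between_dist m1 m2); rewrite -/al -/be u1.
have D1 u : al <= u <= be -> chart_dom c (sigma u) /\ `|st c sigma xi u - z0| < d.
  by move=> /nr[uab]; rewrite lt_min => /andP[? _]; exact: H1.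
have D2 u : al <= u <= be -> chart_dom c (sigma' u) /\ `|st c sigma' xi' u - z0| < d.
  by move=> /nr[uab]; rewrite lt_min /z0 E0 => /andP[_ ?]; exact: H2.
have in1 : al <= s1 <= be by rewrite /al /be ge_min le_max lexx.
have in2 : al <= s2 <= be by rewrite /al /be ge_min le_max lexx !orbT.
have oi u : al < u < be -> a < u < b by case/andP=> u1 u2; rewrite (le_lt_trans aal) //= (lt_le_trans u2).
have := @fb_stable _ _ _ _ _ _ _ _ B (st c sigma xi) (st c sigma' xi') al be s1 _ _ _ _ _ in1 s2 in2.
rewrite -(agree_stE Ag Ac (D1 _ in1).1) subrr normr0 mulr0 normr_le0 subr_eq0 => HE.
apply: (agree_st P P' s2ab s2ab Ac (D1 _ in2).1 (D2 _ in2).1); apply/esym/eqP; apply: HE.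
- move: l3 k3; rewrite !ltr_norml /al /be /Num.min /Num.max => /andP[? ?] /andP[? ?]; case: ifP => _; lra.
- by apply: (phase_within P Ac aal beb) => u /D1[].
- by apply: (phase_within P' Ac aal beb) => u /D2[].
- move=> u uab; have uab' : al <= u <= be by case/andP: uab => ? ?; rewrite !ltW.
  by have [? ?] := D1 _ uab'; apply: (phase_solves P a0 bS L Ac (oi _ uab)).
- move=> u uab; have uab' : al <= u <= be by case/andP: uab => ? ?; rewrite !ltW.
  by have [? ?] := D2 _ uab'; apply: (phase_solves P' a0 bS L Ac (oi _ uab)).
Qed.

Lemma solves_time K z0 (d del : R) (psi : R -> 'rV[R]_N) :
  (forall u : R, `|u| < del -> solves (hf K) z0 d psi u) ->
  forall u : R, `|u| < del -> psi u 0 i0 = psi 0 0 i0 + u.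
Proof.
move=> sol u ud; pose g (v : R) : R := psi v 0 i0 - v.
have dg (v : R) : `|v| < del -> is_derive v 1 g 0.
  move=> /sol[_ /is_derive_mxP/(_ 0 i0)]; rewrite vfE hf0 => D.
  have : is_derive v 1 g (1 - 1) by apply: is_deriveB.
  by rewrite subrr.
suff : g u = g 0 by rewrite /g subr0; lra.
have cst (x y : R) : x <= y -> (forall v, x <= v <= y -> `|v| < del) -> g y = g x.
  move=> xy H1; have [v|v|v _] := @MVT_segment R g (fun=> 0) x y xy.
  - by rewrite in_itv /= => /andP[? ?]; apply: dg; apply: H1; rewrite !ltW.
  - by apply: derivable_within_continuous => w; rewrite in_itv /= => /H1 /dg[].
  by rewrite mul0r => /eqP; rewrite subr_eq0 => /eqP.
have [u0|/ltW u0] := leP 0 u.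
  apply: cst => // v /andP[v0 vu]; apply: le_lt_trans ud; rewrite !ger0_norm //; lra.
apply/esym; apply: cst => // v /andP[v0 vu]; apply: le_lt_trans ud; rewrite !ler0_norm //; lra.
Qed.

Lemma flow_phase c z0 U K d del C psi s1 al be : A c -> local_model c z0 U K d del C ->
  (forall u : R, `|u| < del -> solves (hf K) z0 d psi u) -> psi 0 0 i0 = s1 ->
  s1 - del < al -> be < s1 + del -> 0 <= al -> be <= S ->
  exists sigma xi, phase al be sigma xi /\
    forall t, al <= t <= be -> chart_dom c (sigma t) /\ st c sigma xi t = psi (t - s1).
Proof.
move=> Ac L sol psi0 al1 be1 al0 beS.
have dd t : al <= t <= be -> `|t - s1| < del.
  by case/andP=> t1 t2; rewrite ltr_norml; apply/andP; split; lra.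
have D t : al <= t <= be -> is_derive t 1 (fun t => psi (t - s1)) (vf (hf K) (psi (t - s1))).
  by move=> /dd /sol[_] X; exact: is_derive_shift_real.
apply: (@chart_phase c (fun t => psi (t - s1)) al be Ac al0 beS) => t tab.
  have [_ ud] := sol _ (dd _ tab); split.
  - by rewrite (solves_time sol (dd _ tab)) psi0 addrC subrK.
  - have [zd _] := sol _ (dd _ tab).
    by have [] := lm_eq L (fb_sub (lm_box L) zd).
  - apply: cvg_within_filter; have [X _] := D _ tab.
    by move/derivable1_diffP: X => /differentiable_continuous.
have tab' : al <= t <= be by case/andP: tab => ? ?; rewrite !ltW.
have [zd _] := sol _ (dd _ tab').
rewrite (model_field L (fb_sub (lm_box L) zd)); first exact: D.
rewrite /slab (solves_time sol (dd _ tab')) psi0 addrC subrK.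
by case/andP: tab' => ? ?; rewrite (le_trans al0) //= (le_trans _ beS).
Qed.

(** By uniqueness the given curve coincides with the flow of the box as long as the latter is
    defined. In particular it cannot leave the chart during that time, which is not known in
    advance. *)
Lemma flow_is_phase a b sigma xi c z0 U K d del C s1 : phase a b sigma xi -> 0 <= a -> b <= S ->
  A c -> local_model c z0 U K d del C -> a <= s1 <= b -> chart_dom c (sigma s1) ->
  `|st c sigma xi s1 - z0| < d / 4 ->
  exists psi, [/\ psi 0 = st c sigma xi s1, forall u : R, `|u| < del -> solves (hf K) z0 d psi u
    & forall t, a <= t <= b -> `|t - s1| < del -> chart_dom c (sigma t) /\ st c sigma xi t = psi (t - s1)].
Proof.
move=> P a0 bS Ac L s1ab cs1 zd.
have [psi [psi0 sol]] := fb_flow (lm_box L) zd.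
exists psi; split=> // t tab td; have del0 := fb_del (lm_box L).
have pt0 : psi 0 0 i0 = s1 by rewrite psi0 st_tm.
pose al := Num.min s1 t; pose be := Num.max s1 t.
have aal : a <= al by rewrite le_min; case/andP: s1ab => -> _; case/andP: tab => -> _.
have beb : be <= b by rewrite ge_max; case/andP: s1ab => _ ->; case/andP: tab => _ ->.
have al1 : s1 - del < al by rewrite lt_min; move: td; rewrite ltr_norml => /andP[? ?]; apply/andP; split; lra.
have be1 : be < s1 + del by rewrite gt_max; move: td; rewrite ltr_norml => /andP[? ?]; apply/andP; split; lra.
have [sigma' [xi' [P' E']]] := flow_phase Ac L sol pt0 al1 be1 (le_trans a0 aal) (le_trans beb bS).
have in1 : al <= s1 <= be by rewrite /al /be ge_min le_max lexx.
have in2 : al <= t <= be by rewrite /al /be ge_min le_max lexx !orbT.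
have [cs1' es1] := E' _ in1; have [ct' et] := E' _ in2.
have P1 := phase_sub P aal beb.
have Ag : agree sigma xi sigma' xi' s1.
  by apply: (agree_st P1 P' in1 in1 Ac) => //; rewrite es1 subrr psi0.
have [E1 E2] := phase_unique P1 P' (le_trans a0 aal) (le_trans beb bS) in1 in2 Ag.
have ct : chart_dom c (sigma t) by rewrite E1.
by split=> //; rewrite -et; apply: agree_stE.
Qed.

(** * Existence of solutions on the whole interval for nearby initial covectors *)

Section Family.
Variables (c0 : chart R n M) (p : M) (sigma : R -> M) (xi : chart R n M -> R -> 'rV[R]_n).
Hypotheses (S0 : 0 < S) (Ac0 : A c0) (c0p : chart_dom c0 p) (P : phase 0 S sigma xi) (sigma0 : sigma 0 = p).
Local Notation eta0 := (xi c0 0).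

(* reach c s: every initial covector close to that of sigma gives a solution on [0, s], which ends close to it.
   The domain of existence is propagated along sigma; no completeness is needed. *)
Definition reach c s := forall e : R, 0 < e -> exists2 rho : R, 0 < rho & forall eta : 'rV[R]_n, `|eta - eta0| < rho ->
  exists sigma' xi', [/\ phase 0 s sigma' xi', sigma' 0 = p, xi' c0 0 = eta &
    chart_dom c (sigma' s) /\ `|st c sigma' xi' s - st c sigma xi s| < e].

Lemma overlap_dom c c' q : chart_dom c q -> overlap c c' (chart_map c q) -> chart_dom c' q.
Proof. by move=> cq [q' [cq' c'q'] /(chart_inj cq' cq) <-]. Qed.

Lemma reach_transfer c c' s : 0 <= s <= S -> A c -> A c' -> chart_dom c (sigma s) -> chart_dom c' (sigma s) ->
  reach c s -> reach c' s.
Proof.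
move=> s0S Ac Ac' cs c's Q e e0; pose z := st c sigma xi s.
have Tz : tdom c c' z by rewrite /tdom /ctlift_dom /= st_xp; exact: overlap_mem.
have n1 : \forall y \near z, tdom c c' y by apply: open_nbhs_nbhs; split=> //; exact: tdom_open.
have n2 : \forall y \near z, `|transfer c c' z - transfer c c' y| < e.
  by have := transfer_continuous Ac Ac' Tz; move/cvgrPdist_lt/(_ _ e0).
have [d d0 Hd] := near_normE (filterI n1 n2).
have [rho rho0 Hr] := Q _ d0; exists rho => // eta /Hr[sigma' [xi' [P' s'0 x'0 [cs' zd]]]].
exists sigma', xi'; have [Ty Tc] := Hd _ zd.
have c's' : chart_dom c' (sigma' s).
  by move: Ty; rewrite /tdom /ctlift_dom /= st_xp; exact: overlap_dom.
have s_in : 0 <= s <= s by case/andP: s0S => -> _; rewrite lexx.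
split=> //; split=> //.
rewrite (st_transfer Ac Ac' cs' c's' (phase_cov (P' _ s_in) Ac Ac' cs' c's')).
rewrite (st_transfer Ac Ac' cs c's (phase_cov (P s0S) Ac Ac' cs c's)).
by rewrite distrC.
Qed.

Lemma reach_start : reach c0 0.
Proof.
move=> e e0; exists e => // eta etae.
pose z (t : R) : 'rV[R]_N := mk (const_mx t) (chart_map c0 p) eta.
have [t|t|sigma' [xi' [P' E']]] := @chart_phase c0 z 0 0 Ac0 (lexx 0) (ltW S0).
- move=> /andP[t0 t1]; have -> : t = 0 by apply/le_anti; rewrite t0 t1.
  split.
  + by rewrite -(tmE _ 0 0) tm_mk mxE.
  + by rewrite xp_mk; exact: map_image.
  + apply: cvg_within_filter; apply/(@cvg_mxP _ _ (nbhs (0 : R))) => i j.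
    have zE (s : R) : z s i j = sel s ((chart_map c0 p) i) (eta i) j by rewrite /z !mxE.
    rewrite zE; under eq_fun do rewrite zE.
    elim/state_ind: j {zE} => [|k|k].
    * by rewrite sel0; under eq_fun do rewrite sel0; exact: cvg_id.
    * by rewrite selx; under eq_fun do rewrite selx; exact: cvg_cst.
    * by rewrite selp; under eq_fun do rewrite selp; exact: cvg_cst.
- by move=> /andP[t0 t1]; have := lt_trans t0 t1; rewrite ltxx.
have [|d0 E0] := E' 0; first by rewrite lexx.
have s'0 : sigma' 0 = p.
  by apply: (chart_inj d0 c0p); have := congr1 (@xp R n 1) E0; rewrite st_xp xp_mk.
have x'0 : xi' c0 0 = eta by have := congr1 (@mp R n 1) E0; rewrite st_mp mp_mk.
exists sigma', xi'; split=> //; split=> //.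
apply: le_lt_trans etae; apply: mxnorm_le => // i j; rewrite (ord1 i) /st s'0 sigma0 x'0 !mxE.
elim/state_ind: j => [|k|k]; rewrite ?sel0 ?selx ?selp ?subrr ?normr0 //.
by have := mxnorm_entry (eta - eta0) 0 k; rewrite !mxE.
Qed.

(** Times near s0 share one flow box. A solution known up to s1 is continued by the flow of the box,
    and its distance from the reference curve at s2 is at most twice the one at s1. *)
Lemma reach_step s0 : 0 <= s0 <= S -> exists2 d : R, 0 < d & forall s1 s2, 0 <= s1 -> s1 <= s2 -> s2 <= S ->
  `|s1 - s0| < d -> `|s2 - s0| < d -> (exists c, [/\ A c, chart_dom c (sigma s1) & reach c s1]) ->
  exists c, [/\ A c, chart_dom c (sigma s2) & reach c s2].
Proof.
move=> s0S; have [c [Ac cs0]] := chart_at (sigma s0).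
have sl : slab (st c sigma xi s0) by rewrite /slab st_tm.
have xc : chart_image c (xp (st c sigma xi s0)) by rewrite st_xp; exact: map_image.
have [U [K [d [del [C L]]]]] := local_model_exists Ac sl xc.
have d0 := fb_d (lm_box L); have del0 := fb_del (lm_box L).
have d8 : 0 < d / 8 by rewrite divr_gt0.
have [d1 d10 H1] := phase_near P s0S Ac cs0 d8.
exists (Num.min d1 (del / 4)); first by rewrite lt_min d10 divr_gt0.
move=> s1 s2 s10 s12 s2S; rewrite !lt_min => /andP[k1 k2] /andP[l1 l2] [c1 [Ac1 c1s1 Q1]].
have s1S : 0 <= s1 <= S by rewrite s10 (le_trans s12).
have s2S' : 0 <= s2 <= S by rewrite s2S (le_trans s10).
have [cs1 n1] := H1 _ s1S k1; have [cs2 n2] := H1 _ s2S' l1.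
have {}Q1 := reach_transfer s1S Ac1 Ac c1s1 cs1 Q1.
have s21 : `|s2 - s1| < del.
  by move: k2 l2; rewrite !ltr_norml => /andP[? ?] /andP[? ?]; apply/andP; split; lra.
have sub (t : R) : 0 <= t <= s2 - s1 -> `|t| < del.
  move=> /andP[t0 t1]; rewrite ger0_norm //; apply: le_lt_trans t1 _; exact: le_lt_trans (ler_norm _) s21.
exists c; split=> // e e0.
(* The bound e/2 compensates the factor 2 of the stability estimate. The bound d/8, added to the
   distance d/8 of the reference curve from the centre, places the starting state within the d/4
   required for the flow. *)
pose e' := Num.min (e / 2) (d / 8).
have e'0 : 0 < e' by rewrite lt_min d8 divr_gt0.
have [rho rho0 Hr] := Q1 _ e'0; exists rho => // eta /Hr[sigma' [xi' [P' s'0 x'0 [cs' zd]]]].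
have s1in : 0 <= s1 <= s1 by rewrite s10 lexx.
have [zd1 zd2] : `|st c sigma' xi' s1 - st c sigma xi s1| < e / 2 /\ `|st c sigma' xi' s1 - st c sigma xi s1| < d / 8.
  by apply/andP; move: zd; rewrite lt_min.
have z4 : `|st c sigma' xi' s1 - st c sigma xi s0| < d / 4.
  have := ler_normD (st c sigma' xi' s1 - st c sigma xi s1) (st c sigma xi s1 - st c sigma xi s0).
  rewrite subrKA; lra.
have z4' : `|st c sigma xi s1 - st c sigma xi s0| < d / 4 by lra.
have [psi [psi0 sol E]] := flow_is_phase P' (lexx 0) (le_trans s12 s2S) Ac L s1in cs' z4.
have [phi [phi0 solp Ep]] := flow_is_phase P (lexx 0) (lexx S) Ac L s1S cs1 z4'.
have pt0 : psi 0 0 i0 = s1 by rewrite psi0 st_tm.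
(* The continuation is also run backwards from s1. Both curves agree on the overlap [a', s1], so
   that the glued curve solves the equation across s1 and not merely on either side. *)
pose a' := Num.max 0 (s1 - del / 2).
have a'0 : 0 <= a' by rewrite le_max lexx.
have a's1 : a' <= s1 by rewrite ge_max s10 /=; lra.
have a'1 : s1 - del < a' by rewrite lt_max; apply/orP; right; lra.
have b'1 : s2 < s1 + del by move: s21; rewrite ltr_norml => /andP[_ ?]; lra.
have [sigma2 [xi2 [P2 E2]]] := flow_phase Ac L sol pt0 a'1 b'1 a'0 s2S.
have Ag t : a' <= t <= s1 -> agree sigma' xi' sigma2 xi2 t.
  move=> tas; have t2 : a' <= t <= s2 by case/andP: tas => -> ? /=; rewrite (le_trans _ s12).
  have t1 : 0 <= t <= s1 by case/andP: tas => ? ->; rewrite (le_trans a'0).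
  have td : `|t - s1| < del.
    case/andP: tas => at_ ts1; rewrite distrC ger0_norm ?subr_ge0 // ltrBlDr -ltrBlDl.
    exact: lt_le_trans a'1 at_.
  have [ct et] := E _ t1 td; have [ct2 et2] := E2 _ t2.
  by apply: (agree_st P' P2 t1 t2 Ac ct ct2); rewrite et et2.
pose sg t := if t <= s1 then sigma' t else sigma2 t.
pose x3 (c : chart R n M) t := if t <= s1 then xi' c t else xi2 c t.
have sg2 t : a' <= t <= s2 -> sg t = sigma2 t /\ forall c, A c -> chart_dom c (sg t) -> x3 c t = xi2 c t.
  case/andP=> at_ ts2; rewrite /sg /x3; case: ifP => // ts1.
  by have [|-> X] := Ag t; rewrite ?at_ ?ts1 //; split=> // c2 Ac2 c2t; apply: X.
exists sg, x3.
have s2in : a' <= s2 <= s2 by rewrite lexx (le_trans a's1).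
have [es2 ex2] := sg2 _ s2in; have [cs2' est2] := E2 _ s2in.
have cs2'' : chart_dom c (sg s2) by rewrite es2.
split; first last.
- split=> //.
  have -> : st c sg x3 s2 = psi (s2 - s1) by rewrite -est2 /st es2 ex2.
  have [_ ->] := Ep _ s2S' s21.
  have e2 : 2 * `|psi 0 - phi 0| < e by rewrite psi0 phi0; lra.
  apply: le_lt_trans e2.
  apply: (@fb_stable _ _ _ _ _ _ _ _ (lm_box L) phi psi 0 (s2 - s1) 0).
  + rewrite subr0 (le_trans (ler_norm _)) // (le_trans (ltW s21)) // ler_peMl ?ler1n // ltW //.
  + by apply: (@solves_within _ _ _ _ d) => t /sub; exact: solp.
  + by apply: (@solves_within _ _ _ _ d) => t /sub; exact: sol.
  + by move=> t /andP[t0 t1]; apply: solp; apply: sub; rewrite !ltW.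
  + by move=> t /andP[t0 t1]; apply: sol; apply: sub; rewrite !ltW.
  + by rewrite lexx subr_ge0.
  + by rewrite lexx subr_ge0 s12.
- by rewrite /x3 s10.
- by rewrite /sg s10.
apply: phase_glue => r /andP[r0 rs2].
have [rs1|s1r] := ltP r s1.
  exists 0, s1, sigma', xi'; split=> //; first by rewrite r0 ltW.
  apply: near_realI; exists (s1 - r); first by rewrite subr_gt0.
  move=> t; rewrite ltr_norml => /andP[t1 t2] /andP[t3 t4].
  have ts : t <= s1 by rewrite ltW // -(subrK r t) -ltrBrDr.
  by rewrite t3 ts /sg /x3 ts.
exists a', s2, sigma2, xi2; split=> //; first by rewrite (le_trans a's1).
apply: near_realI; exists (del / 2); first by rewrite divr_gt0.
move=> t; rewrite ltr_norml => /andP[t1 t2] /andP[t3 t4].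
have at_ : a' <= t.
  rewrite ge_max t3 /=; apply: (@le_trans _ _ (r - del / 2)); first by rewrite lerB.
  by rewrite ltW // -(subrK r t) addrC ltrD2r.
have [|-> X] := sg2 t; first by rewrite at_.
by split=> // ; rewrite ?at_ //.
Qed.

Lemma reach_end : exists2 rho : R, 0 < rho & forall eta : 'rV[R]_n, `|eta - eta0| < rho ->
  exists sigma' xi', [/\ phase 0 S sigma' xi', sigma' 0 = p & xi' c0 0 = eta].
Proof.
have [|c [Ac cS Q]] := interval_chain reach_step (lexx 0) (ltW S0) (lexx S).
  by exists c0; split=> //; [rewrite sigma0|exact: reach_start].
have [rho rho0 Hr] := Q 1 ltr01; exists rho => // eta /Hr[s' [x' [? ? ? _]]].
by exists s', x'.
Qed.

End Family.

(** * Expansion in the initial covector, and finiteness of the singular parameters *)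

Section Expansion.
Variables (c0 : chart R n M) (p : M) (eta0 : 'rV[R]_n) (rho : R)
  (Fs : 'rV[R]_n -> R -> M) (Fx : 'rV[R]_n -> chart R n M -> R -> 'rV[R]_n).
Hypotheses (S0 : 0 < S) (Ac0 : A c0) (c0p : chart_dom c0 p) (rho0 : 0 < rho)
  (HF : forall eta : 'rV[R]_n, `|eta - eta0| < rho ->
    [/\ phase 0 S (Fs eta) (Fx eta), Fs eta 0 = p & Fx eta c0 0 = eta]).
Local Notation Xs c eta t := (st c (Fs eta) (Fx eta) t).

(* To first order in the initial covector eta at p, the solutions at time t differ by (eta - eta0) *m Z: the rows
   of Z are the Jacobi fields vanishing at p, and ex_omega and ex_inj say that they span a Lagrangian subspace. *)
Record expands c t (Z : 'M[R]_(n, N)) : Prop := {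
  ex_tm : tm Z = 0 ;
  ex_omega : omega Z Z = 0 ;
  ex_inj : forall u : 'rV[R]_n, u *m Z = 0 -> u = 0 ;
  ex_remainder : exists C e : R, [/\ 0 <= C, 0 < e & forall eta : 'rV[R]_n, `|eta - eta0| < e ->
    [/\ `|eta - eta0| < rho, chart_dom c (Fs eta t) &
    `|Xs c eta t - Xs c eta0 t - (eta - eta0) *m Z| <= C * `|eta - eta0| ^+ 2]] }.

Lemma center_near : `|eta0 - eta0| < rho. Proof. by rewrite subrr normr0. Qed.
Let P0 : phase 0 S (Fs eta0) (Fx eta0). Proof. by have [] := HF center_near. Qed.

Lemma ex_dom c t Z : expands c t Z -> chart_dom c (Fs eta0 t).
Proof. by case=> _ _ _ [C [e [_ e0 /(_ eta0)]]]; rewrite subrr normr0 => /(_ e0)[]. Qed.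

Lemma expands_start : expands c0 0 (mk 0 0 1%:M).
Proof.
split.
- exact: tm_mk.
- by rewrite /omega xp_mk mp_mk trmx0 mul0mx mulmx0 subrr.
- by move=> u /(congr1 (@mp R n 1)); rewrite mpM mp_mk mulmx1 => ->; apply/matrixP => i j; rewrite !mxE.
exists 0, rho; split=> // eta er; split=> //; first by have [_ -> _] := HF er.
rewrite mul0r normr_le0; apply/eqP/state_ext.
- apply/matrixP => i j; rewrite (ord1 i) [LHS]tmE [RHS]tmE addmx_entry oppmx_entry addmx_entry oppmx_entry !st_tm subrr sub0r.
  by rewrite -(tmE _ _ j) tmM tm_mk mulmx0 !mxE oppr0.
- apply/matrixP => i j; rewrite !xpE !addmx_entry !oppmx_entry -!xpE !st_xp xpM xp_mk mulmx0.
  have [_ -> _] := HF er; have [_ -> _] := HF center_near.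
  by rewrite subrr !mxE subrr.
apply/matrixP => i j; rewrite !mpE !addmx_entry !oppmx_entry -!mpE !st_mp mpM mp_mk mulmx1.
have [_ _ ->] := HF er; have [_ _ ->] := HF center_near.
by rewrite [X in _ - X]addmx_entry oppmx_entry subrr !mxE.
Qed.

Lemma expands_transfer c c' t Z : 0 <= t <= S -> A c -> A c' -> chart_dom c' (Fs eta0 t) -> expands c t Z ->
  expands c' t (Z *m dvf (ctlift (trans c c')) (Xs c eta0 t)).
Proof.
move=> tS Ac Ac' c't Ex; have ct := ex_dom Ex.
have oV := @overlap_open R n M c c'.
have CV k (a : 'I_n) : Ck k (overlap c c') (trans c c' a) := Ck_trans hM k a Ac Ac'.
have uJ x (Vx : overlap c c' x) := jac_unit hM Ac Ac' Vx.
have Tz : tdom c c' (Xs c eta0 t) by rewrite /tdom /ctlift_dom /= st_xp; exact: overlap_mem.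
split.
- by rewrite (dlift_tm oV CV uJ Tz) (ex_tm Ex).
- by rewrite (omega_lift oV CV uJ Tz) (ex_omega Ex).
- by move=> u; rewrite mulmxA => /(dlift_inj oV CV uJ Tz) /(ex_inj Ex).
have [C [e [C0' e0 He]]] := ex_remainder Ex.
have [d [K [d0 K0 HK]]] := vf_quadratic_near (tdom_open (c:=c) (c':=c')) (Ck_transfer Ac Ac' 2) Tz.
have [C' [e' [C'0 e'0 He']]] := quad_trans Z (dvf (ctlift (trans c c')) (Xs c eta0 t)) C0' K0 d0.
exists C', (Num.min e e'); split=> //; first by rewrite lt_min e0.
move=> eta; rewrite lt_min => /andP[/He[er cet Hq] ee'].
have [dist Hq'] := He' _ _ (transfer c c' (Xs c eta t) - transfer c c' (Xs c eta0 t)) ee' Hq.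
have [Tz' Hv] := HK _ dist.
have c'et : chart_dom c' (Fs eta t).
  by move: Tz'; rewrite /tdom /ctlift_dom /= st_xp; exact: overlap_dom.
split=> //; have [Pe _ _] := HF er.
rewrite (st_transfer Ac Ac' cet c'et (phase_cov (Pe _ tS) Ac Ac' cet c'et)).
rewrite (st_transfer Ac Ac' ct c't (phase_cov (P0 tS) Ac Ac' ct c't)).
exact: Hq'.
Qed.

(** The expansion at s1 is composed with the linearization of the box flow by [quad_trans]. Isotropy
    persists because the linearized flow is symplectic, and independence of the rows because linear
    solutions are determined by any of their values. *)
Lemma expands_flow c s1 Z z0 U K d del C : 0 <= s1 <= S -> A c -> expands c s1 Z -> local_model c z0 U K d del C ->
  `|Xs c eta0 s1 - z0| < d / 8 -> exists Phi : R -> 'M[R]_N, [/\ Phi 0 = 1%:M,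
    forall t, 0 <= t <= S -> `|t - s1| < del -> chart_dom c (Fs eta0 t) /\ `|Xs c eta0 t - z0| < d,
    forall t, 0 <= t <= S -> `|t - s1| < del / 2 -> expands c t (Z *m Phi (t - s1))
  & is_derive (0 : R) 1 Phi (dvf (hf K) (Xs c eta0 s1))].
Proof.
move=> s1S Ac Ex L z8; have d0 := fb_d (lm_box L); have del0 := fb_del (lm_box L); have C0 := fb_C (lm_box L).
have cs1 := ex_dom Ex.
have z4 : `|Xs c eta0 s1 - z0| < d / 4 by lra.
have [phi [phi0 solp Ep]] := flow_is_phase P0 (lexx 0) (lexx S) Ac L s1S cs1 z4.
have [Phi [Phi0 dPhi HPhi]] := fb_linearization (lm_box L) solp.
have del2 : del / 2 < del by lra.
exists Phi; split=> //.
- by move=> t tS td; have [ct ->] := Ep _ tS td; split=> //; have [] := solp _ td.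
- move=> t tS td2; have td : `|t - s1| < del by apply: lt_trans del2.
  have Up u : `|u| < del / 2 -> U (phi u).
    by move=> ud; apply: (fb_sub (lm_box L)); have [] := solp _ (lt_trans ud del2).
  have dZ (q : nat) (Y : 'M[R]_(q, N)) (u : R) : `|u| < del / 2 ->
      is_derive u 1 (fun u => Y *m Phi u) ((Y *m Phi u) *m dvf (hf K) (phi u)).
    by move=> ud; rewrite -mulmxA; apply: is_derive_mulmxl; exact: dPhi.
  have tm0 : tm (Z *m Phi 0) = 0 by rewrite Phi0 mulmx1 (ex_tm Ex).
  have [t1 t2] := linear_flow_omega (lm_open L) (lm_smooth L 2) Up tm0 (dZ _ Z) td2.
  split=> //; first by rewrite t2 Phi0 mulmx1 (ex_omega Ex).
    (* [u *m Z *m Phi v] solves the linear equation in v. The estimate based at v = t - s1, where it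
       vanishes, shows that its value u Z at v = 0 is zero. *)
    move=> u uW; apply: (ex_inj Ex); apply/eqP; rewrite -normr_le0.
    pose al := Num.min 0 (t - s1); pose be := Num.max 0 (t - s1).
    have in1 : al <= 0 <= be by rewrite /al /be ge_min le_max lexx.
    have in2 : al <= t - s1 <= be by rewrite /al /be ge_min le_max lexx !orbT.
    have nr v : al <= v <= be -> `|v| < del / 2.
      have e1 : `|0 - (0 : R)| < del / 2 by rewrite subrr normr0 divr_gt0.
      have e2 : `|(t - s1) - 0| < del / 2 by rewrite subr0.
      by move=> /(between_dist e1 e2); rewrite subr0.
    have -> : u *m Z = (u *m Z) *m Phi 0 by rewrite Phi0 mulmx1.
    have E0 : 2 * `|(u *m Z) *m Phi (t - s1)| = 0 by rewrite -mulmxA uW normr0 mulr0.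
    rewrite -[leRHS]E0; apply: (@fb_linear _ _ _ _ _ _ _ _ (lm_box L) _ phi (fun v => u *m Z *m Phi v) al be (t - s1) _ _ _ in2 0 in1).
    + have := nr _ in1; have := nr _ in2; rewrite /al /be /Num.min /Num.max !ltr_norml => /andP[? ?] _; case: ifP => _; lra.
    + apply: derivable_within_continuous => v; rewrite in_itv /= => /nr vd.
      by have [] := dZ _ (u *m Z) v vd.
    + move=> v /andP[v1 v2]; have vd : `|v| < del / 2 by apply: nr; rewrite !ltW.
      by split; [have [] := solp _ (lt_trans vd del2)|exact: dZ].
  have [C1 [e [C10 e0 He]]] := ex_remainder Ex.
  have d8 : 0 < d / 8 by rewrite divr_gt0.
  have [C' [e' [C'0 e'0 He']]] := quad_trans Z (Phi (t - s1)) C10 C0 d8.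
  exists C', (Num.min e e'); split=> //; first by rewrite lt_min e0.
  move=> eta; rewrite lt_min => /andP[/He[er cet Hq] ee'].
  have [dist Hq'] := He' _ _ (Xs c eta t - Xs c eta0 t) ee' Hq.
  have [Pe _ _] := HF er.
  have z4' : `|Xs c eta s1 - z0| < d / 4.
    rewrite -(subrKA (Xs c eta0 s1)) (le_lt_trans (ler_normD _ _)) //.
    have -> : d / 4 = d / 8 + d / 8 by field.
    exact: ltrD.
  have [psi [psi0 sols Es]] := flow_is_phase Pe (lexx 0) (lexx S) Ac L s1S cet z4'.
  have [cet' E1] := Es _ tS td; have [_ E2] := Ep _ tS td.
  split=> //; apply: Hq'; rewrite E1 E2 -psi0 -phi0; exact: HPhi.
- have d20 : `|(0 : R)| < del / 2 by rewrite normr0 divr_gt0.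
  by have := dPhi _ d20; rewrite Phi0 mul1mx phi0.
Qed.

Lemma expands_all t : 0 <= t <= S -> exists c Z, A c /\ expands c t Z.
Proof.
move=> /andP[t0 tS].
apply: (@interval_chain _ 0 S (fun t => exists c Z, A c /\ expands c t Z) _ 0 t) => //; last first.
  by exists c0, (mk 0 0 1%:M); split=> //; exact: expands_start.
move=> s0 s0S; have [c [Ac cs0]] := chart_at (Fs eta0 s0).
have sl : slab (Xs c eta0 s0) by rewrite /slab st_tm.
have xc : chart_image c (xp (Xs c eta0 s0)) by rewrite st_xp; exact: map_image.
have [U [K [d [del [C L]]]]] := local_model_exists Ac sl xc.
have d0 := fb_d (lm_box L); have del0 := fb_del (lm_box L).
have d8 : 0 < d / 8 by rewrite divr_gt0.
have [d1 d10 H1] := phase_near P0 s0S Ac cs0 d8.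
exists (Num.min d1 (del / 4)); first by rewrite lt_min d10 divr_gt0.
move=> s1 s2 s10 s12 s2S; rewrite !lt_min => /andP[k1 k2] /andP[l1 l2] [c1 [Z1 [Ac1 Ex1]]].
have s1S : 0 <= s1 <= S by rewrite s10 (le_trans s12).
have s2S' : 0 <= s2 <= S by rewrite s2S (le_trans s10).
have [cs1 n1] := H1 _ s1S k1.
have Ex2 := expands_transfer s1S Ac1 Ac cs1 Ex1.
have [Phi [_ _ HE _]] := expands_flow s1S Ac Ex2 L n1.
eexists c, _; split=> //; apply: HE => //.
by move: k2 l2; rewrite !ltr_norml => /andP[? ?] /andP[? ?]; apply/andP; split; lra.
Qed.

Definition nonconjugate t := exists c Z, [/\ A c, expands c t Z & xp Z \in unitmx].

Lemma nonconjugate_near s0 : 0 <= s0 <= S -> exists2 d : R, 0 < d &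
  forall t, 0 <= t <= S -> `|t - s0| < d -> t != s0 -> nonconjugate t.
Proof.
move=> s0S; have [c [Z [Ac Ex]]] := expands_all s0S; have cs0 := ex_dom Ex.
have sl : slab (Xs c eta0 s0) by rewrite /slab st_tm.
have xc : chart_image c (xp (Xs c eta0 s0)) by rewrite st_xp; exact: map_image.
have [U [K [d [del [C L]]]]] := local_model_exists Ac sl xc.
have d0 := fb_d (lm_box L); have del0 := fb_del (lm_box L).
have zd : `|Xs c eta0 s0 - Xs c eta0 s0| < d / 8 by rewrite subrr normr0 divr_gt0.
have [Phi [Phi0 _ HE dPhi]] := expands_flow s0S Ac Ex L zd.
pose A1 u := xp (Z *m Phi u).
have A10 : A1 0 = xp Z by rewrite /A1 Phi0 mulmx1.
(* The position part of the linearized equation: the mixed Hessian acts on A, and the momentum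
   Hessian, positive definite by convexity, acts on B. *)
have dA : is_derive (0 : R) 1 A1 (A1 0 *m hess K (Xs c eta0 s0) (@ix n) (@ip n) + mp Z *m hess K (Xs c eta0 s0) (@ip n) (@ip n)).
  rewrite A10 -(@dvf_xp _ _ K (Xs c eta0 s0) _ Z (ex_tm Ex)).
  by apply: is_derive_xp_curve; exact: is_derive_mulmxl.
have [|u uA uB|w w0|e e0 He] := unitmx_isolated dA.
- by rewrite A10; apply/eqP; rewrite -subr_eq0; apply/eqP; exact: ex_omega Ex.
- apply: (ex_inj Ex); apply: state_ext.
  + by rewrite tmM (ex_tm Ex) mulmx0; apply/matrixP => i j; rewrite !mxE.
  + by rewrite xpM -A10 uA; apply/matrixP => i j; rewrite !mxE.
  + by rewrite mpM uB; apply/matrixP => i j; rewrite !mxE.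
- by apply: (lm_convex L) => //; exact: lm_mem L.
exists (Num.min e (del / 2)); first by rewrite lt_min e0 divr_gt0.
move=> t tS; rewrite lt_min => /andP[te td] ts; exists c, (Z *m Phi (t - s0)); split=> //.
  exact: HE.
by apply: He => //; rewrite subr_eq0.
Qed.

(** Compactness of [0, S] enters as continuous induction on the finiteness of the part below s: each
    local step adds at most the point s0. *)
Lemma conjugate_finite : finite_set [set t : R | 0 <= t <= S /\ ~ nonconjugate t].
Proof.
pose E := [set t : R | 0 <= t <= S /\ ~ nonconjugate t].
apply: (@sub_finite_set _ _ (E `&` [set t : R | t <= S])); first by move=> t [tS nt]; split=> //; case/andP: tS.
apply: (@interval_chain _ 0 S (fun s => finite_set (E `&` [set t : R | t <= s])) _ 0 S) => //; first last.
- apply: (@sub_finite_set _ _ [set 0]); last exact: finite_set1.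
  by move=> t [[/andP[t0 _] _] /= t0']; apply/le_anti; rewrite t0 t0'.
- exact: ltW.
move=> s0 /nonconjugate_near[d d0 Hd]; exists d => // s1 s2 s10 s12 s2S k1 k2 F1.
apply: (@sub_finite_set _ _ ((E `&` [set t : R | t <= s1]) `|` [set s0])); last first.
  by rewrite finite_setU; split=> //; exact: finite_set1.
move=> t [[tS nt] /= ts2]; have [ts1|st1] := leP t s1; first by left; split.
right => /=; apply/eqP/negPn/negP => ts0; apply: nt; apply: Hd => //.
apply: (between_dist k1 k2); apply/andP; split.
  by rewrite ge_min (ltW st1).
by rewrite le_max ts2 orbT.
Qed.

End Expansion.

End Hamiltonian.

(** * The Hamiltonian of the L-length *)

(** Properness gives uniqueness of limits, without which the [lim] in [derive_within] could not be
    evaluated. *)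
Lemma proper_within (R : realType) (S : set R) (t : R) :
  (forall d : R, 0 < d -> exists u : R, [/\ u != t, `|u - t| < d & S u]) ->
  ProperFilter (within [set h | S (t + h)] (0 : R)^').
Proof.
move=> acc; apply: Build_ProperFilter_ex => Q HQ.
have H0 : \forall h \near (0 : R), h != 0 -> S (t + h) -> Q h by exact: HQ.
have [d d0 Hd] := near_realE H0; have [u [ut ud Su]] := acc _ d0.
exists (u - t); apply: Hd; rewrite ?subr0 ?subr_eq0 //.
by rewrite addrC subrK.
Qed.

Section DeriveWithin.
Variables (R : realType) (V : normedModType R) (S : set R) (f F : R -> V) (t : R) (l : V).
Hypotheses (fF : exists2 d : R, 0 < d & forall u : R, `|u - t| < d -> S u -> f u = F u) (St : S t)
  (dF : is_derive t 1 F l).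

Lemma within_quotient : h^-1 *: (f (t + h) - f t) @[h --> within [set h | S (t + h)] (0 : R)^'] --> l.
Proof.
have cF : (fun h : R => h^-1 *: (F (t + h) - F t)) @ (0 : R)^' --> l.
  case: dF; rewrite /derivable /derive => c <-.
  suff -> : (fun h : R => h^-1 *: (F (t + h) - F t)) = (fun h : R => h^-1 *: ((F \o shift t) (h *: (1 : R)) - F t)) by [].
  by apply/funext => h; rewrite /= [h *: _]mulr1 [h + t]addrC.
have [d d0 Hd] := fF.
have ft : f t = F t by apply: Hd => //; rewrite subrr normr0.
have cF' : h^-1 *: (F (t + h) - F t) @[h --> within [set h | S (t + h)] (0 : R)^'] --> l.
  exact: cvg_within_filter.
move: cF'; apply: cvg_trans; apply: near_eq_cvg.
have n0 : \forall h \near (0 : R), h != 0 -> S (t + h) -> h^-1 *: (F (t + h) - F t) = h^-1 *: (f (t + h) - f t).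
  apply: near_realI; exists d => // h; rewrite subr0 => hd _ Sh.
  by rewrite ft Hd // addrC addKr.
exact: n0.
Qed.

Hypothesis acc : forall d : R, 0 < d -> exists u : R, [/\ u != t, `|u - t| < d & S u].

Lemma derive_withinE : derive_within S f t = l.
Proof. by have PF := proper_within acc; apply: cvg_lim => //; exact: within_quotient. Qed.

End DeriveWithin.

Lemma is_derive_within_unique (R : realType) (V : normedModType R) (S : set R) (F G : R -> V) t l l' :
  (exists2 d : R, 0 < d & forall u : R, `|u - t| < d -> S u -> F u = G u) -> S t ->
  (forall d : R, 0 < d -> exists u : R, [/\ u != t, `|u - t| < d & S u]) ->
  is_derive t 1 F l -> is_derive t 1 G l' -> l = l'.
Proof.
move=> FG St acc dF dG; rewrite -(derive_withinE (f := F) _ St dF acc); last by exists 1.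
exact: derive_withinE.
Qed.

Lemma limit_point_itv (R : realType) (a b t : R) (I : set R) : a < b -> a <= t <= b ->
  (forall u, a < u < b -> I u) -> forall d : R, 0 < d -> exists u : R, [/\ u != t, `|u - t| < d & I u].
Proof.
move=> ab /andP[at_ tb] II d d0; have [tb'|bt] := ltP t b.
  pose u := Num.min ((t + b) / 2) (t + d / 2).
  have tu : t < u by rewrite lt_min; apply/andP; split; lra.
  have ub : u < b by rewrite gt_min; apply/orP; left; lra.
  have ud : u <= t + d / 2 by rewrite ge_min lexx orbT.
  exists u; split; first by rewrite gt_eqF.
    by rewrite gtr0_norm ?subr_gt0 //; lra.
  by apply: II; rewrite ub andbT (le_lt_trans at_).
have {tb bt} tb : t = b by apply/le_anti; rewrite tb.
rewrite {t at_}tb; pose u := Num.max ((a + b) / 2) (b - d / 2).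
have ub : u < b by rewrite gt_max; apply/andP; split; lra.
have au : a < u by rewrite lt_max; apply/orP; left; lra.
have ud : b - d / 2 <= u by rewrite le_max lexx orbT.
exists u; split; first by rewrite lt_eqF.
  by rewrite distrC gtr0_norm ?subr_gt0 //; lra.
by apply: II; rewrite au.
Qed.

Lemma Ck_comp_linear (R : realType) (V V' W : normedModType R) k (U : set V') (f : V' -> W) (l : V -> V') :
  linear l -> continuous l -> Ck k U f -> Ck k (l @^-1` U) (f \o l).
Proof.
move=> hl cl; have E (f1 : V' -> W) (x v : V) : (fun h : R => h^-1 *: ((f1 \o l) (h *: v + x) - (f1 \o l) x)) =
    (fun h : R => h^-1 *: (f1 (h *: l v + l x) - f1 (l x))).
  by apply/funext => h; rewrite /= hl.
elim: k f => [|k IH] f /=.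
  by move=> Cf x Ux; apply: continuous_comp; [exact: cl|exact: Cf].
case=> Cf df Df; split.
- by move=> x Ux; apply: continuous_comp; [exact: cl|exact: Cf].
- by move=> x v Ux; have := df _ (l v) Ux; rewrite /derivable E.
move=> v; have := IH _ (Df (l v)).
by congr Ck; apply/funext => x; rewrite /derive E.
Qed.

Lemma Ck_mx (R : realType) (V : normedModType R) p q k (U : set V) (f : V -> 'M[R]_(p, q)) :
  open U -> (forall i j, Ck k U (fun x => f x i j)) -> Ck k U f.
Proof.
move=> oU; elim: k f => [|k IH] f Cf /=.
  by move=> x Ux; apply/(@cvg_mxP _ _ (nbhs x)) => i j; exact: Cf.
have dx x v : U x -> is_derive x v f (\matrix_(i, j) 'D_v (fun x => f x i j) x).
  move=> Ux; apply/is_derive_mxP => i j; rewrite mxE; apply: DeriveDef => //.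
  exact: Ck_derivable (Cf i j) Ux.
split.
- by move=> x Ux; apply/(@cvg_mxP _ _ (nbhs x)) => i j; exact: Ck_continuous (Cf i j) Ux.
- by move=> x v Ux; have [] := dx _ v Ux.
move=> v; have : Ck k U (fun x => \matrix_(i, j) 'D_v (fun x => f x i j) x).
  apply: IH => i j; have := Ck_derive v (Cf i j).
  by congr Ck; apply/funext => x; rewrite mxE.
by apply: (Ck_ext oU) => x Ux; have [] := dx _ v Ux.
Qed.

Lemma open_neq0 (R : realType) (V : normedModType R) (W : set V) (f : V -> R) :
  open W -> (forall x, W x -> {for x, continuous f}) -> open [set x | W x /\ f x != 0].
Proof.
move=> oW Cf; rewrite openE => x [Wx fx].
have n1 : \forall y \near x, W y by apply: open_nbhs_nbhs.
have n2 : \forall y \near x, 0 < `|f y|.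
  by apply: (cvgr_gt `|f x|); [apply: cvg_norm; exact: Cf|rewrite normr_gt0].
by apply: filterS (filterI n1 n2) => y [Wy]; rewrite normr_gt0.
Qed.

(** Differentiability of the inverse is taken from [Ck_invmx] when this is applied; differentiating
    F F^-1 = 1 then determines the derivative. *)
Lemma is_derive_invmx (R : realType) (V : normedModType R) n (F : V -> 'M[R]_n) x v dF dQ :
  (\forall y \near x, F y \in unitmx) -> is_derive x v F dF -> is_derive x v (fun y => invmx (F y)) dQ ->
  dQ = - (invmx (F x) *m dF *m invmx (F x)).
Proof.
move=> Fu dF1 dQ1; have Fx := nbhs_singleton Fu.
have [_ D1] := is_derive_mulmx dF1 dQ1.
have D2 : 'D_v (fun y => F y *m invmx (F y)) x = 0.
  have [_ <-] := is_derive_cst (1%:M : 'M[R]_n) x v.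
  by apply: near_eq_derive; apply: filterS Fu => y Fy; rewrite mulmxV.
have E : F x *m dQ = - (dF *m invmx (F x)).
  by apply/eqP; rewrite -addr_eq0 addrC -D1 D2.
by rewrite -(mulKmx Fx dQ) E mulmxN mulmxA.
Qed.

Lemma row_diff (R : realType) m p (U : set 'rV[R]_m) (f : 'rV[R]_m -> 'rV[R]_p) x :
  open U -> U x -> (forall j, Ck 1 U (fun y => f y 0 j)) ->
  let D : 'M[R]_(m, p) := \matrix_(i, j) partial i (fun y => f y 0 j) x in
  is_diff x f (mulmxr D : 'rV[R]_m -> 'rV[R]_p).
Proof.
move=> oU Ux Cf D; apply: differentiable_of_remainder.
  move=> y; apply/(@cvg_mxP _ _ (nbhs y)) => i j; rewrite (ord1 i) /= mulmx_entry.
  under eq_fun do rewrite mulmx_entry.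
  apply: cvg_sum_seq => k; apply: cvgM; [exact: coord_continuous|exact: cvg_cst].
move=> e e0; have n1 : \forall y \near x, forall j, `|f y 0 j - f x 0 j - \sum_i (y - x) 0 i * 'D_('e_i) (fun y => f y 0 j) x| <= e * `|y - x|.
  apply: (@filter_forall _ _ (fun j y => `|f y 0 j - f x 0 j - \sum_i (y - x) 0 i * 'D_('e_i) (fun y => f y 0 j) x| <= e * `|y - x|) (nbhs x) _) => j.
  exact: (C1_remainder oU Ux (Cf j) e0).
apply: filterS n1 => y Hy; apply: mxnorm_le; first by rewrite mulr_ge0 // ltW.
move=> i j; rewrite (ord1 i); apply: le_trans (Hy j).
rewrite !addmx_entry !oppmx_entry /= mulmx_entry.
rewrite (eq_bigr (fun i => (y - x) 0 i * 'D_('e_i) (fun y => f y 0 j) x)) // => k _.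
by congr (_ * _); rewrite mxE partialE.
Qed.

Lemma jacobianE (R : realType) m p (U : set 'rV[R]_m) (f : 'rV[R]_m -> 'rV[R]_p) x :
  open U -> U x -> (forall j, Ck 1 U (fun y => f y 0 j)) ->
  jacobian f x = \matrix_(i, j) partial i (fun y => f y 0 j) x.
Proof.
move=> oU Ux Cf; have [_ dE] := row_diff oU Ux Cf.
apply/matrixP => i j; rewrite /jacobian [LHS]mxE dE /= -rowE [LHS]mxE.
by [].
Qed.

Lemma invmx_eq (R : fieldType) n (A B : 'M[R]_n) : A \in unitmx -> B *m A = 1%:M -> invmx A = B.
Proof. by move=> uA BA; rewrite -(mulmxK uA B) BA mul1mx. Qed.

Lemma invmx_congr (R : fieldType) n (G J : 'M[R]_n) : G \in unitmx -> J \in unitmx ->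
  invmx (J *m G *m J^T) = (invmx J)^T *m invmx G *m invmx J.
Proof.
move=> uG uJ; apply: invmx_eq; first by rewrite !unitmx_mul uJ uG unitmx_tr.
by rewrite !mulmxA !mulmxKV // -trmx_mul mulmxV // trmx1.
Qed.

Section TimeSpace.
Variables (R : realType) (n : nat).

Definition itime : 'I_(1 + n) := lshift n ord0.
Definition ispace (k : 'I_n) : 'I_(1 + n) := rshift 1 k.
(** Time and position as one row vector, because partial derivatives and compositions are developed
    on row vectors; [untx] leads back to the product space on which the smoothness of the metric is
    stated. *)
Definition tx (t : R) (x : 'rV[R]_n) : 'rV[R]_(1 + n) := row_mx (const_mx t) x.

Lemma tx_time t x : tx t x 0 itime = t. Proof. by rewrite /tx /itime row_mxEl mxE. Qed.
Lemma tx_space t x k : tx t x 0 (ispace k) = x 0 k. Proof. by rewrite /tx /ispace row_mxEr. Qed.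

Lemma time_space_ind (P : 'I_(1 + n) -> Prop) : P itime -> (forall k, P (ispace k)) -> forall j, P j.
Proof.
move=> P0 Pk j; case: (fintype.splitP j) => k kj.
  by have -> // : j = itime; apply: val_inj; rewrite /= kj (ord1 k).
by have -> // : j = ispace k; exact: val_inj.
Qed.

Lemma sum_time_space (V : nmodType) (F : 'I_(1 + n) -> V) : \sum_i F i = F itime + \sum_k F (ispace k).
Proof. by rewrite big_split_ord big_ord1; congr (F _ + _); apply: val_inj. Qed.

Lemma is_derive_tx (V : normedModType R) (tau : V -> R) (f : V -> 'rV[R]_n) y v m l :
  is_derive y v tau m -> is_derive y v f l -> is_derive y v (fun z => tx (tau z) (f z)) (tx m l).
Proof.
move=> dt /is_derive_mxP df; apply/is_derive_mxP => i j; rewrite (ord1 i); elim/time_space_ind: j => [|k].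
  by rewrite tx_time; under eq_fun do rewrite tx_time.
by rewrite tx_space; under eq_fun do rewrite tx_space.
Qed.

Lemma is_derive_txfun (V : normedModType R) (W : set 'rV[R]_(1 + n)) (phi : 'rV[R]_(1 + n) -> R)
    (tau : V -> R) (f : V -> 'rV[R]_n) y v m l :
  open W -> Ck 1 W phi -> W (tx (tau y) (f y)) -> is_derive y v tau m -> is_derive y v f l ->
  is_derive y v (fun z => phi (tx (tau z) (f z))) (m * partial itime phi (tx (tau y) (f y)) +
    \sum_k l 0 k * partial (ispace k) phi (tx (tau y) (f y))).
Proof.
move=> oW Cp Wy dt df; have := @is_derive_chain _ _ V W phi (fun z => tx (tau z) (f z)) y v _ oW Wy Cp (is_derive_tx dt df).
by rewrite sum_time_space tx_time; under eq_bigr do rewrite tx_space.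
Qed.

Lemma tx_near (U : topologicalType) (W : set 'rV[R]_(1 + n)) (F : set_system U) (FF : Filter F) (tau : U -> R) (f : U -> 'rV[R]_n) t x :
  open W -> W (tx t x) -> tau z @[z --> F] --> t -> f z @[z --> F] --> x -> \forall z \near F, W (tx (tau z) (f z)).
Proof.
move=> oW Wy ct cf; have c : tx (tau z) (f z) @[z --> F] --> tx t x.
  apply/cvg_mxP => i j; rewrite (ord1 i); elim/time_space_ind: j => [|k].
    by rewrite tx_time; under eq_fun do rewrite tx_time.
  rewrite tx_space; under eq_fun do rewrite tx_space.
  exact: (iffLR (cvg_mxP _ _ _) cf).
by apply: c; apply: open_nbhs_nbhs.
Qed.

Definition untx (y : 'rV[R]_(1 + n)) : R^o * 'rV[R]_n := (y 0 itime, rsubmx y).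

Lemma untx_tx t x : untx (tx t x) = (t, x).
Proof. by rewrite /untx tx_time row_mxKr. Qed.

Lemma untx_linear : linear untx.
Proof. by move=> a y z; rewrite /untx linearP !mxE. Qed.

Lemma rsubmx_continuous : continuous (fun y : 'rV[R]_(1 + n) => rsubmx y).
Proof.
move=> y; apply/(@cvg_mxP _ _ (nbhs y)) => i j; rewrite mxE; under eq_fun do rewrite mxE.
exact: coord_continuous.
Qed.

Lemma untx_continuous : continuous untx.
Proof.
move=> y; apply: (@cvg_pair _ _ _ (nbhs y) (nbhs (y 0 itime : R^o)) (nbhs (rsubmx y))).
  exact: coord_continuous.
exact: rsubmx_continuous.
Qed.

End TimeSpace.
Arguments itime {n}.

Section StateBasis.
Variables (R : realType) (n : nat).
Local Notation N := (1 + (n + n))%N.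
Variable k : 'I_n.

Lemma delta_ip_tm : ('e_(ip k) : 'rV[R]_N) 0 i0 = 0.
Proof. by rewrite mxE /i0 /ip eq_lrshift andbF. Qed.
Lemma delta_ip_xp : xp ('e_(ip k) : 'rV[R]_N) = 0.
Proof. by apply/matrixP => i j; rewrite xpE !mxE /ix /ip eq_rshift eq_lrshift andbF. Qed.
Lemma delta_ip_mp : mp ('e_(ip k) : 'rV[R]_N) = 'e_k.
Proof. by apply/matrixP => i j; rewrite mpE !mxE /ip !eq_rshift. Qed.
Lemma delta_ix_tm : ('e_(ix k) : 'rV[R]_N) 0 i0 = 0.
Proof. by rewrite mxE /i0 /ix eq_lrshift andbF. Qed.
Lemma delta_ix_xp : xp ('e_(ix k) : 'rV[R]_N) = 'e_k.
Proof. by apply/matrixP => i j; rewrite xpE !mxE /ix eq_rshift eq_lshift. Qed.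
Lemma delta_ix_mp : mp ('e_(ix k) : 'rV[R]_N) = 0.
Proof. by apply/matrixP => i j; rewrite mpE !mxE /ix /ip eq_rshift eq_rlshift andbF. Qed.

Lemma sum_delta (F : 'I_n -> R) : \sum_j ('e_k : 'rV[R]_n) 0 j * F j = F k.
Proof.
rewrite (bigD1 k) //= mxE !eqxx mul1r big1 ?addr0 // => j jk.
by rewrite mxE (negbTE jk) mul0r.
Qed.

Lemma mul_delta_tr (y : 'rV[R]_n) : (y *m ('e_k : 'rV[R]_n)^T) 0 0 = y 0 k.
Proof.
rewrite mulmx_entry -[RHS]sum_delta; apply: eq_bigr => j _; by rewrite trmx_entry mulrC.
Qed.

End StateBasis.

(** * Local models of the metric, its curvature and the Hamiltonian *)

Section Metric.
Variables (R : realType) (n : nat) (M : topologicalType) (A : set (chart R n M)) (T : R).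
Variable g : tensor_family R n M.
Hypotheses (T0 : 0 < T) (hflow : backwards_ricci_flow A T g).
Implicit Types (c : chart R n M) (t : R) (x : 'rV[R]_n).
Let hg : metric_family A T g := hflow.1.

(* A smooth symmetric extension of g c near a point of [0, T] x U to an open set, which may reach beyond [0, T]. *)
Record metric_model c (W : set 'rV[R]_(1 + n)) (E : 'rV[R]_(1 + n) -> 'M[R]_n) : Prop := {
  mm_open : open W ;
  mm_smooth : forall k i j, Ck k W (fun y => E y i j) ;
  mm_sym : forall y, (E y)^T = E y ;
  mm_unit : forall y, W y -> E y \in unitmx ;
  mm_codom : forall y, W y -> chart_image c (rsubmx y) ;
  mm_eq : forall t x, 0 <= t <= T -> W (tx t x) -> g c t x = E (tx t x) }.

Lemma metric_unit c t x : A c -> 0 <= t <= T -> chart_image c x -> g c t x \in unitmx.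
Proof.
move=> Ac tT cx; apply: unitmx_of_kernel => u u1; apply/eqP => ug.
have u0 : u != 0 by rewrite -normr_gt0 u1.
by have := metric_family_pos hg Ac tT cx u0; rewrite ug mul0mx mxE ltxx.
Qed.

Lemma metric_model_exists c t0 x0 : A c -> 0 <= t0 <= T -> chart_image c x0 ->
  exists W E, metric_model c W E /\ W (tx t0 x0).
Proof.
move=> Ac tT cx.
have [U [F [oU Ux CF HF]]] := metric_family_smooth hg Ac (conj tT cx : [set z : R^o * 'rV[R]_n | _] (t0, x0)).
pose W0 : set 'rV[R]_(1 + n) := @untx R n @^-1` U `&` (fun y => rsubmx y) @^-1` chart_image c.
have oW0 : open W0.
  apply: openI.
    by apply: open_comp => // y _; exact: untx_continuous.
  by apply: open_comp; [move=> y _; exact: rsubmx_continuous|exact: chart_codom_open].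
(* The extension is symmetrized so that symmetry holds at every y, including times outside [0, T];
   on the original domain this changes nothing. *)
pose E y := 2^-1 *: (F (untx y) + (F (untx y))^T).
have CE k i j : Ck k W0 (fun y => E y i j).
  have C1 : Ck k W0 (F \o @untx R n).
    apply: (@Ck_sub _ _ _ _ (@untx R n @^-1` U)); first by move=> y [].
    by apply: Ck_comp_linear (CF k); [exact: untx_linear|exact: untx_continuous].
  have -> : (fun y => E y i j) = (fun y => 2^-1 * ((F \o @untx R n) y i j + (F \o @untx R n) y j i)).
    by apply/funext => y; rewrite !mxE.
  apply: (CkM oW0 (Ck_cst k W0 (2^-1 : R))); apply: CkD => //; exact: Ck_entry.
have Eg t x : 0 <= t <= T -> W0 (tx t x) -> g c t x = E (tx t x).
  move=> tT' [U1 /= c1]; have cx' : chart_image c x by move: c1; rewrite row_mxKr.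
  rewrite /E untx_tx; have U2 : U (t, x) by move: U1; rewrite /= untx_tx.
  have <- : g c t x = F (t, x) by exact: (HF (t, x) U2 (conj tT' cx')).
  by rewrite (metric_family_sym hg Ac tT' cx'); apply/matrixP => i j; rewrite !mxE; field.
exists [set y | W0 y /\ \det (E y) != 0], E; split.
  split.
  - apply: open_neq0 => // y Wy; exact: Ck_continuous (Ck_det oW0 (CE 0%N)) Wy.
  - by move=> k i j; apply: Ck_sub (CE k i j) => y [].
  - by move=> y; rewrite /E linearZ /= raddfD /= trmxK addrC.
  - by move=> y [_]; rewrite unitmxE unitfE.
  - by move=> y [[_ ?] _].
  - by move=> t x tT' [Wy _]; exact: Eg.
have W00 : W0 (tx t0 x0) by split; rewrite /= ?untx_tx ?row_mxKr.
by split=> //; rewrite -Eg // -unitfE -unitmxE; exact: metric_unit.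
Qed.

Section Model.
Variables (c : chart R n M) (W : set 'rV[R]_(1 + n)) (E : 'rV[R]_(1 + n) -> 'M[R]_n).
Hypotheses (Ac : A c) (mm : metric_model c W E).
Let oW := mm_open mm.

Definition dtime (y : 'rV[R]_(1 + n)) : 'M[R]_n := \matrix_(i, j) partial itime (fun y => E y i j) y.
Definition dspace (k : 'I_n) (y : 'rV[R]_(1 + n)) : 'M[R]_n :=
  \matrix_(i, j) partial (ispace k) (fun y => E y i j) y.
(* Since 2 Ric is the time derivative of g, the scalar curvature needs no second derivatives. *)
Definition mscal (y : 'rV[R]_(1 + n)) : R := 2^-1 * \tr (invmx (E y) *m dtime y).

Lemma dtimeE y i j : dtime y i j = partial itime (fun y => E y i j) y. Proof. by rewrite mxE. Qed.
Lemma dspaceE k y i j : dspace k y i j = partial (ispace k) (fun y => E y i j) y. Proof. by rewrite mxE. Qed.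

Lemma is_derive_metric (V : normedModType R) (tau : V -> R) (f : V -> 'rV[R]_n) y v m l :
  W (tx (tau y) (f y)) -> is_derive y v tau m -> is_derive y v f l ->
  is_derive y v (fun z => E (tx (tau z) (f z))) (m *: dtime (tx (tau y) (f y)) +
    \sum_k l 0 k *: dspace k (tx (tau y) (f y))).
Proof.
move=> Wy dt df; apply/is_derive_mxP => i j.
have := @is_derive_txfun R n _ W (fun y => E y i j) tau f y v m l oW (mm_smooth mm 1 i j) Wy dt df.
rewrite [in X in _ -> X]addmx_entry [in X in _ -> X]summxE [in X in _ -> X]mxE dtimeE.
by under [in X in _ -> X]eq_bigr do rewrite mxE dspaceE.
Qed.

Lemma Ck_invE k i j : Ck k W (fun y => invmx (E y) i j).
Proof. by apply: Ck_invmx => //; [exact: mm_smooth mm k|exact: mm_unit mm]. Qed.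

Lemma Ck_dtime k i j : Ck k W (fun y => dtime y i j).
Proof.
have -> : (fun y => dtime y i j) = partial itime (fun y => E y i j) by apply/funext => y; rewrite dtimeE.
exact: Ck_partial (mm_smooth mm k.+1 i j).
Qed.

Lemma Ck_mscal k : Ck k W mscal.
Proof.
have E1 : mscal = (fun y => 2^-1 * \sum_i \sum_j invmx (E y) i j * dtime y j i).
  by apply/funext => y; rewrite /mscal /mxtrace; under eq_bigr do rewrite mulmx_entry.
rewrite E1; apply: (CkM oW (Ck_cst k W (2^-1 : R))); apply: Ck_sum => // i; apply: Ck_sum => // j.
by apply: CkM => //; [exact: Ck_invE|exact: Ck_dtime].
Qed.

Lemma ricciE t x : 0 <= t <= T -> W (tx t x) -> 2 *: ricci (g c t) x = dtime (tx t x).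
Proof.
move=> tT Wy; have cx : chart_image c x by have := mm_codom mm Wy; rewrite row_mxKr.
rewrite -(hflow.2 c t x Ac tT cx).
apply: (derive_withinE (F := fun s => E (tx s x))).
- have n1 : \forall s \near t, W (tx s x).
    by apply: (@tx_near R n _ W (nbhs t) _ (fun s => s) (fun=> x) t x oW Wy); [exact: cvg_id|exact: cvg_cst].
  have [d d0 Hd] := near_realE n1; exists d => // u /Hd Wu.
  by rewrite /= in_itv /= => uT; exact: (mm_eq mm uT Wu).
- by rewrite /= in_itv.
- have := @is_derive_metric _ (fun s => s) (fun=> x) t 1 _ _ Wy (is_derive_id t 1) (is_derive_cst x t 1).
  rewrite scale1r big1 ?addr0 // => k _; by rewrite mxE scale0r.
- by apply: (limit_point_itv T0 tT) => u /andP[u1 u2]; rewrite /= in_itv /= !ltW.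
Qed.

Lemma scalE t x : 0 <= t <= T -> W (tx t x) -> scalar_curvature (g c t) x = mscal (tx t x).
Proof.
move=> tT Wy; rewrite /scalar_curvature /mscal -(ricciE tT Wy) (mm_eq mm tT Wy).
by rewrite -scalemxAr mxtraceZ mulrA mulVf ?mul1r.
Qed.

Lemma near_space t x : W (tx t x) -> \forall y \near x, W (tx t y).
Proof. by move=> Wy; apply: (@tx_near R n _ W (nbhs x) _ (fun=> t) (fun y => y) t x oW Wy); [exact: cvg_cst|exact: cvg_id]. Qed.

Lemma pd_model (f : 'rV[R]_n -> R) (phi : 'rV[R]_(1 + n) -> R) t x k : Ck 1 W phi -> W (tx t x) ->
  (forall y, W (tx t y) -> f y = phi (tx t y)) -> pd k f x = partial (ispace k) phi (tx t x).
Proof.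
move=> Cp Wy fp; rewrite /pd.
have D : is_derive x 'e_k (fun y => phi (tx t y)) (partial (ispace k) phi (tx t x)).
  have := @is_derive_txfun R n _ W phi (fun=> t) (fun y => y) x 'e_k _ _ oW Cp Wy (is_derive_cst t x 'e_k) (is_derive_id x 'e_k).
  rewrite mul0r add0r (bigD1 k) //= mxE !eqxx mul1r big1 ?addr0 // => j jk.
  by rewrite mxE (negbTE jk) mul0r.
have [_ <-] := D; apply: near_eq_derive; apply: filterS (near_space Wy) => y; exact: fp.
Qed.

Lemma pd_metric t x k i j : 0 <= t <= T -> W (tx t x) -> pd k (fun y => g c t y i j) x = dspace k (tx t x) i j.
Proof.
move=> tT Wy; rewrite dspaceE; apply: (@pd_model (fun y => g c t y i j) (fun y => E y i j) t x k (mm_smooth mm 1 i j) Wy) => y Wy'.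
by rewrite (mm_eq mm tT Wy').
Qed.

Lemma pd_scal t x k : 0 <= t <= T -> W (tx t x) ->
  pd k (scalar_curvature (g c t)) x = partial (ispace k) mscal (tx t x).
Proof. by move=> tT Wy; apply: (@pd_model (scalar_curvature (g c t)) mscal t x k (Ck_mscal 1) Wy) => y; exact: scalE. Qed.

End Model.

Local Notation N := (1 + (n + n))%N.
Local Notation S := (Num.sqrt T).

(* For t = s^2 and y = dx/ds the L-length is the integral of |y|^2 / 2 + 2 s^2 R, with Legendre transform L_ham. *)
Definition L_ham c (z : 'rV[R]_N) : R :=
  2^-1 * (mp z *m invmx (g c (z 0 i0 ^+ 2) (xp z)) *m (mp z)^T) 0 0
  - 2 * z 0 i0 ^+ 2 * scalar_curvature (g c (z 0 i0 ^+ 2)) (xp z).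

Definition sx (z : 'rV[R]_N) : 'rV[R]_(1 + n) := tx (z 0 i0 ^+ 2) (xp z).

Lemma slab_time (z : 'rV[R]_N) : slab S z -> 0 <= z 0 i0 ^+ 2 <= T.
Proof.
case/andP=> z0 zS; rewrite exprn_ge0 //= -(sqr_sqrtr (ltW T0)).
by rewrite lerXn2r // nnegrE sqrtr_ge0.
Qed.

Lemma sx_continuous : continuous sx.
Proof.
move=> z; apply/(@cvg_mxP _ _ (nbhs z)) => i j; rewrite (ord1 i); elim/time_space_ind: j => [|k].
  rewrite tx_time; under eq_fun do rewrite tx_time.
  by rewrite expr2; under eq_fun do rewrite expr2; apply: cvgM; exact: coord_continuous.
rewrite tx_space xpE; under eq_fun do rewrite tx_space xpE.
exact: coord_continuous.
Qed.

Section HamiltonianModel.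
Variables (c : chart R n M) (W : set 'rV[R]_(1 + n)) (E : 'rV[R]_(1 + n) -> 'M[R]_n).
Hypotheses (Ac : A c) (mm : metric_model c W E).
Let oW := mm_open mm.
Local Notation Q z := (invmx (E (sx z))).

Definition model_ham (z : 'rV[R]_N) : R :=
  2^-1 * (mp z *m Q z *m (mp z)^T) 0 0 - 2 * z 0 i0 ^+ 2 * mscal E (sx z).

Definition model_dom : set 'rV[R]_N := sx @^-1` W.

Lemma model_dom_open : open model_dom.
Proof. by apply: open_comp => // z _; exact: sx_continuous. Qed.

Lemma model_hamE z : slab S z -> model_dom z -> L_ham c z = model_ham z.
Proof.
move=> sz kz; have tT := slab_time sz.
by rewrite /L_ham /model_ham (mm_eq mm tT kz) (scalE Ac mm tT kz).
Qed.

Lemma Ck_sx k (phi : 'rV[R]_(1 + n) -> R) : Ck k W phi -> Ck k model_dom (fun z => phi (sx z)).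
Proof.
apply: Ck_comp => //; first exact: model_dom_open.
elim/time_space_ind => [|j].
  have -> : (fun z => sx z 0 itime) = (fun z => z 0 i0 * z 0 i0) by apply/funext => z; rewrite tx_time expr2.
  by apply: (CkM model_dom_open); exact: Ck_coord.
have -> : (fun z => sx z 0 (ispace j)) = (fun z => z 0 (ix j)) by apply/funext => z; rewrite tx_space xpE.
exact: Ck_coord.
Qed.

Lemma Ck_model_ham k : Ck k model_dom model_ham.
Proof.
have oK := model_dom_open.
have E1 : model_ham = (fun z => 2^-1 * (\sum_j (\sum_i z 0 (ip i) * Q z i j) * z 0 (ip j)) -
    2 * (z 0 i0 * z 0 i0) * mscal E (sx z)).
  apply/funext => z; rewrite /model_ham expr2 mulmx_entry; congr (2^-1 * _ - _); apply: eq_bigr => j _.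
  by rewrite mulmx_entry trmx_entry mpE; congr (_ * _); apply: eq_bigr => i _; rewrite mpE.
rewrite E1; apply: CkB => //.
  apply: (CkM oK (Ck_cst k model_dom (2^-1 : R))); apply: Ck_sum => // j; apply: CkM => //; last exact: Ck_coord.
  apply: Ck_sum => // i; apply: CkM => //; first exact: Ck_coord.
  by apply: (@Ck_sx k (fun y => invmx (E y) i j)); exact: Ck_invE mm k i j.
apply: CkM => //; last by apply: Ck_sx; exact: Ck_mscal mm k.
by apply: (CkM oK (Ck_cst k model_dom (2 : R))); apply: CkM => //; exact: Ck_coord.
Qed.

Definition velocity (z : 'rV[R]_N) : 'rV[R]_n := mp z *m Q z.

Lemma invE_sym z : (Q z)^T = Q z. Proof. by rewrite trmx_inv (mm_sym mm). Qed.

(** Only directions of constant time occur, so the time derivative of the metric is absent. The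
    derivative -Q dE Q of the inverse metric Q converts momenta into velocities and produces the
    sign of the middle term. *)
Lemma is_derive_model_ham z (w : 'rV[R]_N) : model_dom z -> w 0 i0 = 0 ->
  is_derive z w model_ham ((velocity z *m (mp w)^T) 0 0
   - 2^-1 * \sum_k xp w 0 k * (velocity z *m dspace E k (sx z) *m (velocity z)^T) 0 0
   - 2 * z 0 i0 ^+ 2 * \sum_k xp w 0 k * partial (ispace k) (mscal E) (sx z)).
Proof.
move=> kz w0; have oK := model_dom_open.
have dx : is_derive z w (fun y : 'rV[R]_N => xp y) (xp w) by exact: is_derive_xp.
have dm : is_derive z w (fun y : 'rV[R]_N => mp y) (mp w) by exact: is_derive_mp.
have dt : is_derive z w (fun y : 'rV[R]_N => y 0 i0 ^+ 2) 0.
  have D : is_derive z w (fun y : 'rV[R]_N => y 0 i0) 0.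
    by rewrite -w0; have /is_derive_mxP := is_derive_id z w; exact.
  have -> : (fun y : 'rV[R]_N => y 0 i0 ^+ 2) = (fun y => y 0 i0) * (fun y => y 0 i0).
    by apply/funext => y; rewrite expr2.
  by have := is_deriveM D D; rewrite scaler0 addr0.
have dE := is_derive_metric mm kz dt dx.
have dS := is_derive_txfun oW (Ck_mscal mm 1) kz dt dx.
rewrite scale0r add0r in dE; rewrite mul0r add0r in dS.
set dEz := \sum_k _ in dE.
have dQ0 : is_derive z w (fun y => Q y) (\matrix_(i, j) 'D_w (fun y => Q y i j) z).
  apply/is_derive_mxP => i j; rewrite mxE; apply: DeriveDef => //.
  exact: Ck_derivable (Ck_sx (Ck_invE mm 1 i j)) kz.
have Fu : \forall y \near z, E (sx y) \in unitmx.
  have : \forall y \near z, model_dom y by apply: open_nbhs_nbhs.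
  by apply: filterS => y; exact: mm_unit mm _.
have dQ1 := is_derive_invmx Fu dE dQ0; rewrite {}dQ1 in dQ0.
have dP := is_derive_mulmx (is_derive_mulmx dm dQ0) (is_derive_tr dm).
have {}dP := iffLR (is_derive_mxP _ _ _ _) dP 0 0.
have D1 := is_deriveM (is_derive_cst (2^-1 : R) z w) dP.
have D2 := is_deriveM (is_deriveM (is_derive_cst (2 : R) z w) dt) dS.
have D3 : is_derive z w model_ham _ := is_deriveB D1 D2.
apply: is_derive_eq D3 _; rewrite ![in LHS]scaler0 !addr0 scaler0 addr0.
set dS0 := \sum_k _ in dS *; set y := velocity z.
have yT : Q z *m (mp z)^T = y^T by rewrite /y /velocity trmx_mul invE_sym.
have Ea : (mp w *m Q z *m (mp z)^T) 0 0 = (y *m (mp w)^T) 0 0.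
  by rewrite -mulmxA yT -[LHS]trmx_entry trmx_mul trmxK.
have Eb : (mp z *m - (Q z *m dEz *m Q z) *m (mp z)^T) 0 0 = - (\sum_k xp w 0 k * (y *m dspace E k (sx z) *m y^T) 0 0).
  rewrite mulmxN mulNmx oppmx_entry !mulmxA -[mp z *m Q z]/y -[_ *m Q z *m _]mulmxA yT.
  rewrite /dEz mulmx_sumr mulmx_suml summxE; congr (- _); apply: eq_bigr => k _.
  by rewrite -scalemxAr -scalemxAl [LHS]mxE.
rewrite mulmxDl !addmx_entry Ea Eb; set b := \sum_k _.
rewrite -[mp z *m Q z]/y; set a := (y *m _) 0 0; rewrite -[LHS]/(2^-1 * (a - b + a) - (2 * z 0 i0 ^+ 2) * dS0).
by field.
Qed.

Lemma model_ham_mom k z : model_dom z -> partial (ip k) model_ham z = velocity z 0 k.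
Proof.
move=> kz; rewrite partialE; have [_ ->] := is_derive_model_ham kz (delta_ip_tm R k).
rewrite delta_ip_xp delta_ip_mp mul_delta_tr !big1 ?mulr0 ?subr0 //; by move=> j _; rewrite mxE mul0r.
Qed.

Lemma model_ham_pos k z : model_dom z -> partial (ix k) model_ham z =
  - (2^-1 * (velocity z *m dspace E k (sx z) *m (velocity z)^T) 0 0)
  - 2 * z 0 i0 ^+ 2 * partial (ispace k) (mscal E) (sx z).
Proof.
move=> kz; rewrite partialE; have [_ ->] := is_derive_model_ham kz (delta_ix_tm R k).
by rewrite delta_ix_xp delta_ix_mp !sum_delta trmx0 mulmx0 [X in X - _ - _]mxE sub0r.
Qed.

(** Along a momentum direction time and position are fixed, so the velocity is an affine function
    with slope the inverse metric. *)
Lemma hess_model_ham z : model_dom z -> hess model_ham z (@ip n) (@ip n) = Q z.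
Proof.
move=> kz; apply/matrixP => k l; rewrite [LHS]mxE partialE.
have n1 : \forall y \near z, model_dom y by apply: open_nbhs_nbhs; split=> //; exact: model_dom_open.
have -> : 'D_('e_(ip k)) (partial (ip l) model_ham) z = 'D_('e_(ip k)) (fun y => velocity y 0 l) z.
  by apply: near_eq_derive; apply: filterS n1 => y; exact: model_ham_mom.
have D0 : is_derive z 'e_(ip k) (fun s => velocity s 0 l) (Q z k l).
  apply/is_derive_lineP.
  have -> : (fun s : R => velocity (z + s *: ('e_(ip k) : 'rV[R]_N)) 0 l) = (fun s => velocity z 0 l + s * Q z k l).
    apply/funext => s; rewrite /velocity.
    have lineE j : (z + s *: ('e_(ip k) : 'rV[R]_N)) 0 j = z 0 j + s * ('e_(ip k) : 'rV[R]_N) 0 j by rewrite !mxE.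
    have -> : sx (z + s *: ('e_(ip k) : 'rV[R]_N)) = sx z.
      rewrite /sx; congr tx.
        by rewrite lineE delta_ip_tm mulr0 addr0.
      apply/matrixP => i j; rewrite (ord1 i) !xpE lineE -[('e_(ip k) : 'rV[R]_N) 0 (ix j)]xpE.
      by rewrite delta_ip_xp mxE mulr0 addr0.
    have -> : mp (z + s *: ('e_(ip k) : 'rV[R]_N)) = mp z + s *: 'e_k.
      apply/matrixP => i j; rewrite (ord1 i) mpE lineE -[('e_(ip k) : 'rV[R]_N) 0 (ip j)]mpE.
      by rewrite delta_ip_mp !mxE.
    by rewrite mulmxDl -scalemxAl -rowE addmx_entry; congr (_ + _); rewrite [LHS]mxE; congr (_ * _); rewrite mxE.
  have := is_deriveD (is_derive_cst (velocity z 0 l) (0 : R) 1)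
     (is_deriveM (is_derive_id (0 : R) 1) (is_derive_cst (Q z k l) (0 : R) 1)).
  by rewrite scaler0 add0r add0r [_ *: 1]mulr1.
by have [_ ->] := D0.
Qed.

Lemma model_ham_convex z (w : 'rV[R]_n) : slab S z -> model_dom z -> w != 0 ->
  0 < (w *m hess model_ham z (@ip n) (@ip n) *m w^T) 0 0.
Proof.
move=> sz kz w0; rewrite hess_model_ham //; have tT := slab_time sz.
have uE := mm_unit mm kz; have Eg := mm_eq mm tT kz.
have cx : chart_image c (xp z) by have := mm_codom mm kz; rewrite row_mxKr.
have wQ0 : w *m Q z != 0.
  by apply: contra_neq w0 => wQ; rewrite -(mulmxKV uE w) wQ mul0mx.
have := metric_family_pos hg Ac tT cx wQ0.
by rewrite Eg -/(sx z) trmx_mul invE_sym mulmxA mulmxKV.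
Qed.

End HamiltonianModel.

Lemma L_ham_smooth c z0 : A c -> slab S z0 -> chart_image c (xp z0) ->
  exists (U : set 'rV[R]_N) (K : 'rV[R]_N -> R),
    [/\ open U, U z0, forall k, Ck k U K, forall z, U z -> chart_image c (xp z) /\ (slab S z -> L_ham c z = K z)
    & forall z, U z -> slab S z -> forall w : 'rV[R]_n, w != 0 -> 0 < (w *m hess K z (@ip n) (@ip n) *m w^T) 0 0].
Proof.
move=> Ac sz cx; have [W [E [mm Wz]]] := metric_model_exists Ac (slab_time sz) cx.
exists (model_dom W), (model_ham E); split=> //.
- exact: model_dom_open mm.
- by move=> k; exact: Ck_model_ham mm k.
- move=> z kz; split; first by have := mm_codom mm kz; rewrite row_mxKr.
  by move=> sz'; exact: (model_hamE Ac mm sz' kz).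
- by move=> z kz sz' w w0; exact: (model_ham_convex Ac mm).
Qed.

Hypothesis hM : smooth_manifold A.

Lemma jacobian_jac c c' q : A c -> A c' -> chart_dom c q -> chart_dom c' q ->
  jacobian (chart_map c' \o chart_inv c) (chart_map c q) = jac (trans c c') (chart_map c q).
Proof.
move=> Ac Ac' cq c'q; apply: (jacobianE (@overlap_open R n M c c')); first exact: overlap_mem.
by move=> j; exact: (Ck_trans hM 1 j Ac Ac').
Qed.

Lemma metric_change c c' t q : A c -> A c' -> 0 <= t <= T -> chart_dom c q -> chart_dom c' q ->
  let J := jac (trans c c') (chart_map c q) in
  g c t (chart_map c q) = J *m g c' t (chart_map c' q) *m J^T.
Proof. by move=> Ac Ac' tT cq c'q; rewrite /= -jacobian_jac //; exact: (metric_family_change hg). Qed.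

(** The tensor law of the Ricci curvature comes from the flow equation rather than from a
    computation with Christoffel symbols: 2 Ric is the time derivative of g, and the Jacobian of the
    coordinate change is independent of time. *)
Lemma ricci_change c c' t q : A c -> A c' -> 0 <= t <= T -> chart_dom c q -> chart_dom c' q ->
  let J := jac (trans c c') (chart_map c q) in
  ricci (g c t) (chart_map c q) = J *m ricci (g c' t) (chart_map c' q) *m J^T.
Proof.
move=> Ac Ac' tT cq c'q J.
have [W [E [mm Wy]]] := metric_model_exists Ac' tT (map_image c'q).
suff E2 : 2 *: ricci (g c t) (chart_map c q) = J *m (2 *: ricci (g c' t) (chart_map c' q)) *m J^T.
  apply: (scalerI (_ : (2 : R) != 0)); first by rewrite pnatr_eq0.
  by rewrite E2 -scalemxAr -scalemxAl.
rewrite -(hflow.2 c t _ Ac tT (map_image cq)) (ricciE Ac' mm tT Wy).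
apply: (derive_withinE (F := fun s => J *m E (tx s (chart_map c' q)) *m J^T)).
- have n1 : \forall s \near t, W (tx s (chart_map c' q)).
    by apply: (@tx_near R n _ W (nbhs t) _ (fun s => s) (fun=> chart_map c' q) t _ (mm_open mm) Wy); [exact: cvg_id|exact: cvg_cst].
  have [d d0 Hd] := near_realE n1; exists d => // u /Hd Wu.
  by rewrite /= in_itv /= => uT; rewrite (metric_change Ac Ac' uT cq c'q) (mm_eq mm uT Wu).
- by rewrite /= in_itv.
- apply: is_derive_mulmxr; apply: is_derive_mulmxl.
  have := @is_derive_metric _ _ _ mm _ (fun s => s) (fun=> chart_map c' q) t 1 _ _ Wy (is_derive_id t 1) (is_derive_cst (chart_map c' q) t 1).
  rewrite scale1r big1 ?addr0 // => k _; by rewrite mxE scale0r.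
- by apply: (limit_point_itv T0 tT) => u /andP[u1 u2]; rewrite /= in_itv /= !ltW.
Qed.

Lemma L_ham_transfer c c' (z : 'rV[R]_N) : A c -> A c' -> slab S z -> overlap c c' (xp z) ->
  L_ham c z = L_ham c' (transfer c c' z).
Proof.
move=> Ac Ac' sz [q [cq c'q] Eq]; have tT := slab_time sz.
pose J := jac (trans c c') (xp z).
have uJ : J \in unitmx by rewrite /J -Eq; apply: (jac_unit hM) => //; exact: overlap_mem.
have xq : xp (transfer c c' z) = chart_map c' q by rewrite transfer_xp -Eq row_trans.
rewrite /L_ham transfer_tm xq transfer_mp -/J -Eq; set t := z 0 i0 ^+ 2 in tT *.
have uG : g c' t (chart_map c' q) \in unitmx by apply: metric_unit => //; exact: map_image.
rewrite /scalar_curvature (ricci_change Ac Ac' tT cq c'q) (metric_change Ac Ac' tT cq c'q) Eq -/J.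
rewrite (invmx_congr uG uJ); congr (2^-1 * _ - _ * _).
  by rewrite trmx_mul trmxK !mulmxA.
rewrite -!mulmxA mxtrace_mulC !mulmxA mulmxKV //.
by rewrite -[_ *m J^T *m _]mulmxA -trmx_mul mulVmx // trmx1 mulmx1 mxtrace_mulC.
Qed.

End Metric.

Lemma scalemx_entry (R : pzRingType) p q (a : R) (B : 'M[R]_(p, q)) i j : (a *: B) i j = a * B i j.
Proof. by rewrite mxE. Qed.

Lemma row_entry (R : Type) n (F : 'I_n -> R) i j : (\row_k F k) i j = F j.
Proof. by rewrite mxE. Qed.

(** * L-geodesics and Hamilton's equations *)

Section Algebra.
Variables (R : realType) (n : nat).
Implicit Types (X : 'rV[R]_n).

(* Christoffel symbols of the first kind, contracted twice with X. *)
Definition first_kind (dG : 'I_n -> 'M[R]_n) X : 'rV[R]_n :=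
  \row_l \sum_i \sum_j 2^-1 * (dG i j l + dG j i l - dG l i j) * X 0 i * X 0 j.

Lemma first_kindE dG X : (forall k, (dG k)^T = dG k) ->
  first_kind dG X = \sum_k X 0 k *: (X *m dG k) - 2^-1 *: \row_k (X *m dG k *m X^T) 0 0.
Proof.
move=> sG; apply/rowP => l; rewrite [LHS]mxE addmx_entry summxE oppmx_entry scalemx_entry row_entry.
have E1 : \sum_i \sum_j dG i j l * X 0 i * X 0 j = \sum_k (X 0 k *: (X *m dG k)) 0 l.
  apply: eq_bigr => i _; rewrite [RHS]mxE mulmx_entry mulr_sumr; apply: eq_bigr => j _.
  by rewrite mulrAC mulrC; congr (_ * _); rewrite mulrC.
have E2 : \sum_i \sum_j dG j i l * X 0 i * X 0 j = \sum_k (X 0 k *: (X *m dG k)) 0 l.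
  rewrite exchange_big /= -E1; apply: eq_bigr => i _; apply: eq_bigr => j _; by rewrite mulrAC.
have E3 : \sum_i \sum_j dG l i j * X 0 i * X 0 j = (X *m dG l *m X^T) 0 0.
  rewrite mulmx_entry exchange_big /=; apply: eq_bigr => j _; rewrite trmx_entry mulmx_entry mulr_suml.
  by apply: eq_bigr => i _; rewrite [X 0 i * _]mulrC.
have -> : \sum_i \sum_j 2^-1 * (dG i j l + dG j i l - dG l i j) * X 0 i * X 0 j =
    2^-1 * (\sum_i \sum_j dG i j l * X 0 i * X 0 j + \sum_i \sum_j dG j i l * X 0 i * X 0 j
     - \sum_i \sum_j dG l i j * X 0 i * X 0 j).
  rewrite -big_split -sumrB mulr_sumr; apply: eq_bigr => i _.
  rewrite -big_split -sumrB mulr_sumr; apply: eq_bigr => j _ /=; ring.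
rewrite E1 E2 E3; set a := \sum_k _; set b := (_ *m _) 0 0; by field.
Qed.

(* With y = 2 s X the velocity in the parameter s = sqrt t, this turns the L-geodesic equation at t = s^2
   into Hamilton's equation for the momentum y G. *)
Lemma momentum_identity (G dt : 'M[R]_n) (dG : 'I_n -> 'M[R]_n) X (a r : 'rV[R]_n) (s : R) : s != 0 ->
  (forall k, (dG k)^T = dG k) ->
  let y := (2 * s) *: X in
  (4 * s ^+ 2) *: (a *m G + first_kind dG X - 2^-1 *: r + (2 * s ^+ 2)^-1 *: (X *m G) + X *m dt) =
  (2 *: X + (4 * s ^+ 2) *: a) *m G + y *m ((2 * s) *: dt + \sum_k y 0 k *: dG k)
  - \row_k (2^-1 * (y *m dG k *m y^T) 0 0 + 2 * s ^+ 2 * r 0 k).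
Proof.
move=> s0 sG y; rewrite first_kindE //.
have -> : \row_k (2^-1 * (y *m dG k *m y^T) 0 0 + 2 * s ^+ 2 * r 0 k) =
    (4 * s ^+ 2) *: (2^-1 *: \row_k (X *m dG k *m X^T) 0 0) + (2 * s ^+ 2) *: r.
  apply/rowP => k; rewrite row_entry addmx_entry !scalemx_entry row_entry.
  have -> : (y *m dG k *m y^T) 0 0 = (2 * s) * ((2 * s) * (X *m dG k *m X^T) 0 0).
    by rewrite -!scalemx_entry /y linearZ /= -scalemxAr -!scalemxAl.
  by field.
have -> : y *m ((2 * s) *: dt + \sum_k y 0 k *: dG k) =
    (4 * s ^+ 2) *: (X *m dt) + (4 * s ^+ 2) *: \sum_k X 0 k *: (X *m dG k).
  rewrite mulmxDr /y -!scalemxAl -!scalemxAr scalerA; congr (_ + _); first by congr (_ *: _); ring.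
  rewrite scaler_sumr mulmx_sumr scaler_sumr; apply: eq_bigr => k _.
  by rewrite -scalemxAr !scalerA scalemx_entry; congr (_ *: _); ring.
rewrite mulmxDl -!scalemxAl !scalerDr !scalerN !scalerA.
have -> : 4 * s ^+ 2 / (2 * s ^+ 2) = 2 by field.
have -> : 4 * s ^+ 2 / 2 = 2 * s ^+ 2 by field.
set A1 := _ *: (a *m G); set A2 := _ *: \sum_k _; set A3 := _ *: \row_k _; set A4 := _ *: r; set A5 := 2 *: _; set A6 := _ *: (X *m dt).
rewrite opprD; apply/rowP => k; rewrite !mxE; ring.
Qed.

End Algebra.

Lemma is_derive_comp1 (R : realType) (V W : normedModType R) (f : R -> W) (tau : V -> R) x v l m :
  is_derive (tau x) 1 f l -> is_derive x v tau m -> is_derive x v (fun z => f (tau z)) (m *: l).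
Proof.
move=> [f1 f2] dt; have df : differentiable f (tau x) by apply/derivable1_diffP.
have D := is_derive_comp_diff df dt; apply: is_derive_eq D _.
by rewrite -f2 (deriveE _ df) -linearZ /= [m *: 1]mulr1.
Qed.

Lemma is_derive_sqr (R : realType) (s : R) : is_derive s 1 (fun s : R => s ^+ 2) (2 * s).
Proof.
have -> : (fun s : R => s ^+ 2) = (id : R -> R) * id by apply/funext => u; rewrite expr2.
have D := is_deriveM (is_derive_id s 1) (is_derive_id s 1); apply: is_derive_eq D _.
by rewrite [s *: 1]mulr1; ring.
Qed.

Lemma is_derive_state (R : realType) (V : normedModType R) n (tau : V -> R) (f h : V -> 'rV[R]_n) y v m l k :
  is_derive y v tau m -> is_derive y v f l -> is_derive y v h k ->
  is_derive y v (fun z => mk (const_mx (tau z)) (f z) (h z)) (mk (const_mx m) l k).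
Proof.
move=> dt df dh; apply/is_derive_mxP => i j; rewrite (ord1 i); elim/state_ind: j => [|a|a].
- rewrite -(tmE _ 0 0) tm_mk mxE.
  have -> // : (fun z => mk (const_mx (tau z)) (f z) (h z) 0 i0) = tau by apply/funext => z; rewrite -(tmE _ 0 0) tm_mk mxE.
- rewrite -xpE xp_mk; have -> : (fun z => mk (const_mx (tau z)) (f z) (h z) 0 (ix a)) = (fun z => f z 0 a).
    by apply/funext => z; rewrite -xpE xp_mk.
  by have /is_derive_mxP := df.
- rewrite -mpE mp_mk; have -> : (fun z => mk (const_mx (tau z)) (f z) (h z) 0 (ip a)) = (fun z => h z 0 a).
    by apply/funext => z; rewrite -mpE mp_mk.
  by have /is_derive_mxP := dh.
Qed.

Lemma Ck2_derivatives (R : realType) (V : normedModType R) (U : set R^o) (F : R^o -> V) : Ck 2 U F ->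
  exists F1 F2 : R -> V, forall t : R, U t -> is_derive t 1 F (F1 t) /\ is_derive t 1 F1 (F2 t).
Proof.
move=> CF; pose F1 : R^o -> V := 'D_1 F; pose F2 : R^o -> V := 'D_1 F1.
have C1 : Ck 1 U F1 by exact: Ck_derive CF.
exists F1, F2 => t Ut; split; apply: DeriveDef => //.
  exact: (Ck_derivable (k := 0) (Ck_pred CF) Ut).
exact: (Ck_derivable (k := 0) C1 Ut).
Qed.

Section Geodesics.
Variables (R : realType) (n : nat) (M : topologicalType) (A : set (chart R n M)) (T : R).
Variable g : tensor_family R n M.
Hypotheses (hM : smooth_manifold A) (T0 : 0 < T) (hflow : backwards_ricci_flow A T g).
Implicit Types (c : chart R n M) (t : R) (x : 'rV[R]_n).
Local Notation N := (1 + (n + n))%N.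
Local Notation S := (Num.sqrt T).
Local Notation H := (L_ham g).
Let hg : metric_family A T g := hflow.1.

(** The left-hand side of the L-geodesic equation, with a standing for the coordinate derivative of
    X. *)
Definition L_operator c t x (X a : 'rV[R]_n) : 'rV[R]_n :=
  a + christoffel_quad (g c t) x X - 2^-1 *: gradient (g c t) (scalar_curvature (g c t)) x
  + (2 * t)^-1 *: X + 2 *: (X *m ricci (g c t) x *m invmx (g c t x)).

Section Model.
Variables (c : chart R n M) (W : set 'rV[R]_(1 + n)) (E : 'rV[R]_(1 + n) -> 'M[R]_n).
Hypotheses (Ac : A c) (mm : metric_model T g c W E).
Let oW := mm_open mm.

Lemma dspace_sym k y : (dspace E k y)^T = dspace E k y.
Proof.
apply/matrixP => i j; rewrite trmx_entry !dspaceE; congr (partial _ _ _); apply/funext => z.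
by rewrite -[LHS]trmx_entry (mm_sym mm).
Qed.

(** Multiplication by the metric lowers the index: inverse metrics cancel, Christoffel symbols of
    the first kind appear, and Ric becomes half the time derivative of the metric. *)
Lemma L_operatorE t x X a : 0 <= t <= T -> W (tx t x) -> L_operator c t x X a *m E (tx t x) =
  a *m E (tx t x) + first_kind (fun k => dspace E k (tx t x)) X
  - 2^-1 *: \row_k partial (ispace k) (mscal E) (tx t x) + (2 * t)^-1 *: (X *m E (tx t x)) + X *m dtime E (tx t x).
Proof.
move=> tT Wy; rewrite /L_operator; have uE := mm_unit mm Wy; have Eg := mm_eq mm tT Wy.
have sE : (invmx (E (tx t x)))^T = invmx (E (tx t x)) by rewrite trmx_inv (mm_sym mm).
have -> : christoffel_quad (g c t) x X = first_kind (fun k => dspace E k (tx t x)) X *m invmx (E (tx t x)).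
  apply/rowP => k; rewrite [LHS]mxE mulmx_entry.
  under [RHS]eq_bigr => l _.
    rewrite [first_kind _ _ _ _]mxE mulr_suml.
    under eq_bigr => i _ do rewrite mulr_suml.
    over.
  rewrite [RHS]exchange_big /=; apply: eq_bigr => i _; rewrite [RHS]exchange_big /=; apply: eq_bigr => j _.
  rewrite /christoffel Eg mulr_sumr !mulr_suml; apply: eq_bigr => l _.
  by rewrite !(pd_metric mm _ _ _ tT Wy) -[in LHS]sE trmx_entry; ring.
have -> : gradient (g c t) (scalar_curvature (g c t)) x =
    (\row_k partial (ispace k) (mscal E) (tx t x)) *m invmx (E (tx t x)).
  apply/rowP => k; rewrite [LHS]mxE mulmx_entry Eg; apply: eq_bigr => l _.
  rewrite (pd_scal T0 hflow Ac mm _ tT Wy) [in RHS]mxE -[in LHS]sE trmx_entry mulrC //.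
rewrite Eg !mulmxDl mulNmx -!scalemxAl !mulmxKV //.
by rewrite -(ricciE T0 hflow Ac mm tT Wy) -scalemxAr.
Qed.

Lemma hfieldE (z : 'rV[R]_N) : slab S z -> model_dom W z ->
  hfield H c z = mk (const_mx 1) (velocity E z)
   (\row_k (2^-1 * (velocity E z *m dspace E k (sx z) *m (velocity E z)^T) 0 0
      + 2 * z 0 i0 ^+ 2 * partial (ispace k) (mscal E) (sx z))).
Proof.
move=> sz kz.
rewrite (hfield_model (model_dom_open mm) kz (Ck_model_ham mm 1) _ sz); last first.
  by move=> y ky sy; exact: (model_hamE T0 hflow Ac mm sy ky).
apply: state_ext.
- by apply/matrixP => i j; rewrite tm_mk (ord1 i) tmE vfE hf0 mxE.
- by apply/rowP => k; rewrite xp_mk xpE vfE hfx (model_ham_mom mm).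
- by apply/rowP => k; rewrite mp_mk mpE vfE hfp (model_ham_pos mm) // row_entry opprB opprK addrC.
Qed.

Section Curve.
Variables (F F1 F2 : R -> 'rV[R]_n) (s : R).
Hypotheses (dF : is_derive (s ^+ 2) 1 F (F1 (s ^+ 2))) (dF1 : is_derive (s ^+ 2) 1 F1 (F2 (s ^+ 2)))
  (Ws : W (tx (s ^+ 2) (F (s ^+ 2)))).
Local Notation y := ((2 * s) *: F1 (s ^+ 2)).
Local Notation Y := (tx (s ^+ 2) (F (s ^+ 2))).

Definition momentum (s : R) : 'rV[R]_n := ((2 * s) *: F1 (s ^+ 2)) *m E (tx (s ^+ 2) (F (s ^+ 2))).

Definition dmomentum : 'rV[R]_n := (2 *: F1 (s ^+ 2) + (4 * s ^+ 2) *: F2 (s ^+ 2)) *m E Y +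
  y *m ((2 * s) *: dtime E Y + \sum_k y 0 k *: dspace E k Y).

Lemma is_derive_position : is_derive s 1 (fun s : R => F (s ^+ 2)) y.
Proof. exact: (@is_derive_comp1 _ _ _ F (fun s : R => s ^+ 2) s 1 _ _ dF (is_derive_sqr s)). Qed.

Lemma is_derive_momentum : is_derive s 1 momentum dmomentum.
Proof.
have d2 : is_derive s 1 (fun s : R => 2 * s) (2 : R).
  have D := is_deriveM (is_derive_cst (2 : R) s 1) (is_derive_id s 1); apply: is_derive_eq D _.
  by rewrite scaler0 addr0 [_ *: 1]mulr1.
have dX : is_derive s 1 (fun s : R => F1 (s ^+ 2)) ((2 * s) *: F2 (s ^+ 2)).
  exact: (@is_derive_comp1 _ _ _ F1 (fun s : R => s ^+ 2) s 1 _ _ dF1 (is_derive_sqr s)).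
have dy : is_derive s 1 (fun s : R => (2 * s) *: F1 (s ^+ 2)) (2 *: F1 (s ^+ 2) + (4 * s ^+ 2) *: F2 (s ^+ 2)).
  apply/is_derive_mxP => i j.
  have -> : (fun s : R => ((2 * s) *: F1 (s ^+ 2)) i j) = (fun s : R => 2 * s) * (fun s => F1 (s ^+ 2) i j).
    by apply/funext => u; rewrite scalemx_entry.
  have D := is_deriveM d2 (iffLR (is_derive_mxP _ _ _ _) dX i j); apply: is_derive_eq D _.
  by rewrite addmx_entry !scalemx_entry [_ *: (_ * _)]mulrA [_ *: 2]mulrC addrC; congr (_ + _ * _); ring.
have dE := @is_derive_metric _ _ _ _ _ _ _ _ mm _ (fun s : R => s ^+ 2) (fun s : R => F (s ^+ 2)) s 1 _ _ Ws (is_derive_sqr s) is_derive_position.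
exact: is_derive_mulmx dy dE.
Qed.

(** The derivative of the momentum differs from Hamilton's right-hand side by 4 s^2 times the
    lowered L-geodesic operator. For s != 0 the two equations are therefore equivalent, and the
    identity is used in both directions. *)
Lemma dmomentumE : s != 0 -> 0 <= s ^+ 2 <= T ->
  dmomentum = (4 * s ^+ 2) *: (L_operator c (s ^+ 2) (F (s ^+ 2)) (F1 (s ^+ 2)) (F2 (s ^+ 2)) *m E Y) +
    \row_k (2^-1 * (y *m dspace E k Y *m y^T) 0 0 + 2 * s ^+ 2 * partial (ispace k) (mscal E) Y).
Proof.
move=> s0 tT; rewrite (L_operatorE _ _ tT Ws) momentum_identity //; last by move=> k; exact: dspace_sym.
apply/esym; have -> : \row_k (2^-1 * (y *m dspace E k Y *m y^T) 0 0 + 2 * s ^+ 2 * (\row_k partial (ispace k) (mscal E) Y) 0 k) = \row_k (2^-1 * (y *m dspace E k Y *m y^T) 0 0 + 2 * s ^+ 2 * partial (ispace k) (mscal E) Y).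
  by apply/rowP => k; rewrite !row_entry.
exact: subrK.
Qed.

Lemma hfield_momentum : 0 <= s <= S ->
  hfield H c (mk (const_mx s) (F (s ^+ 2)) (momentum s)) = mk (const_mx 1) y
   (\row_k (2^-1 * (y *m dspace E k Y *m y^T) 0 0 + 2 * s ^+ 2 * partial (ispace k) (mscal E) Y)).
Proof.
move=> sS; set z := mk _ _ _.
have zs : z 0 i0 = s by rewrite -(tmE _ 0 0) tm_mk mxE.
have zY : sx z = Y by rewrite /sx zs xp_mk.
have kz : model_dom W z by rewrite /model_dom /= zY.
have vz : velocity E z = y by rewrite /velocity zY mp_mk mulmxK //; exact: (mm_unit mm Ws).
by rewrite (hfieldE _ kz) /slab zs // vz zY.
Qed.

End Curve.

End Model.

Local Notation I0T := (`]0, T]%classic : set R).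
Local Notation W0 b r := (within `[0, b]%classic (nbhs r)).

Lemma sqr_time (s : R) : 0 <= s <= S -> 0 <= s ^+ 2 <= T.
Proof.
case/andP=> s0 sS; rewrite exprn_ge0 //= -(sqr_sqrtr (ltW T0)).
by rewrite lerXn2r // nnegrE sqrtr_ge0.
Qed.

Lemma sqr_time_pos (s : R) : 0 < s <= S -> 0 < s ^+ 2 <= T.
Proof.
case/andP=> s0 sS; rewrite exprn_gt0 //=; have := @sqr_time s; rewrite (ltW s0) sS => /(_ isT).
by case/andP.
Qed.

Lemma sqr_cvg (s : R) : u ^+ 2 @[u --> s] --> s ^+ 2.
Proof. by rewrite expr2; under eq_fun do rewrite expr2; apply: cvgM; exact: cvg_id. Qed.

(** * From an L-geodesic to a solution of the Hamiltonian system *)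

Section Forward.
Variables (c0 : chart R n M) (p : M) (w : 'rV[R]_n) (gamma : R -> M).
Hypotheses (Ac0 : A c0) (c0p : chart_dom c0 p) (Lg : L_geodesic A T g c0 p w gamma).

Definition dcurve (gamma : R -> M) c : R -> 'rV[R]_n := derive_within I0T (chart_map c \o gamma).
Definition sigma_of (gamma : R -> M) (s : R) : M := gamma (s ^+ 2).
(* The momentum y G in the parameter s = sqrt t, with y = 2 s X; at s = 0 it is the limit 2 w G in the chart c0,
   transported to c. *)
Definition xi_of c0 p w (gamma : R -> M) c (s : R) : 'rV[R]_n :=
  if 0 < s then ((2 * s) *: dcurve gamma c (s ^+ 2)) *m g c (s ^+ 2) (chart_map c (gamma (s ^+ 2)))
  else ((2 *: w) *m g c0 0 (chart_map c0 p)) *m (jac (trans c c0) (chart_map c p))^T.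
Local Notation Xv := (dcurve gamma).
Local Notation sg := (sigma_of gamma).
Local Notation xi := (xi_of c0 p w gamma).

Lemma gamma_cvg t : 0 <= t <= T -> gamma u @[u --> W0 T t] --> gamma t.
Proof. by move=> tT; case: Lg => /subspace_continuousP cg _ _ _; apply: cg; rewrite /= in_itv. Qed.

Lemma sigma_cvg (s : R) : 0 <= s <= S -> sg u @[u --> W0 S s] --> sg s.
Proof.
move=> sS Q /(gamma_cvg (sqr_time sS)) HQ.
have HQ' : \forall t \near s ^+ 2, `[0, T]%classic t -> Q (gamma t) by exact: HQ.
have := sqr_cvg HQ' => HQ2.
have HQ3 : \forall u \near s, `[0, T]%classic (u ^+ 2) -> Q (gamma (u ^+ 2)) by exact: HQ2.
have : \forall u \near s, `[0, S]%classic u -> Q (sg u).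
  by apply: filterS HQ3 => u Hu; rewrite /= in_itv /= => uS; apply: Hu; rewrite /= in_itv; exact: sqr_time.
by [].
Qed.

(** At t0 = T smoothness means a smooth extension F beyond T. The one-sided derivatives in the
    definition of an L-geodesic are the ordinary derivatives of F. *)
Lemma local_curve c t0 : A c -> 0 < t0 <= T -> chart_dom c (gamma t0) ->
  exists (F F1 F2 : R -> 'rV[R]_n) (d : R), [/\ 0 < d,
    forall t, `|t - t0| < d -> is_derive t 1 F (F1 t) /\ is_derive t 1 F1 (F2 t) &
    forall t, `|t - t0| < d -> 0 < t <= T -> [/\ chart_dom c (gamma t), chart_map c (gamma t) = F t,
      Xv c t = F1 t & derive_within I0T (Xv c) t = F2 t]].
Proof.
move=> Ac t0T ct0; have [_ _ /(_ c Ac)[sm _] _] := Lg.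
have [U [F [oU Ut0 CF HF]]] := sm t0 (conj t0T ct0).
have n1 : \forall u \near t0, U u by apply: open_nbhs_nbhs.
have t0T' : 0 <= t0 <= T by case/andP: t0T => a b; rewrite (ltW a) b.
have n2 : \forall u \near t0, `[0, T]%classic u -> chart_dom c (gamma u).
  have : nbhs (gamma t0) (chart_dom c) by apply: open_nbhs_nbhs; split=> //; exact: chart_dom_open.
  exact: gamma_cvg t0T' _.
have [d d0 Hd] := near_realE (filterI n1 n2).
have [F1 [F2 dFF]] := Ck2_derivatives (CF 2%N).
have dF t : `|t - t0| < d -> is_derive t 1 F (F1 t) by case/Hd => Ut _; have [] := dFF t Ut.
have dF1 t : `|t - t0| < d -> is_derive t 1 F1 (F2 t) by case/Hd => Ut _; have [] := dFF t Ut.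
have dom t : `|t - t0| < d -> 0 < t <= T -> chart_dom c (gamma t).
  by case/Hd => _ H1 /andP[a b]; apply: H1; rewrite /= in_itv /= (ltW a).
have map t : `|t - t0| < d -> 0 < t <= T -> chart_map c (gamma t) = F t.
  by move=> td tT; apply: HF; [have [] := Hd _ td|split=> //; exact: dom].
have nbr t : `|t - t0| < d -> exists2 e : R, 0 < e & forall u : R, `|u - t| < e -> `|u - t0| < d.
  move=> td; exists (d - `|t - t0|); first by rewrite subr_gt0.
  by move=> u ue; rewrite -(subrKA t) (le_lt_trans (ler_normD _ _)) // -ltrBrDr.
have acc t : 0 < t <= T -> forall d : R, 0 < d -> exists u : R, [/\ u != t, `|u - t| < d & I0T u].
  move=> /andP[a b]; apply: (@limit_point_itv R 0 T t) => //; first by rewrite ltW.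
  by move=> u /andP[u0 uT]; rewrite /= in_itv /= u0 ltW.
have X1 t : `|t - t0| < d -> 0 < t <= T -> Xv c t = F1 t.
  move=> td tT; apply: (derive_withinE (F := F) _ _ (dF t td) (acc t tT)); last by rewrite /= in_itv.
  have [e e0 He] := nbr _ td; exists e => // u ue; rewrite /= in_itv /= => uT.
  by apply: map => //; exact: He.
exists F, F1, F2, d; split=> //; first by move=> t td; split; [exact: dF|exact: dF1].
move=> t td tT; split; [exact: dom|exact: map|exact: X1|].
apply: (derive_withinE (F := F1) _ _ (dF1 t td) (acc t tT)); last by rewrite /= in_itv.
have [e e0 He] := nbr _ td; exists e => // u ue; rewrite /= in_itv /= => uT.
by apply: X1 => //; exact: He.
Qed.

Lemma dcurve_change c c' t : A c -> A c' -> 0 < t <= T -> chart_dom c (gamma t) -> chart_dom c' (gamma t) ->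
  Xv c' t = Xv c t *m jac (trans c c') (chart_map c (gamma t)).
Proof.
move=> Ac Ac' tT ct c't; have [F [F1 [F2 [d [d0 dF HF]]]]] := local_curve Ac tT ct.
have tt : `|t - t| < d by rewrite subrr normr0.
have [_ mt Xt _] := HF _ tt tT; have [d1 _] := dF _ tt.
have ov : overlap c c' (F t) by rewrite -mt; exact: overlap_mem.
have D := is_derive_vf_chain (@overlap_open R n M c c') ov (fun j => Ck_trans hM 1 j Ac Ac') d1.
rewrite Xt mt; apply: (derive_withinE (F := fun u => vf (trans c c') (F u)) _ _ D).
- have t0T' : 0 <= t <= T by case/andP: tT => a b; rewrite (ltW a) b.
  have n2 : \forall u \near t, `[0, T]%classic u -> chart_dom c' (gamma u).
    have : nbhs (gamma t) (chart_dom c') by apply: open_nbhs_nbhs; split=> //; exact: chart_dom_open.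
    exact: gamma_cvg t0T' _.
  have [e e0 He] := near_realE n2; exists (Num.min d e); first by rewrite lt_min d0.
  move=> u; rewrite lt_min => /andP[ud ue]; rewrite /= in_itv /= => uT.
  have [cu mu _ _] := HF _ ud uT; have c'u : chart_dom c' (gamma u).
    by apply: He => //; case/andP: uT => a b; rewrite /= in_itv /= (ltW a).
  by rewrite -mu; apply/esym; exact: row_trans.
- by rewrite /= in_itv.
- case/andP: tT => a b; apply: (@limit_point_itv R 0 T t) => //; first by rewrite ltW.
  by move=> u /andP[u0 uT]; rewrite /= in_itv /= u0 ltW.
Qed.

Lemma xi_cov c c' s : 0 <= s <= S -> A c -> A c' -> chart_dom c (sg s) -> chart_dom c' (sg s) ->
  xi c s = xi c' s *m (jac (trans c c') (chart_map c (sg s)))^T.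
Proof.
move=> sS Ac Ac' cs c's; rewrite /xi_of; case: ifPn => s0.
  have sT : 0 < s ^+ 2 <= T by apply: sqr_time_pos; rewrite s0; case/andP: sS.
  rewrite (metric_change hflow hM Ac Ac' (sqr_time sS) cs c's) (dcurve_change Ac Ac' sT cs c's) -/(sg s).
  by rewrite scalemxAl !mulmxA.
have s00 : s = 0 by apply/le_anti; rewrite leNgt s0; case/andP: sS => ->.
have [_ g0 _ _] := Lg.
have sp : sg s = p by rewrite /sigma_of s00 expr0n.
by rewrite sp in cs c's *; rewrite -[RHS]mulmxA -trmx_mul (jac_chain hM).
Qed.

Lemma local_state c s0 : A c -> 0 < s0 <= S -> chart_dom c (sg s0) ->
  exists W E (F F1 F2 : R -> 'rV[R]_n) (d : R), [/\ metric_model T g c W E, 0 < d,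
    forall s : R, `|s - s0| < d -> [/\ is_derive (s ^+ 2) 1 F (F1 (s ^+ 2)), is_derive (s ^+ 2) 1 F1 (F2 (s ^+ 2))
      & W (tx (s ^+ 2) (F (s ^+ 2)))] &
    forall s : R, `|s - s0| < d -> 0 < s <= S -> [/\ chart_dom c (sg s),
      st c sg xi s = mk (const_mx s) (F (s ^+ 2)) (momentum E F F1 s),
      Xv c (s ^+ 2) = F1 (s ^+ 2) & L_operator c (s ^+ 2) (F (s ^+ 2)) (F1 (s ^+ 2)) (F2 (s ^+ 2)) = 0]].
Proof.
move=> Ac s0S cs0; have t0T := sqr_time_pos s0S.
have t0T' : 0 <= s0 ^+ 2 <= T by case/andP: t0T => a b; rewrite (ltW a) b.
have [F [F1 [F2 [d [d0 dF HF]]]]] := local_curve Ac t0T cs0.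
have tt : `|s0 ^+ 2 - s0 ^+ 2| < d by rewrite subrr normr0.
have [_ m0 _ _] := HF _ tt t0T; have [[dF0 _] _] := dF _ tt.
have [W [E [mm Wy]]] := metric_model_exists hflow Ac t0T' (map_image cs0).
rewrite [chart_map _ _]m0 in Wy.
have n1 : \forall s \near s0, `|s ^+ 2 - s0 ^+ 2| < d.
  have := sqr_cvg (s := s0); move/cvgrPdist_lt/(_ _ d0); apply: filterS => u; by rewrite distrC.
have n2 : \forall s \near s0, W (tx (s ^+ 2) (F (s ^+ 2))).
  apply: (@tx_near R n _ W (nbhs s0) _ (fun s : R => s ^+ 2) (fun s : R => F (s ^+ 2)) _ _ (mm_open mm) Wy); first exact: sqr_cvg.
  apply: (cvg_comp (fun s : R => s ^+ 2) F); first exact: sqr_cvg.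
  by move/derivable1_diffP: dF0 => /differentiable_continuous.
have [e e0 He] := near_realE (filterI n1 n2).
exists W, E, F, F1, F2, e; split; [exact: mm|exact: e0| |].
  by move=> s /He[sd Ws]; have [D1 D2] := dF _ sd; split; [exact: D1|exact: D2|exact: Ws].
move=> s /He[sd Ws] sS; have sT := sqr_time_pos sS.
have sT' : 0 <= s ^+ 2 <= T by case/andP: sT => a b; rewrite (ltW a) b.
have [ct mt Xt Xt2] := HF _ sd sT; split; [exact: ct| |exact: Xt|].
- rewrite /st /xi_of; case/andP: (sS) => -> _ /=; rewrite mt Xt (mm_eq mm sT' Ws).
  by [].
- have [_ _ Lg3 _] := Lg; have [_ ode] := Lg3 c Ac.
  have ode2 : L_operator c (s ^+ 2) (chart_map c (gamma (s ^+ 2))) (Xv c (s ^+ 2))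
    (derive_within I0T (Xv c) (s ^+ 2)) = 0 := ode _ (conj sT ct).
  by rewrite mt Xt2 Xt in ode2.
Qed.

Lemma xi_start : xi c0 0 = (2 *: w) *m g c0 0 (chart_map c0 p).
Proof. by rewrite /xi_of ltxx jac_id // trmx1 mulmx1. Qed.

Lemma sg0 : sg 0 = p.
Proof. by have [_ g0 _ _] := Lg; rewrite /sigma_of expr0n. Qed.

(** With t = s^2 the initial condition becomes s X(s^2) -> w, so the momentum 2 s X G has a limit at
    s = 0 although X itself may be unbounded. *)
Lemma momentum_start : (2 * s *: dcurve gamma c0 (s ^+ 2)) *m g c0 (s ^+ 2) (chart_map c0 (sg s))
  @[s --> within `]0, S]%classic (nbhs (0 : R))] --> xi c0 0.
Proof.
have S0 : 0 < S by rewrite sqrtr_gt0.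
have T00 : 0 <= (0 : R) <= T by rewrite lexx ltW.
have S00 : 0 <= (0 : R) <= S by rewrite lexx ltW.
pose Fi := within `]0, S]%classic (nbhs (0 : R)).
have FFi : Filter Fi by exact: within_filter.
have cv : s *: dcurve gamma c0 (s ^+ 2) @[s --> Fi] --> w.
  have [_ _ _ lim] := Lg; move=> Q /lim HQ.
  have HQ' : \forall t \near (0 : R), 0 < t -> Q (Num.sqrt t *: dcurve gamma c0 t) by exact: HQ.
  have HQ2 : \forall s \near (0 : R), 0 < s ^+ 2 -> Q (Num.sqrt (s ^+ 2) *: dcurve gamma c0 (s ^+ 2)).
    have := sqr_cvg (s := 0); rewrite expr0n /= => C; exact: C _ HQ'.
  have : \forall s \near (0 : R), `]0, S]%classic s -> Q (s *: dcurve gamma c0 (s ^+ 2)).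
    apply: filterS HQ2 => s Hs; rewrite /= in_itv /= => /andP[s0 _].
    by have := Hs (exprn_gt0 2 s0); rewrite sqrtr_sqr gtr0_norm.
  by [].
have [W [E [mm Wy]]] := metric_model_exists hflow Ac0 T00 (map_image c0p).
have cs : s ^+ 2 @[s --> Fi] --> (0 : R).
  have := sqr_cvg (s := 0); rewrite expr0n /= => C; exact: cvg_within_filter.
have sgF : sg s @[s --> Fi] --> p.
  rewrite -sg0; move=> Q /(sigma_cvg S00) HQ.
  have HQ' : \forall s \near (0 : R), `[0, S]%classic s -> Q (sg s) by exact: HQ.
  have : \forall s \near (0 : R), `]0, S]%classic s -> Q (sg s).
    apply: filterS HQ' => s Hs; rewrite /= in_itv /= => /andP[s0 sS]; apply: Hs.
    by rewrite /= in_itv /= (ltW s0).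
  by [].
have cm : chart_map c0 (sg s) @[s --> Fi] --> chart_map c0 p.
  by apply: (cvg_comp sg (chart_map c0)); [exact: sgF|exact: chart_map_continuous].
have cy : tx (s ^+ 2) (chart_map c0 (sg s)) @[s --> Fi] --> tx 0 (chart_map c0 p).
  apply/cvg_mxP => i j; rewrite (ord1 i); elim/time_space_ind: j => [|k].
    by rewrite tx_time; under eq_fun do rewrite tx_time.
  rewrite tx_space; under eq_fun do rewrite tx_space.
  exact: (iffLR (cvg_mxP _ _ _) cm).
have cE : E (tx (s ^+ 2) (chart_map c0 (sg s))) @[s --> Fi] --> E (tx 0 (chart_map c0 p)).
  apply: (cvg_comp _ E cy); apply/(@cvg_mxP _ _ (nbhs (tx 0 (chart_map c0 p)))) => i j.
  exact: (Ck_continuous (mm_smooth mm 0 i j) Wy).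
have nW : \forall s \near Fi, W (tx (s ^+ 2) (chart_map c0 (sg s))).
  by apply: cy; apply: open_nbhs_nbhs; split=> //; exact: mm_open mm.
have nI : \forall s \near Fi, 0 < s <= S.
  have : \forall s \near (0 : R), `]0, S]%classic s -> 0 < s <= S by near=> s; rewrite /= in_itv.
  by [].
rewrite xi_start (mm_eq mm T00 Wy).
have lim : (2 *: (s *: dcurve gamma c0 (s ^+ 2))) *m E (tx (s ^+ 2) (chart_map c0 (sg s))) @[s --> Fi]
    --> (2 *: w) *m E (tx 0 (chart_map c0 p)).
  have cv2 : 2 *: (s *: dcurve gamma c0 (s ^+ 2)) @[s --> Fi] --> 2 *: w by apply: cvgZl_tmp; exact: cv.
  exact: cvg_mulmx cv2 cE.
move: lim; apply: cvg_trans; apply: near_eq_cvg.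
apply: filterS (filterI nW nI) => s [Ws /andP[s0 sS]].
rewrite (mm_eq mm _ Ws) ?scalerA //; apply: sqr_time; by rewrite (ltW s0).
Unshelve. all: by end_near. Qed.

Lemma xi_cvg0 : xi c0 s @[s --> W0 S 0] --> xi c0 0.
Proof.
move=> Q HQ; have := momentum_start HQ => H1.
have H2 : \forall s \near (0 : R), `]0, S]%classic s ->
    Q ((2 * s *: dcurve gamma c0 (s ^+ 2)) *m g c0 (s ^+ 2) (chart_map c0 (sg s))) by exact: H1.
have : \forall s \near (0 : R), `[0, S]%classic s -> Q (xi c0 s).
  apply: filterS H2 => s Hs; rewrite /= in_itv /= => /andP[s0 sS].
  have [s0'|s0'] := ltP 0 s; last first.
    by have -> : s = 0; [apply/le_anti; rewrite s0 s0'|exact: nbhs_singleton HQ].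
  rewrite /xi_of s0'; apply: Hs; by rewrite /= in_itv /= s0'.
by [].
Qed.

(** The initial condition is a limit in the chart c0 alone; in another chart continuity at 0 follows
    by transport with the Jacobian, which is continuous along the curve. *)
Lemma st_cvg0 c : A c -> chart_dom c (sg 0) -> st c sg xi s @[s --> W0 S 0] --> st c sg xi 0.
Proof.
have S0 : 0 < S by rewrite sqrtr_gt0.
have S00 : 0 <= (0 : R) <= S by rewrite lexx ltW.
move=> Ac cs; have c0s : chart_dom c0 (sg 0) by rewrite sg0.
have sgF := sigma_cvg S00.
have cm : chart_map c (sg s) @[s --> W0 S 0] --> chart_map c (sg 0).
  by apply: (cvg_comp sg (chart_map c)); [exact: sgF|exact: chart_map_continuous].
have ov : overlap c c0 (chart_map c (sg 0)) by exact: overlap_mem.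
have cJ : (jac (trans c c0) (chart_map c (sg s)))^T @[s --> W0 S 0] --> (jac (trans c c0) (chart_map c (sg 0)))^T.
  apply: (cvg_comp (fun s => chart_map c (sg s)) (fun x => (jac (trans c c0) x)^T) cm).
  apply/(@cvg_mxP _ _ (nbhs (chart_map c (sg 0)))) => i j; rewrite trmx_entry jacE.
  under eq_fun do rewrite trmx_entry jacE.
  exact: (Ck_continuous (Ck_partial j (Ck_trans hM 1 i Ac Ac0)) ov).
have cxi : xi c s @[s --> W0 S 0] --> xi c 0.
  rewrite (xi_cov S00 Ac Ac0 cs c0s).
  have lim : xi c0 s *m (jac (trans c c0) (chart_map c (sg s)))^T @[s --> W0 S 0]
    --> xi c0 0 *m (jac (trans c c0) (chart_map c (sg 0)))^T by exact: cvg_mulmx xi_cvg0 cJ.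
  move: lim; apply: cvg_trans; apply: near_eq_cvg.
  have nd c' : chart_dom c' (sg 0) -> \forall s \near (0 : R), `[0, S]%classic s -> chart_dom c' (sg s).
    move=> c's; have : nbhs (sg 0) (chart_dom c') by apply: open_nbhs_nbhs; split=> //; exact: chart_dom_open.
    exact: sgF _.
  have : \forall s \near (0 : R), `[0, S]%classic s ->
      xi c0 s *m (jac (trans c c0) (chart_map c (sg s)))^T = xi c s.
    apply: filterS (filterI (nd c cs) (nd c0 c0s)) => s [n1 n2] sS.
    have sS' : 0 <= s <= S by move: sS; rewrite /= in_itv.
    by apply/esym; apply: (xi_cov sS' Ac Ac0 (n1 sS) (n2 sS)).
  by [].
have FF : Filter (W0 S (0 : R)) by exact: within_filter.
apply/cvg_mxP => i j; rewrite (ord1 i); elim/state_ind: j => [|k|k].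
- rewrite st_tm; under eq_fun do rewrite st_tm.
  by apply: cvg_within_filter; exact: cvg_id.
- rewrite -xpE st_xp; under eq_fun do rewrite -xpE st_xp.
  exact: (iffLR (cvg_mxP _ _ _) cm).
- rewrite -mpE st_mp; under eq_fun do rewrite -mpE st_mp.
  exact: (iffLR (cvg_mxP _ _ _) cxi).
Qed.

Lemma state_curve c (r : R) : A c -> 0 < r <= S -> chart_dom c (sg r) -> exists (z : R -> 'rV[R]_N) (d : R),
  [/\ 0 < d, is_derive r 1 z (hfield H c (z r)) & forall s : R, `|s - r| < d -> 0 < s <= S -> st c sg xi s = z s].
Proof.
move=> Ac rS cr; have [W [E [F [F1 [F2 [d [mm d0 dF HF]]]]]]] := local_state Ac rS cr.
exists (fun s => mk (const_mx s) (F (s ^+ 2)) (momentum E F F1 s)), d.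
have rr : `|r - r| < d by rewrite subrr normr0.
have [dr dr1 Wr] := dF _ rr; have [_ _ _ L0] := HF _ rr rS.
have rS' : 0 <= r <= S by case/andP: rS => a b; rewrite (ltW a) b.
have r0 : r != 0 by rewrite gt_eqF //; case/andP: rS.
split; [exact: d0| |by move=> s sd sS; have [] := HF _ sd sS].
rewrite (hfield_momentum Ac mm F1 Wr rS').
apply: (is_derive_state (is_derive_id r 1) (is_derive_position dr)).
have D := is_derive_momentum mm dr dr1 Wr.
(* The L-geodesic equation annihilates the operator term, and what remains is Hamilton's equation
   for the momentum. *)
by rewrite (dmomentumE Ac mm F1 F2 Wr r0 (sqr_time rS')) L0 mul0mx scaler0 add0r in D.
Qed.

Lemma geodesic_phase : phase A H 0 S sg xi.
Proof.
move=> r rS; split.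
- exact: sigma_cvg.
- move=> c Ac cr; have [r0|r0] := ltP 0 r; last first.
    have r00 : r = 0 by apply/le_anti; rewrite r0; case/andP: rS => ->.
    by rewrite r00 in cr *; exact: st_cvg0.
  have rS' : 0 < r <= S by rewrite r0; case/andP: rS.
  have [z [d [d0 [dz _] Hz]]] := state_curve Ac rS' cr.
  have rr : `|r - r| < d by rewrite subrr normr0.
  rewrite (Hz _ rr rS').
  have cz : z s @[s --> W0 S r] --> z r.
    by apply: cvg_within_filter; move/derivable1_diffP: dz => /differentiable_continuous.
  move: cz; apply: cvg_trans; apply: near_eq_cvg.
  have : \forall s \near r, `[0, S]%classic s -> z s = st c sg xi s.
    apply: near_realI; exists (Num.min d r); first by rewrite lt_min d0.
    move=> s; rewrite lt_min => /andP[sd]; rewrite ltr_norml => /andP[s1 _].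
    rewrite /= in_itv /= => /andP[_ sS]; rewrite Hz //.
    by rewrite sS andbT; move: s1; rewrite ltrBrDl subrr.
  by [].
- move=> c Ac cr /andP[r0 rS2]; have rS' : 0 < r <= S by rewrite r0 ltW.
  have [z [d [d0 dz Hz]]] := state_curve Ac rS' cr.
  have rr : `|r - r| < d by rewrite subrr normr0.
  rewrite (Hz _ rr rS'); apply: near_eq_is_derive dz.
  apply: near_realI; exists (Num.min d (Num.min r (S - r))); first by rewrite !lt_min d0 r0 subr_gt0.
  move=> s; rewrite !lt_min => /and3P[sd]; rewrite !ltr_norml => /andP[s1 _] /andP[_ s2].
  rewrite Hz //; apply/andP; split; lra.
- by move=> c c' Ac Ac' cr c'r; exact: xi_cov.
Qed.

End Forward.

(** The equation in t is singular at 0, but both geodesics lift to solutions of the regular system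
    in s with the same state at s = 0. *)
Lemma geodesic_unique c0 p w gamma gamma' t : A c0 -> chart_dom c0 p ->
  L_geodesic A T g c0 p w gamma -> L_geodesic A T g c0 p w gamma' -> 0 <= t <= T -> gamma t = gamma' t.
Proof.
move=> Ac0 c0p L L' tT; have S0 : 0 < S by rewrite sqrtr_gt0.
have in0 : 0 <= (0 : R) <= S by rewrite lexx ltW.
have int : 0 <= Num.sqrt t <= S.
  by case/andP: tT => t0 tT'; rewrite sqrtr_ge0 ler_wsqrtr.
have P := geodesic_phase Ac0 c0p L; have P' := geodesic_phase Ac0 c0p L'.
have Ag : agree A (sigma_of gamma) (xi_of c0 p w gamma) (sigma_of gamma') (xi_of c0 p w gamma') 0.
  by split=> [|c Ac cs]; [rewrite (sg0 L) (sg0 L')|rewrite /xi_of ltxx].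
have [E _] := phase_unique hM (L_ham_smooth T0 hflow) P P' (lexx 0) (lexx S) in0 int Ag.
by move: E; rewrite /sigma_of sqr_sqrtr //; case/andP: tT.
Qed.

End Geodesics.

Lemma is_derive_dir (R : realType) (V : normedModType R) (f : R -> V) (t v : R) l :
  is_derive t 1 f l -> is_derive t v f (v *: l).
Proof.
move=> [d1 d2]; have df : differentiable f t by apply/derivable1_diffP.
apply: DeriveDef; first exact: diff_derivable.
by rewrite (deriveE _ df) -d2 (deriveE _ df) -linearZ /= [v *: 1]mulr1.
Qed.

(** Bootstrapping: if w is of class C^k, then so is its derivative [vf f (w t)], hence w is of class
    C^(k+1). *)
Lemma Ck_solution (R : realType) m (I : set R^o) (Om : set 'rV[R]_m) (f : 'I_m -> 'rV[R]_m -> R) (w : R^o -> 'rV[R]_m) k :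
  open I -> open Om -> (forall k j, Ck k Om (f j)) ->
  (forall t : R, I t -> Om (w t) /\ is_derive t 1 (w : R -> 'rV[R]_m) (vf f (w t))) -> Ck k I w.
Proof.
move=> oI oO Cf sol; have C0 : forall x, I x -> {for x, continuous w}.
  move=> t It; have [_ [d1 _]] := sol t It.
  by move/derivable1_diffP: d1 => /differentiable_continuous.
elim: k => [//|k IH].
have dw (t v : R) : I t -> is_derive t v (w : R -> 'rV[R]_m) (v *: vf f (w t)).
  by move=> It; apply: is_derive_dir; have [_] := sol t It.
split=> [//|t v It|v]; first by have [d1 _] := dw t v It.
apply: (Ck_ext oI (f := fun t => v *: vf f (w t))).
  by move=> t It; have [_ d2] := dw t v It; rewrite d2.
apply: Ck_mx => // i j; rewrite (ord1 i).
have -> : (fun t => (v *: vf f (w t)) 0 j) = (fun t => v * f j (w t)).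
  by apply/funext => t; rewrite scalemx_entry vfE.
apply: (CkM oI (Ck_cst k I (v : R))); apply: (Ck_comp oI oO _ _ (Cf k j)).
  by move=> t /sol[].
by move=> i'; exact: Ck_entry.
Qed.

(** * From a solution of the Hamiltonian system to an L-geodesic *)

Section Backward.
Variables (R : realType) (n : nat) (M : topologicalType) (A : set (chart R n M)) (T : R).
Variable g : tensor_family R n M.
Hypotheses (hM : smooth_manifold A) (T0 : 0 < T) (hflow : backwards_ricci_flow A T g).
Local Notation N := (1 + (n + n))%N.
Local Notation S := (Num.sqrt T).
Local Notation H := (L_ham g).
Local Notation I0T := (`]0, T]%classic : set R).
Variables (c0 : chart R n M) (p : M) (w : 'rV[R]_n) (sigma : R -> M) (xi : chart R n M -> R -> 'rV[R]_n).
Hypotheses (Ac0 : A c0) (c0p : chart_dom c0 p) (P : phase A H 0 S sigma xi) (sigma0 : sigma 0 = p)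
  (xi0 : xi c0 0 = (2 *: w) *m g c0 0 (chart_map c0 p)).
Implicit Types (c : chart R n M) (t s : R).
Let Hsm := L_ham_smooth T0 hflow.
Let Htr := L_ham_transfer T0 hflow hM.

Definition gamma_of t : M := sigma (Num.sqrt t).
Local Notation gm := gamma_of.

Lemma sqrt_time t : 0 <= t <= T -> 0 <= Num.sqrt t <= S.
Proof. by case/andP=> t0 tT; rewrite sqrtr_ge0 ler_wsqrtr. Qed.

Lemma sqrt_time_pos t : 0 < t <= T -> 0 < Num.sqrt t <= S.
Proof. by case/andP=> t0 tT; rewrite sqrtr_gt0 t0 ler_wsqrtr. Qed.

Lemma hfield_xp c s : A c -> 0 <= s <= S -> chart_dom c (sigma s) ->
  xp (hfield H c (st c sigma xi s)) = xi c s *m invmx (g c (s ^+ 2) (chart_map c (sigma s))).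
Proof.
move=> Ac sS cs; have tT := sqr_time T0 sS.
have [W [E [mm Wy]]] := metric_model_exists hflow Ac tT (map_image cs).
have zY : sx (st c sigma xi s) = tx (s ^+ 2) (chart_map c (sigma s)) by rewrite /sx st_tm st_xp.
rewrite (hfieldE T0 hflow Ac mm); first by rewrite xp_mk /velocity zY st_mp (mm_eq mm tT Wy).
  by rewrite /slab st_tm.
by rewrite /model_dom /= zY.
Qed.

Lemma smooth_curve c t0 : A c -> 0 < t0 <= T -> chart_dom c (gm t0) ->
  exists (I : set R^o) (F : R^o -> 'rV[R]_n) (psi : R -> 'rV[R]_N), [/\ open I, I t0, forall k, Ck k I F,
    forall t, I t -> 0 < t <= T -> [/\ chart_dom c (gm t), chart_map c (gm t) = F t &
      is_derive t 1 (F : R -> 'rV[R]_n) ((2 * Num.sqrt t)^-1 *: (xi c (Num.sqrt t) *m invmx (g c t (F t))))] &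
    is_derive (Num.sqrt t0) 1 psi (hfield H c (st c sigma xi (Num.sqrt t0))) /\
    forall s, I (s ^+ 2) -> 0 < s <= S -> psi s = st c sigma xi s].
Proof.
move=> Ac t0T ct0; set s0 := Num.sqrt t0; have s0S := sqrt_time_pos t0T; rewrite -/s0 in s0S.
have s0S' : 0 <= s0 <= S by case/andP: s0S => a b; rewrite (ltW a).
have sl : slab S (st c sigma xi s0) by rewrite /slab st_tm.
have xc : chart_image c (xp (st c sigma xi s0)) by rewrite st_xp; exact: map_image.
have [U [K [d [del [C L]]]]] := local_model_exists Hsm Ac sl xc.
have d0 := fb_d (lm_box L); have del0 := fb_del (lm_box L).
have z4 : `|st c sigma xi s0 - st c sigma xi s0| < d / 4 by rewrite subrr normr0 divr_gt0.
have [psi [psi0 sol Es]] := flow_is_phase hM Hsm Htr P (lexx 0) (lexx S) Ac L s0S' ct0 z4.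
pose I : set R^o := [set t | 0 < t /\ `|Num.sqrt t - s0| < del].
have oI : open I.
  apply: openI; first exact: open_gt.
  have cf : continuous (fun t : R => `|Num.sqrt t - s0|).
    move=> t; apply: cvg_norm; apply: cvgB; [exact: sqrt_continuous|exact: cvg_cst].
  by apply: (open_comp (f := fun t : R => `|Num.sqrt t - s0|) (D := [set x | x < del])); [move=> t _; exact: cf|exact: open_lt].
pose wt (t : R^o) : 'rV[R]_N := psi (Num.sqrt t - s0).
have wtm t : I t -> wt t 0 i0 = Num.sqrt t.
  by case=> _ td; rewrite /wt (solves_time sol td) psi0 st_tm addrC subrK.
pose Om : set 'rV[R]_N := [set z | U z /\ z 0 i0 != 0].
have oO : open Om by apply: open_neq0; [exact: lm_open L|move=> z _; exact: coord_continuous].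
(* In the parameter t the field is divided by 2 s. Since the time coordinate of the state is s
   itself, the rescaled system is again autonomous, and smooth where that coordinate is nonzero, so
   [Ck_solution] gives smoothness in t. *)
pose f2 (j : 'I_N) (z : 'rV[R]_N) : R := (2 * z 0 i0)^-1 * hf K j z.
have Cf2 k j : Ck k Om (f2 j).
  apply: CkM => //.
    apply: CkV => //; first by move=> z [_ z0]; rewrite mulf_neq0 // pnatr_eq0.
    by apply: (CkM oO (Ck_cst k Om (2 : R))); exact: Ck_coord.
  by apply: (@Ck_sub _ _ _ k U); [move=> z []|apply: Ck_hf; [exact: lm_open L|exact: lm_smooth L k.+1]].
have dwt t : I t -> is_derive t 1 (wt : R -> 'rV[R]_N) ((2 * Num.sqrt t)^-1 *: vf (hf K) (wt t)).
  case=> t00 td; have [_ D] := sol _ td.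
  have ds : is_derive t 1 (fun t : R => Num.sqrt t - s0) (2 * Num.sqrt t)^-1.
    have := is_deriveB (is_derive1_sqrt t00) (is_derive_cst s0 t 1); by rewrite subr0.
  exact: (@is_derive_comp1 _ _ _ psi (fun t : R => Num.sqrt t - s0) t 1 _ _ D ds).
have solw t : I t -> Om (wt t) /\ is_derive t 1 (wt : R -> 'rV[R]_N) (vf f2 (wt t)).
  move=> It; have [t00 td] := It; have [zd _] := sol _ td; split.
    by split; [exact: fb_sub (lm_box L) _ zd|rewrite wtm // gt_eqF // sqrtr_gt0].
  have -> : vf f2 (wt t) = (2 * Num.sqrt t)^-1 *: vf (hf K) (wt t).
    by apply/rowP => j; rewrite vfE scalemx_entry vfE /f2 wtm.
  exact: dwt.
have Cwt k : Ck k I wt by exact: Ck_solution oI oO Cf2 solw.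
have It0 : I t0 by split; [case/andP: t0T|rewrite subrr normr0].
have stw t : I t -> 0 < t <= T -> chart_dom c (gm t) /\ st c sigma xi (Num.sqrt t) = wt t.
  move=> [_ td] tT; apply: Es => //; have := sqrt_time_pos tT; by case/andP=> a b; rewrite (ltW a).
exists I, (fun t => xp (wt t)), (fun s => psi (s - s0)); split.
- exact: oI.
- exact: It0.
- move=> k; apply: Ck_mx => // i j; rewrite (ord1 i).
  have -> : (fun t => xp (wt t) 0 j) = (fun t => wt t 0 (ix j)) by apply/funext => t; rewrite xpE.
  exact: Ck_entry.
- move=> t It tT; have [ct et] := stw t It tT; have xE : chart_map c (gm t) = xp (wt t) by rewrite -et st_xp.
  split; [exact: ct|exact: xE|].
  have tT' : 0 <= t <= T by case/andP: tT => a b; rewrite (ltW a).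
  have := is_derive_xp_curve (dwt t It).
  have -> : xp ((2 * Num.sqrt t)^-1 *: vf (hf K) (wt t)) = (2 * Num.sqrt t)^-1 *: xp (vf (hf K) (wt t)).
    by apply/matrixP => i j; rewrite xpE !scalemx_entry xpE.
  rewrite -(model_field L); first last.
  + by rewrite -et /slab st_tm; exact: sqrt_time.
  + by have [[]] := solw t It.
  rewrite -et hfield_xp //; last exact: sqrt_time.
  by rewrite sqr_sqrtr ?st_xp //; case/andP: tT'.
split.
  have zd : `|(0 : R)| < del by rewrite normr0.
  have [_ D] := sol _ zd.
  have -> : hfield H c (st c sigma xi s0) = vf (hf K) (psi 0).
    by rewrite psi0; apply: (model_field L) => //; exact: lm_mem L.
  by apply: is_derive_shift_real; rewrite subrr.
move=> s [sp sd] sS; have s_0 : 0 < s by case/andP: sS.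
move: sd; rewrite sqrtr_sqr (gtr0_norm s_0) => sd.
have [|_ ->] // := Es s _ sd; by case/andP: sS => a b; rewrite (ltW a).
Qed.

Lemma acc_time t : 0 < t <= T -> forall d : R, 0 < d -> exists u : R, [/\ u != t, `|u - t| < d & I0T u].
Proof.
move=> /andP[a b]; apply: (@limit_point_itv R 0 T t) => //; first by rewrite ltW.
by move=> u /andP[u0 uT]; rewrite /= in_itv /= u0 ltW.
Qed.

Lemma near_open (I : set R^o) (t : R) : open I -> I t -> exists2 d : R, 0 < d & forall u : R, `|u - t| < d -> I u.
Proof. by move=> oI It; apply: near_realE; apply: open_nbhs_nbhs. Qed.

Lemma dcurve_velocity c t : A c -> 0 < t <= T -> chart_dom c (gm t) ->
  dcurve T gm c t = (2 * Num.sqrt t)^-1 *: (xi c (Num.sqrt t) *m invmx (g c t (chart_map c (gm t)))).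
Proof.
move=> Ac tT ct; have [I [F [psi [oI It _ HF _]]]] := smooth_curve Ac tT ct.
have [_ mt D] := HF t It tT; rewrite mt; apply: (derive_withinE _ _ D (acc_time tT)).
  have [d d0 Hd] := near_open oI It; exists d => // u /Hd Iu; rewrite /= in_itv /= => uT.
  by have [] := HF u Iu uT.
by rewrite /= in_itv.
Qed.

Lemma smooth_geodesic c t0 : A c -> 0 < t0 <= T -> chart_dom c (gm t0) ->
  L_operator g c t0 (chart_map c (gm t0)) (dcurve T gm c t0) (derive_within I0T (dcurve T gm c) t0) = 0.
Proof.
move=> Ac t0T ct0; have [I [F [psi [oI It CF HF [Dpsi Hpsi]]]]] := smooth_curve Ac t0T ct0.
have [F1 [F2 dF]] := Ck2_derivatives (CF 2%N).
have [d d0 Hd] := near_open oI It.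
have X1 t : I t -> 0 < t <= T -> dcurve T gm c t = F1 t.
  move=> It' tT; have [d1 _] := dF t It'; apply: (derive_withinE _ _ d1 (acc_time tT)).
    have [e e0 He] := near_open oI It'; exists e => // u /He Iu; rewrite /= in_itv /= => uT.
    by have [] := HF u Iu uT.
  by rewrite /= in_itv.
have X2 : derive_within I0T (dcurve T gm c) t0 = F2 t0.
  have [_ d2] := dF t0 It; apply: (derive_withinE _ _ d2 (acc_time t0T)).
    by exists d => // u /Hd Iu; rewrite /= in_itv /= => uT; exact: X1.
  by rewrite /= in_itv.
rewrite X2 (X1 t0 It t0T); have [_ m0 _] := HF t0 It t0T; rewrite m0.
have t0T' : 0 <= t0 <= T by case/andP: t0T => a b; rewrite (ltW a).
set s0 := Num.sqrt t0 in Dpsi; have s0S := sqrt_time_pos t0T; rewrite -/s0 in s0S.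
have s0S' : 0 <= s0 <= S by case/andP: s0S => a b; rewrite (ltW a).
have s02 : s0 ^+ 2 = t0 by rewrite sqr_sqrtr //; case/andP: t0T'.
have sgE s : 0 < s -> gm (s ^+ 2) = sigma s by move=> sp; rewrite /gamma_of sqrtr_sqr (gtr0_norm sp).
have [W [E [mm Wy]]] := metric_model_exists hflow Ac t0T' (map_image ct0).
rewrite m0 -s02 in Wy; rewrite -s02 in It *.
have [dF0 dF10] := dF _ It.
have cF : {for (s0 ^+ 2 : R), continuous F}.
  by case: dF0 => d1 _; move/derivable1_diffP: d1 => /differentiable_continuous.
have n1 : \forall s \near s0, I (s ^+ 2).
  have : nbhs (s0 ^+ 2 : R) I by apply: open_nbhs_nbhs.
  exact: sqr_cvg.
have n2 : \forall s \near s0, W (tx (s ^+ 2) (F (s ^+ 2))).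
  apply: (@tx_near R n _ W (nbhs s0) _ (fun s : R => s ^+ 2) (fun s : R => F (s ^+ 2)) _ _ (mm_open mm) Wy); first exact: sqr_cvg.
  by apply: (cvg_comp (fun s : R => s ^+ 2) F); first exact: sqr_cvg.
have [e e0 He] := near_realE (filterI n1 n2).
have momE s : `|s - s0| < e -> 0 < s <= S -> chart_map c (sigma s) = F (s ^+ 2) /\ momentum E F F1 s = xi c s.
  move=> /He[Is Ws] sS; have sT := sqr_time_pos T0 sS; have sp : 0 < s by case/andP: sS.
  have [cs ms D1] := HF _ Is sT; have [[_ D2] _] := dF _ Is.
  have sT' : 0 <= s ^+ 2 <= T by case/andP: sT => a b; rewrite (ltW a).
  rewrite sgE // in ms; split; first exact: ms.
  have F1E : F1 (s ^+ 2) = (2 * s)^-1 *: (xi c s *m invmx (E (tx (s ^+ 2) (F (s ^+ 2))))).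
    case: D1 => _; rewrite D2 => ->; rewrite sqrtr_sqr (gtr0_norm sp).
    by rewrite (mm_eq mm sT' Ws).
  rewrite /momentum F1E scalerA mulfV ?scale1r ?mulmxKV //; last by rewrite mulf_neq0 ?pnatr_eq0 // gt_eqF.
  exact: (mm_unit mm Ws).
have ss : `|s0 - s0| < e by rewrite subrr normr0.
have [ms0 mo0] := momE s0 ss s0S.
have stE : st c sigma xi s0 = mk (const_mx s0) (F (s0 ^+ 2)) (momentum E F F1 s0).
  by rewrite /st mo0 ms0.
have Dm := is_derive_momentum mm dF0 dF10 Wy.
(* The two expressions for the momentum agree for parameters in ]0, S] only. At s0 = S this is a
   one-sided neighbourhood, which still determines the derivative. *)
have key := is_derive_within_unique (S := `]0, S]%classic) _ _ _ Dm (is_derive_mp_curve Dpsi).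
have s00 : s0 != 0 by rewrite gt_eqF //; case/andP: s0S.
have uE := mm_unit mm Wy.
have E1 : dmomentum E F F1 F2 s0 = mp (hfield H c (st c sigma xi s0)).
  apply: key.
  - exists e => // s se; rewrite /= in_itv /= => sS; have [_ ->] := momE s se sS.
    by have [Is _] := He s se; rewrite (Hpsi s Is sS) st_mp.
  - by rewrite /= in_itv.
  - case/andP: s0S => a b; apply: (@limit_point_itv R 0 S s0) => //; rewrite ?(ltW a) // ?sqrtr_gt0 //.
    by move=> u /andP[u0 uS]; rewrite /= in_itv /= u0 ltW.
rewrite stE (hfield_momentum T0 hflow Ac mm F1 Wy s0S') mp_mk in E1.
rewrite (dmomentumE T0 hflow Ac mm F1 F2 Wy s00 (sqr_time T0 s0S')) in E1.
move/eqP: E1; rewrite -subr_eq0 addrK scaler_eq0 => /orP[|/eqP L0].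
  by rewrite mulf_eq0 pnatr_eq0 /= expf_eq0 (negbTE s00).
by rewrite -(mulmxK uE (L_operator _ _ _ _ _ _)) L0 mul0mx.
Qed.

Lemma phase_geodesic : L_geodesic A T g c0 p w gm.
Proof.
have S0 : 0 < S by rewrite sqrtr_gt0.
have in0 : 0 <= (0 : R) <= S by rewrite lexx ltW.
split.
- apply/subspace_continuousP => t; rewrite /= in_itv /= => tT.
  move=> Q /(phase_base (P (sqrt_time tT))) HQ.
  have HQ' : \forall s \near Num.sqrt t, `[0, S]%classic s -> Q (sigma s) by exact: HQ.
  have HQ2 : \forall u \near t, `[0, S]%classic (Num.sqrt u) -> Q (sigma (Num.sqrt u)) := @sqrt_continuous R t _ HQ'.
  have : \forall u \near t, `[0, T]%classic u -> Q (gm u).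
    apply: filterS HQ2 => u Hu; rewrite /= in_itv /= => uT; apply: Hu.
    by rewrite /= in_itv; exact: sqrt_time.
  by [].
- by rewrite /gamma_of sqrtr0.
- move=> c Ac x X Sx; split.
    move=> t0 [t0T ct0]; have [I [F [psi [oI It CF HF _]]]] := smooth_curve Ac t0T ct0.
    exists I, F; split=> // t It' [tT _]; by have [] := HF t It' tT.
  move=> t [tT ct]; exact: (smooth_geodesic Ac tT ct).
have S00 : 0 <= (0 : R) <= T by rewrite lexx ltW.
have c0s : chart_dom c0 (sigma 0) by rewrite sigma0.
have nI : \forall t \near (0 : R)^'+, 0 < t <= T.
  have : \forall t \near (0 : R), 0 < t -> 0 < t <= T.
    apply: near_realI; exists T => // t; rewrite subr0 => tT t0; rewrite t0 /= ltW //.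
    exact: le_lt_trans (ler_norm t) tT.
  by [].
have FG : Filter (0 : R)^'+ by exact: within_filter.
have cz : st c0 sigma xi (Num.sqrt t) @[t --> (0 : R)^'+] --> st c0 sigma xi 0.
  move=> Q /(phase_cvg (P in0) Ac0 c0s) HQ.
  have HQ' : \forall s \near Num.sqrt (0 : R), `[0, S]%classic s -> Q (st c0 sigma xi s) by rewrite sqrtr0; exact: HQ.
  have HQ2 : \forall u \near (0 : R), `[0, S]%classic (Num.sqrt u) -> Q (st c0 sigma xi (Num.sqrt u)) := @sqrt_continuous R 0 _ HQ'.
  have HQ3 : \forall u \near (0 : R)^'+, `[0, S]%classic (Num.sqrt u) -> Q (st c0 sigma xi (Num.sqrt u)).
    exact: cvg_within HQ2.
  apply: filterS (filterI HQ3 nI) => u [Hu /andP[u0 uT]]; apply: Hu.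
  by rewrite /= in_itv; apply: sqrt_time; rewrite (ltW u0).
have cx : chart_map c0 (gm t) @[t --> (0 : R)^'+] --> chart_map c0 p.
  rewrite -sigma0 -(st_xp c0 sigma xi 0); under eq_fun do rewrite -(st_xp c0 sigma xi).
  by apply: (cvg_comp _ (fun y : 'rV[R]_N => xp y) cz); exact: xp_continuous.
have cxi : xi c0 (Num.sqrt t) @[t --> (0 : R)^'+] --> xi c0 0.
  apply/cvg_mxP => i j; rewrite (ord1 i) -(st_mp c0 sigma xi 0) mpE.
  under eq_fun do rewrite -(st_mp c0 sigma xi) mpE.
  exact: (iffLR (cvg_mxP _ _ _) cz).
have [W [E [mm Wy]]] := metric_model_exists hflow Ac0 S00 (map_image c0p).
have cy : tx t (chart_map c0 (gm t)) @[t --> (0 : R)^'+] --> tx 0 (chart_map c0 p).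
  apply/cvg_mxP => i j; rewrite (ord1 i); elim/time_space_ind: j => [|k].
    by rewrite tx_time; under eq_fun do rewrite tx_time; apply: cvg_within_filter; exact: cvg_id.
  rewrite tx_space; under eq_fun do rewrite tx_space.
  exact: (iffLR (cvg_mxP _ _ _) cx).
have cQ : invmx (E (tx t (chart_map c0 (gm t)))) @[t --> (0 : R)^'+] --> invmx (E (tx 0 (chart_map c0 p))).
  apply: (cvg_comp _ (fun y => invmx (E y)) cy); apply/(@cvg_mxP _ _ (nbhs (tx 0 (chart_map c0 p)))) => i j.
  exact: (Ck_continuous (Ck_invE mm 0 i j) Wy).
have nW : \forall t \near (0 : R)^'+, W (tx t (chart_map c0 (gm t))).
  by apply: cy; apply: open_nbhs_nbhs; split=> //; exact: mm_open mm.
have nd : \forall t \near (0 : R)^'+, chart_dom c0 (gm t).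
  have HQ : nbhs (sigma (Num.sqrt 0)) (chart_dom c0).
    by rewrite sqrtr0; apply: open_nbhs_nbhs; split=> //; exact: chart_dom_open.
  have HQ' : \forall s \near Num.sqrt (0 : R), `[0, S]%classic s -> chart_dom c0 (sigma s).
    by rewrite sqrtr0; rewrite sqrtr0 in HQ; exact: phase_base (P in0) _ HQ.
  have HQ2 : \forall u \near (0 : R), `[0, S]%classic (Num.sqrt u) -> chart_dom c0 (sigma (Num.sqrt u)) := @sqrt_continuous R 0 _ HQ'.
  have HQ3 : \forall u \near (0 : R)^'+, `[0, S]%classic (Num.sqrt u) -> chart_dom c0 (sigma (Num.sqrt u)).
    exact: cvg_within HQ2.
  apply: filterS (filterI HQ3 nI) => u [Hu /andP[u0 uT]]; apply: Hu.
  by rewrite /= in_itv; apply: sqrt_time; rewrite (ltW u0).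
(* The velocity is xi G^-1 / (2 sqrt t), so sqrt t times it is xi G^-1 / 2, which tends to w by the
   choice of the initial covector. *)
have lim : 2^-1 *: (xi c0 (Num.sqrt t) *m invmx (E (tx t (chart_map c0 (gm t))))) @[t --> (0 : R)^'+]
    --> 2^-1 *: (xi c0 0 *m invmx (E (tx 0 (chart_map c0 p)))).
  by apply: cvgZl_tmp; exact: cvg_mulmx cxi cQ.
have <- : 2^-1 *: (xi c0 0 *m invmx (E (tx 0 (chart_map c0 p)))) = w.
  rewrite xi0 (mm_eq mm S00 Wy) mulmxK; first by rewrite scalerA mulVf ?scale1r // pnatr_eq0.
  exact: (mm_unit mm Wy).
move: lim; apply: cvg_trans; apply: near_eq_cvg.
apply: filterS (filterI nI (filterI nd nW)) => t [tT [ct Wt]].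
have tT' : 0 <= t <= T by case/andP: tT => a b; rewrite (ltW a).
have st0 : Num.sqrt t != 0 by rewrite gt_eqF // sqrtr_gt0; case/andP: tT.
rewrite -[derive_within _ _ _]/(dcurve T gm c0 t) (dcurve_velocity Ac0 tT ct) (mm_eq mm tT' Wt) scalerA.
by congr (_ *: _); field; rewrite st0.
Qed.

End Backward.

(** * Regularity of the L-exponential map and the conclusion *)

Lemma near_normI (R : realType) (V : normedModType R) (x : V) (P : set V) :
  (exists2 d : R, 0 < d & forall y : V, `|y - x| < d -> P y) -> \forall y \near x, P y.
Proof.
move=> [d d0 Bd]; apply/nbhs_ballP; exists d => //= y.
by rewrite -ball_normE /ball_ /= distrC; exact: Bd.
Qed.

Lemma regular_of_expansion (R : realType) (n m : nat) (M : topologicalType) (A : set (chart R n M)) c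
    (f : 'rV[R]_m -> M) (v : 'rV[R]_m) (B : 'M[R]_(m, n)) (D : 'M[R]_(n, m)) (C e : R) :
  A c -> D *m B = 1%:M -> 0 <= C -> 0 < e ->
  (forall u : 'rV[R]_m, `|u - v| < e -> chart_dom c (f u) /\
     `|chart_map c (f u) - chart_map c (f v) - (u - v) *m B| <= C * `|u - v| ^+ 2) ->
  regular_point A f v.
Proof.
move=> Ac DB C0 e0 Hf.
have [cv _] : chart_dom c (f v) /\ `|chart_map c (f v) - chart_map c (f v) - (v - v) *m B| <= C * `|v - v| ^+ 2.
  by apply: Hf; rewrite subrr normr0.
have [dif dE] : is_diff v (chart_map c \o f) (mulmxr B : 'rV[R]_m -> 'rV[R]_n).
  apply: differentiable_of_remainder.
    move=> y; apply/(@cvg_mxP _ _ (nbhs y)) => i j; rewrite (ord1 i) /= mulmx_entry.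
    under eq_fun do rewrite mulmx_entry.
    by apply: cvg_sum_seq => k; apply: cvgM; [exact: coord_continuous|exact: cvg_cst].
  move=> eps eps0; apply: near_normI; have C1 : 0 < C + 1 by rewrite ltr_wpDl.
  exists (Num.min e (eps / (C + 1))); first by rewrite lt_min e0 divr_gt0.
  move=> u; rewrite lt_min => /andP[/Hf[_ Hu] ue]; apply: (le_trans Hu).
  rewrite expr2 mulrA ler_wpM2r //; apply: (@le_trans _ _ ((C + 1) * `|u - v|)).
    by rewrite ler_wpM2r // lerDl.
  by rewrite mulrC -ler_pdivlMr // ltW.
split.
  have cc : {for v, continuous (chart_map c \o f)} by exact: differentiable_continuous.
  (* The expansion yields continuity of the coordinates of f; continuity as a map into M is
     recovered by applying the inverse chart. *)
  have ci : chart_inv c ((chart_map c \o f) u) @[u --> v] --> f v.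
    rewrite -[X in _ --> X](chart_mapK cv); apply: (cvg_comp (chart_map c \o f) (chart_inv c)); first exact: cc.
    by apply: chart_inv_continuous; exact: map_image.
  have n1 : \forall u \near v, chart_inv c ((chart_map c \o f) u) = f u.
    by apply: near_normI; exists e => // u /Hf[cu _]; exact: chart_mapK cu.
  exact: cvg_trans (near_eq_cvg n1) ci.
exists c; split=> //; move=> y; exists (y *m D); rewrite dE /= -mulmxA DB mulmx1 //.
Qed.

Theorem mainTheorem2 (R : realType) (n : nat) (M : topologicalType)
    (A : set (chart R n M)) (hM : smooth_manifold A)
    (T : R) (hT : 0 < T) (g : tensor_family R n M)
    (hflow : backwards_ricci_flow A T g)
    (hcomplete : forall t, 0 <= t <= T -> complete_metric A (fun c => g c t))
    (hbounded : bounded_curvature_operator A T g)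
    (c0 : chart R n M) (hc0 : A c0) (p : M) (hp : chart_dom c0 p)
    (v : 'rV[R]_n) (gamma : R -> M)
    (hgamma : L_geodesic A T g c0 p v gamma) :
  finite_set [set t : R | 0 < t <= T /\ L_conjugate A T g c0 p v t].
Proof.
have Hsm := L_ham_smooth hT hflow; have Htr := L_ham_transfer hT hflow hM.
have S0 : 0 < Num.sqrt T by rewrite sqrtr_gt0.
have T00 : 0 <= (0 : R) <= T by rewrite lexx ltW.
have P := geodesic_phase hM hT hflow hc0 hp hgamma.
have s0p := sg0 hgamma.
have [rho rho0 Hrho] := reach_end hM Hsm Htr S0 hc0 hp P s0p.
have xi0 : xi_of T g c0 p v gamma c0 0 = 2 *: v *m g c0 0 (chart_map c0 p) by exact: xi_start.
rewrite xi0 in Hrho.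
set G0 := g c0 0 (chart_map c0 p) in Hrho; set eta0 := 2 *: v *m G0 in Hrho.
have uG : G0 \in unitmx by apply: (metric_unit hflow hc0 T00); exact: map_image.
(* The family is made total for [choice]; outside the ball of radius rho its values are dummies. *)
have ex (eta : 'rV[R]_n) : exists q : (R -> M) * (chart R n M -> R -> 'rV[R]_n), `|eta - eta0| < rho ->
    [/\ phase A (L_ham g) 0 (Num.sqrt T) q.1 q.2, q.1 0 = p & q.2 c0 0 = eta].
  have [ne|/Hrho[s [x Hq]]] := leP rho `|eta - eta0|; last by exists (s, x).
  by exists (fun=> p, fun _ _ => 0).
have [F HF] := choice ex.
have fin := conjugate_finite hM Hsm Htr S0 hc0 hp rho0 HF.
apply: sub_finite_set (finite_image (fun s : R => s ^+ 2) fin) => t [tT cj].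
exists (Num.sqrt t); last by rewrite sqr_sqrtr // ltW //; case/andP: tT.
have tT' : 0 <= t <= T by case/andP: tT => a b; rewrite (ltW a).
split; first exact: sqrt_time.
move=> [c [Z [Ac Ex uZ]]]; apply: cj.
have [C [e [C0 e0 He]]] := ex_remainder Ex.
(* The linear isomorphism from initial vectors u to initial covectors 2 u^flat at p. *)
pose L : 'M[R]_n := 2 *: G0.
have uL : L \in unitmx by rewrite unitmxZ // unitfE pnatr_eq0.
(* For u near v a geodesic with initial vector u exists, by projecting the solution of the family,
   and it is unique, so the choice made by [xget] in [L_exp] returns its end point. *)
have expE (u : 'rV[R]_n) : `|u *m L - eta0| < rho -> L_exp A T g c0 p t u = (F (u *m L)).1 (Num.sqrt t).
  move=> /HF[P' s'0 x'0]; have x'E : (F (u *m L)).2 c0 0 = 2 *: u *m g c0 0 (chart_map c0 p).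
    by rewrite x'0 /L -scalemxAr scalemxAl.
  have Lu := phase_geodesic hM hT hflow hc0 hp P' s'0 x'E.
  apply: xget_unique; first by exists (gamma_of (F (u *m L)).1).
  by move=> q [gam Lgam <-]; exact: (geodesic_unique hM hT hflow hc0 hp Lgam Lu tT').
pose k := n%:R * `|L|; have k0 : 0 <= k by rewrite mulr_ge0.
have k1 : 0 < k + 1 by rewrite ltr_wpDl.
have vL : v *m L = eta0 by rewrite /L /eta0 -scalemxAr scalemxAl.
have uLk (u : 'rV[R]_n) : `|u *m L - eta0| <= k * `|u - v|.
  by rewrite -vL -mulmxBl; apply: mxnorm_mul => // i j; exact: mxnorm_entry.
(* By the chain rule the differential of the L-exponential map at v is L followed by the position
   part of Z. The constant C k^2 and the radius e / (k + 1) come from the bound |u L - v L| <= k |u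
   - v|. *)
apply: (@regular_of_expansion R n n M A c _ v (L *m xp Z) (invmx (L *m xp Z)) (C * k ^+ 2) (e / (k + 1))) => //.
- by rewrite mulVmx // unitmx_mul uL.
- by rewrite mulr_ge0 // exprn_ge0.
- by rewrite divr_gt0.
have near_eta (u : 'rV[R]_n) : `|u - v| < e / (k + 1) -> `|u *m L - eta0| < e.
  move=> ue; apply: (le_lt_trans (uLk u)); apply: (@le_lt_trans _ _ ((k + 1) * `|u - v|)).
    by rewrite ler_wpM2r // lerDl.
  by rewrite mulrC -ltr_pdivlMr.
have e0v : `|eta0 - eta0| < rho by rewrite subrr normr0.
move=> u /near_eta /He[ur cu Hu].
rewrite (expE u ur) (expE v) ?vL //; split; first exact: cu.
apply: (@le_trans _ _ (C * `|u *m L - eta0| ^+ 2)); last first.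
  by rewrite -mulrA ler_wpM2l // -exprMn lerXn2r ?nnegrE ?mulr_ge0.
apply: le_trans Hu; apply: mxnorm_le => // i j; rewrite (ord1 i).
apply: le_trans (mxnorm_entry _ 0 (ix j)).
rewrite !addmx_entry !oppmx_entry -!xpE !st_xp xpM mulmxA mulmxBl vL //.
Qed.
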